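(* Let $\mu$ be a co-finite Carleson measure on $\mathbb R_+$ with $H=H_\mu\ne0$, let $h=h_\mu$, $h^{\rm int}(t)=\int_t^\infty h(s)\,ds$, and for $E>0$ let $$\theta_E(t)=\frac{d}{dt}\bigl((H+E)^{-1}h^{\rm int}\bigr)(t),\quad t>0.$$ For $f\in C^\infty_{\mathrm{comp}}(\mathbb R_+)$ and $E>0$ put $$(\Theta f)(E)=-\frac1{\sqrt E}\int_0^\infty\theta_E(t)f(t)\,dt.$$ Then there exists a finite measure $\rho$ on $(0,\infty)$ such that $\Theta$ extends to a partial isometry from $L^2(\mathbb R_+)$ onto $L^2(\rho)$, with $\operatorname{Ker}\Theta=\operatorname{Ker}H$, i.e. the Parseval identity $$\int_0^\infty|(\Theta f)(E)|^2\,d\rho(E)=\|P_{\overline{\operatorname{Ran}H}}f\|^2,\qquad f\in C^\infty_{\mathrm{comp}}(\mathbb R_+),$$ holds true, where $P_{\overline{\operatorname{Ran}H}}$ is the orthogonal projection onto $\overline{\operatorname{Ran}H}$ in $L^2(\mathbb R_+)$. Thus extended, $\Theta$ intertwines $H$ and the multiplication by the independent variable in $L^2(\rho)$, i.e. for $f\in L^2(\mathbb R_+)$ $$(\Theta Hf)(E)=E(\Theta f)(E)\quad\text{for $\rho$-a.e. }E>0.$$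
   Context: $\mathbb R_+=(0,\infty)$. A (non-negative Borel) measure $\mu$ on $\mathbb R_+$ is Carleson if $\mu([0,a))\le C_\mu a$ for all $a>0$ with some constant $C_\mu$; it is co-finite if $\int_0^\infty\lambda^{-2}\,d\mu(\lambda)<\infty$. Put $h_\mu(t)=\int_0^\infty e^{-t\lambda}\,d\mu(\lambda)$, $t>0$, and let $(H_\mu f)(t)=\int_0^\infty h_\mu(t+s)f(s)\,ds$ on $L^2(\mathbb R_+)$; $H_\mu$ is bounded, self-adjoint and positive semi-definite. For co-finite Carleson $\mu$ one has $h^{\rm int}\in L^2(\mathbb R_+)$, and for $E>0$ the function $(H+E)^{-1}h^{\rm int}$ is infinitely smooth on $(0,\infty)$, so that $\theta_E$ is well-defined. $C^\infty_{\mathrm{comp}}(\mathbb R_+)$ is the set of infinitely smooth functions with compact support in $(0,\infty)$. *)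

(* Defs.v *)
From mathcomp Require Import all_boot all_order all_algebra.
From mathcomp Require Import all_classical all_reals all_analysis.
From mathcomp Require Import complex.

Set Implicit Arguments.
Unset Strict Implicit.
Unset Printing Implicit Defensive.

Import Order.TTheory GRing.Theory Num.Theory.
Import numFieldNormedType.Exports.
Import ComplexField.Normc.

Local Open Scope classical_set_scope.
Local Open Scope ring_scope.
Local Open Scope complex_scope.

(* Measures on (0,oo) are Borel measures on the line that vanish off (0,oo).
   Elements of the complex L^2 spaces are handled through representatives:
   functions R -> R[i], of which only the values on (0,oo) matter, equality of
   classes being almost everywhere equality on (0,oo). *)

Section L2.
Context {R : realType}.
Implicit Types (m : {measure set (measurableTypeR R) -> \bar R})
  (f g : R -> R[i]) (S : set (R -> R[i])).

Definition Rpos : set R := `]0, +oo[.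

Definition carried_by_Rpos m : Prop := m (~` Rpos) = 0%E.

Definition cintegral m f : R[i] :=
  (\int[m]_(x in Rpos) complex.Re (f x)) +i*
  (\int[m]_(x in Rpos) complex.Im (f x)).

Definition L2 m : set (R -> R[i]) := [set f : R -> R[i] |
  [/\ measurable_fun (Rpos : set (measurableTypeR R)) (fun x => complex.Re (f x)),
      measurable_fun (Rpos : set (measurableTypeR R)) (fun x => complex.Im (f x))
    & (\int[m]_(x in Rpos) (normc (f x) ^+ 2)%:E < +oo)%E]].

Definition L2norm m f : R := Num.sqrt (\int[m]_(x in Rpos) (normc (f x) ^+ 2)).

Definition L2inner m f g : R[i] := cintegral m (fun x => f x * (g x)^*).

Definition L2closure m S : set (R -> R[i]) := [set f : R -> R[i] | L2 m f /\
  forall e : R, 0 < e -> exists2 g, S g & L2norm m (fun x => f x - g x) < e].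

(* A representative of the orthogonal projection of f onto the closure of S. *)
Definition L2proj_closure m S f : R -> R[i] :=
  xget (fun=> 0) [set p | L2closure m S p /\
    forall q, L2closure m S q -> L2inner m (fun x => f x - p x) q = 0].

Definition L2kernel m m' (T : (R -> R[i]) -> R -> R[i]) : set (R -> R[i]) :=
  [set f | L2 m f /\ T f = (fun=> 0) %[ae m' in Rpos]].

Definition L2range m (T : (R -> R[i]) -> R -> R[i]) : set (R -> R[i]) :=
  T @` L2 m.

Definition L2bounded_operator m m' (T : (R -> R[i]) -> R -> R[i]) : Prop :=
  [/\ forall f, L2 m f -> L2 m' (T f),
      forall f g, L2 m f -> L2 m g -> f = g %[ae m in Rpos] ->
        T f = T g %[ae m' in Rpos],
      forall (a : R[i]) f g, L2 m f -> L2 m g ->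
        T (fun x => a * f x + g x) = (fun x => a * T f x + T g x)
          %[ae m' in Rpos]
    & exists C : R, forall f, L2 m f -> L2norm m' (T f) <= C * L2norm m f].

Definition partial_isometry m m' (T : (R -> R[i]) -> R -> R[i]) : Prop :=
  L2bounded_operator m m' T /\
  forall f, L2 m f -> (forall g, L2kernel m m' T g -> L2inner m f g = 0) ->
    L2norm m' (T f) = L2norm m f.

Definition L2onto m m' (T : (R -> R[i]) -> R -> R[i]) : Prop :=
  forall g, L2 m' g -> exists2 f, L2 m f & T f = g %[ae m' in Rpos].

Definition smooth_on_Rpos f : Prop := forall (n : nat) (t : R), 0 < t ->
  derivable (derive1n n (fun x => complex.Re (f x))) t 1 /\
  derivable (derive1n n (fun x => complex.Im (f x))) t 1.

Definition cderive f (t : R) : R[i] :=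
  derive1 (fun x => complex.Re (f x)) t +i*
  derive1 (fun x => complex.Im (f x)) t.

Definition test_function f : Prop :=
  [/\ smooth_on_Rpos f,
      compact (closure [set t | f t != 0])
    & closure [set t | f t != 0] `<=` Rpos].

End L2.

Section Hankel.
Context {R : realType}.
Variable mu : {measure set (measurableTypeR R) -> \bar R}.
Implicit Types (f g k : R -> R[i]) (E t : R).

Local Notation leb := (@lebesgue_measure R).

Definition Carleson : Prop :=
  exists C : R, forall a : R, 0 < a -> (mu `[0%R, a[%classic <= (C * a)%:E)%E.

Definition cofinite_measure : Prop :=
  (\int[mu]_(l in Rpos) (l ^- 2)%:E < +oo)%E.

Definition hankel_kernel t : R := \int[mu]_(l in Rpos) expR (- (t * l)).

Definition hankel f : R -> R[i] :=
  fun t => cintegral leb (fun s => (hankel_kernel (t + s))%:C * f s).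

Definition hankel_kernel_int t : R :=
  \int[leb]_(s in `]t, +oo[) hankel_kernel s.

(* The representatives of (H + E)^-1 k. *)
Definition resolvent E k : set (R -> R[i]) := [set g : R -> R[i] | L2 leb g /\
  (fun t => hankel g t + E%:C * g t) = k %[ae leb in Rpos]].

(* The representative of (H + E)^-1 h^int that is smooth on (0,oo). *)
Definition smooth_resolvent_hint E : R -> R[i] :=
  xget (fun=> 0)
    (resolvent E (fun t => (hankel_kernel_int t)%:C) `&` smooth_on_Rpos).

Definition theta E : R -> R[i] := cderive (smooth_resolvent_hint E).

Definition Theta f : R -> R[i] := fun E =>
  - ((Num.sqrt E)^-1)%:C * cintegral leb (fun t => theta E t * f t).

End Hankel.

(* Main.v *)
Require Import Defs.
From HB Require Import structures.
From mathcomp Require Import all_boot all_order all_algebra.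
From mathcomp Require Import all_classical all_reals all_analysis.
From mathcomp Require Import measurable_realfun complex ring lra zify.
Set Implicit Arguments.
Unset Strict Implicit.
Unset Printing Implicit Defensive.
Import Order.TTheory GRing.Theory Num.Theory.
Import numFieldNormedType.Exports.
Import ComplexField.Normc.
Local Open Scope classical_set_scope.
Local Open Scope ring_scope.
Local Open Scope complex_scope.

(** Complex functions enter only through their real and imaginary parts, since the
    kernel of [H] is real; the analysis is done for real functions.

    Let [L] be the Laplace transform from L^2(0,oo) to L^2(mu).  It is bounded by
    Schur's test with the weights [x^(-1/2)], whose hypothesis for [mu] is the
    Carleson condition ([schur_carleson], [lap_bounded]), and [H = L* L]
    ([hankel_LsL]).  The operator [G = L L*] on L^2(mu) has the kernel
    [1 / (x + y)]; it is positive and, the Laplace transform being injective, its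
    null space is trivial.  As [mu] is co-finite, the function [v x = 1 / x] is in L^2(mu), and
    [L* v = h^int] ([hint_Ls]).

    Let [A] be the operator [(A y) l = (G y) l / l].  Partial fractions
    ([Gop_div]) give the Lyapunov equation [A G + G A = <., G v> v].  It has two
    consequences, both obtained from [anticommute0]: a bounded operator that
    anticommutes with a positive one is annihilated by it, because
    [(1 - N) ^+ n] stays bounded while [(1 + N) ^+ n] grows.
    - The vectors [G^n v] are total: on their orthogonal complement the right-hand
      side vanishes, so that [A] anticommutes with [G] there ([cyclic]).  The
      Hausdorff moment problem for the moments [<G^n v, v>] ([hausdorff]) then
      yields a finite measure [s] on [[0, B]], without an atom at [0], and a unitary
      map [Phi] from L^2(mu) to L^2(s) that takes [v] to [1] and [G] to the
      multiplication by the variable.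
    - [Phi] takes [A] to the Stieltjes operator that maps [w] to the integral of
      [x / (x + E) * w x], since this operator solves the same equation
      ([representation]).

    Put [rho = s].  The transform is [f |-> E^(-1/2) * Phi (L f)], the isometric
    factor of the polar decomposition of [L]: it is a partial isometry with the
    kernel of [H], it is onto ([Top_onto]), and it takes [H = L* L] to the
    multiplication by [E] because [Phi L L* L f = E * Phi L f].

    It remains to recognize [Theta].  One has
    [(H + E)^-1 h^int = L* (G + E)^-1 v], and [Phi] takes [(G + E)^-1 v] to
    [1 / (x + E)].  For a test function [f], integration by parts gives
    [- \int theta_E f = \int (H + E)^-1 h^int f' = \int Phi (L f') x / (x + E) ds(x)].
    As [L f'] is [l * L f], the formula [G (L f) = <L f', v> v - A (L f')] becomes,
    after [Phi] is applied, [E * Phi (L f) E = \int (1 - x / (x + E)) Phi (L f') x ds(x)],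
    so that the previous integral is [Phi (L f) E] ([qfun_div], [Theta_test]). *)

(** * Semi-inner product spaces *)

Section RealBounds.
Context {R : realType}.
Implicit Types a b e : R.

(** The discriminant of a quadratic polynomial that is bounded below by [- e]. *)
Lemma quadratic_bound a b e : 0 <= a ->
  (forall t : R, 2 * t * b <= t ^+ 2 * a + e) -> b ^+ 2 <= a * e.
Proof.
rewrite le_eqVlt => /orP[/eqP<- H|a0 H].
  suff -> : b = 0 by rewrite expr0n mul0r.
  apply/eqP/negPn/negP => b0; have := H ((e + 1) / b).
  by rewrite mulr0 add0r mulrA divfK// => h; have := H 0; lra.
have := H (b / a); rewrite -subr_ge0 => h; rewrite -subr_ge0.
suff -> : a * e - b ^+ 2 = a * ((b / a) ^+ 2 * a + e - 2 * (b / a) * b).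
  by rewrite mulr_ge0// ltW.
by field; rewrite gt_eqF.
Qed.

Lemma sqrD_le a b : (a + b) ^+ 2 <= 2 * a ^+ 2 + 2 * b ^+ 2.
Proof. by have := sqr_ge0 (a - b); rewrite sqrrB sqrrD; lra. Qed.

Lemma eps_le0 (c K : R) : (forall e : R, 0 < e -> c <= K * e) -> c <= 0.
Proof.
move=> H; rewrite leNgt; apply/negP => c0.
have K1 : 0 < `|K| + 1 by rewrite ltr_wpDl.
have := H (c / 2 / (`|K| + 1)) (divr_gt0 (divr_gt0 c0 (ltr0Sn _ _)) K1).
apply/negP; rewrite -ltNge mulrA ltr_pdivrMr//.
have := mulr_ge0 (ltW c0) (normr_ge0 K).
have := ler_wpM2l (ltW c0) (ler_norm K); lra.
Qed.

End RealBounds.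

(** A complete real space with a positive semi-definite form.  Vectors of norm
    zero are not identified with 0: square-integrable functions can then be
    used themselves, and equality of classes is [nsq (x - y) = 0]. *)
Record hspace (R : realType) := HSpace {
  hcar :> lmodType R;
  dot : hcar -> hcar -> R;
  dotC : forall x y, dot x y = dot y x;
  dotDZl : forall a x y z, dot (a *: x + y) z = a * dot x z + dot y z;
  dot_ge0 : forall x, 0 <= dot x x;
  dot_complete : forall u : nat -> hcar,
    (forall e : R, 0 < e -> exists N, forall m n, (N <= m)%N -> (N <= n)%N ->
       dot (u m - u n) (u m - u n) < e) ->
    exists l, forall e : R, 0 < e -> exists N, forall n, (N <= n)%N ->
       dot (u n - l) (u n - l) < e }.

Arguments dot {R h} x y : rename.

Section SemiInner.
Context {R : realType} {V : hspace R}.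
Implicit Types (x y z u : V) (a b : R).

Definition nsq x : R := dot x x.

Lemma nsq_ge0 x : 0 <= nsq x. Proof. exact: dot_ge0. Qed.

Lemma dotDl x y z : dot (x + y) z = dot x z + dot y z.
Proof. by have := dotDZl 1 x y z; rewrite scale1r mul1r. Qed.

Lemma dot0l x : dot 0 x = 0.
Proof. by apply: (addrI (dot 0 x)); rewrite -dotDl !addr0. Qed.

Lemma dotZl a x y : dot (a *: x) y = a * dot x y.
Proof. by rewrite -[a *: x]addr0 dotDZl dot0l addr0. Qed.

Lemma dotNl x y : dot (- x) y = - dot x y.
Proof. by rewrite -scaleN1r dotZl mulN1r. Qed.

Lemma dotBl x y z : dot (x - y) z = dot x z - dot y z.
Proof. by rewrite dotDl dotNl. Qed.

Lemma dotDr x y z : dot z (x + y) = dot z x + dot z y.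
Proof. by rewrite dotC dotDl !(dotC z). Qed.

Lemma dotZr a x y : dot y (a *: x) = a * dot y x.
Proof. by rewrite dotC dotZl (dotC y). Qed.

Lemma dotNr x y : dot y (- x) = - dot y x.
Proof. by rewrite dotC dotNl (dotC y). Qed.

Lemma dotBr x y z : dot z (x - y) = dot z x - dot z y.
Proof. by rewrite dotC dotBl !(dotC z). Qed.

Lemma dot0r x : dot x 0 = 0. Proof. by rewrite dotC dot0l. Qed.

Definition dotE := (dotDl, dotDr, dotNl, dotNr, dotZl, dotZr, dot0l, dot0r).

Lemma dot_sumr (I : Type) (r : seq I) (P : pred I) (F : I -> V) z :
  dot z (\sum_(i <- r | P i) F i) = \sum_(i <- r | P i) dot z (F i).
Proof. by apply: (big_morph (fun x => dot z x)) => [x y|]; rewrite ?dotDr ?dot0r. Qed.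

Lemma nsqD x y : nsq (x + y) = nsq x + 2 * dot x y + nsq y.
Proof. rewrite /nsq !dotE (dotC y x); ring. Qed.

Lemma nsqN x : nsq (- x) = nsq x.
Proof. by rewrite /nsq dotNl dotNr opprK. Qed.

Lemma nsqB x y : nsq (x - y) = nsq x - 2 * dot x y + nsq y.
Proof. by rewrite nsqD nsqN dotNr mulrN. Qed.

Lemma nsqBC x y : nsq (x - y) = nsq (y - x).
Proof. by rewrite -nsqN opprB. Qed.

Lemma nsqZ a x : nsq (a *: x) = a ^+ 2 * nsq x.
Proof. by rewrite /nsq dotZl dotZr mulrA. Qed.

Lemma nsq0 : nsq 0 = 0. Proof. exact: dot0l. Qed.

Lemma nsqD_le x y : nsq (x + y) <= 2 * nsq x + 2 * nsq y.
Proof. have := nsq_ge0 (x - y); rewrite nsqB nsqD; lra. Qed.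

Lemma cauchy_schwarz x y : dot x y ^+ 2 <= nsq x * nsq y.
Proof.
apply: quadratic_bound (nsq_ge0 x) _ => t.
by have := nsq_ge0 (t *: x - y); rewrite nsqB nsqZ dotZl; lra.
Qed.

Lemma nsq0_dot x y : nsq x = 0 -> dot x y = 0.
Proof.
by move=> x0; have := cauchy_schwarz x y; rewrite x0 mul0r => h;
  apply/eqP; rewrite -sqrf_eq0 eq_le h sqr_ge0.
Qed.

Lemma nsqD0 x y : nsq x = 0 -> nsq y = 0 -> nsq (x + y) = 0.
Proof. by move=> x0 y0; rewrite nsqD x0 y0 nsq0_dot// mulr0 !addr0. Qed.

Lemma nsqZ0 a x : nsq x = 0 -> nsq (a *: x) = 0.
Proof. by rewrite nsqZ => ->; rewrite mulr0. Qed.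

Lemma nsqB0_dot x y z : nsq (x - y) = 0 -> dot x z = dot y z.
Proof. by move=> /(@nsq0_dot _ z)/eqP; rewrite dotBl subr_eq0 => /eqP. Qed.

Lemma nsqB0 x y : nsq (x - y) = 0 -> nsq x = nsq y.
Proof.
by move=> xy; rewrite /nsq (nsqB0_dot x xy) dotC (nsqB0_dot y xy).
Qed.

Lemma perp_nsq x p : dot (x - p) p = 0 ->
  dot x (x - p) = nsq (x - p).
Proof. by move=> h; rewrite [RHS]/nsq [RHS]dotBr h subr0 dotC. Qed.

Lemma pythagoras x p : dot (x - p) p = 0 ->
  nsq x = nsq p + nsq (x - p).
Proof.
move=> h; have := nsqD (x - p) p.
by rewrite subrK h => ->; ring.
Qed.

(** Completeness is used to attain the distance from [u] to the subspace; the
    minimizer differs from [u] by a vector orthogonal to the subspace, hence of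
    norm zero. *)
Lemma total_dense (S : V -> Prop) :
  S 0 -> (forall a x y, S x -> S y -> S (a *: x + y)) ->
  (forall x, (forall s, S s -> dot x s = 0) -> nsq x = 0) ->
  forall x (e : R), 0 < e -> exists2 s, S s & nsq (x - s) < e.
Proof.
move=> S0 SDZ Stot x e e0.
pose D := [set nsq (x - s) | s in [set s | S s]].
have D_lb : lbound D 0 by move=> _ [s _ <-]; exact: nsq_ge0.
have D_inf : has_inf D by split; [exists (nsq (x - 0)), 0|exists 0].
set d := inf D.
have d_le s : S s -> d <= nsq (x - s).
  by move=> Ss; apply: ge_inf; [exists 0|exists s].
have /choice[s sP] : forall n : nat, exists s, S s /\ nsq (x - s) < d + n.+1%:R^-1.
  move=> n; have n0 : 0 < n.+1%:R^-1 :> R by rewrite invr_gt0.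
  by have [_ [s Ss <-] sd] := inf_adherent n0 D_inf; exists s.
have SsZ n : S (s n) by have [] := sP n.
have sd n : nsq (x - s n) < d + n.+1%:R^-1 by have [] := sP n.
have inv_le (N n : nat) : (N <= n)%N -> n.+1%:R^-1 <= N.+1%:R^-1 :> R.
  by move=> Nn; rewrite lef_pV2 ?posrE ?ltr0n// ler_nat.
have s_cauchy (e' : R) : 0 < e' -> exists N, forall m n, (N <= m)%N -> (N <= n)%N ->
    dot (s m - s n) (s m - s n) < e'.
  move=> e'0; have [N Ne] : exists N, N.+1%:R^-1 < e' / 4.
    have e4 : 0 < e' / 4 by rewrite divr_gt0.
    have := near_infty_natSinv_lt (PosNum e4) => -[N _ /(_ N (leqnn N))/= ?].
    by exists N.
  exists N => m n Nm Nn; rewrite -/(nsq _).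
  (* The parallelogram identity at the midpoint of [s m] and [s n]. *)
  have Smid : S (2^-1 *: s m + 2^-1 *: s n).
    by apply: (SDZ) => //; rewrite -[_ *: _]addr0; exact: (SDZ).
  have := d_le _ Smid; have := sd m; have := sd n.
  have := inv_le _ _ Nm; have := inv_le _ _ Nn.
  rewrite /nsq !dotE !(dotC (s m) x) !(dotC (s n) x) (dotC (s n) (s m)).
  move: (n.+1%:R^-1) (m.+1%:R^-1) (N.+1%:R^-1) Ne => a b c *; lra.
have [l lP] := dot_complete s_cauchy.
have small (e' : R) : 0 < e' -> exists n, nsq (s n - l) < e' /\ n.+1%:R^-1 < e'.
  move=> e'0; have [N HN] := lP _ e'0.
  have := near_infty_natSinv_lt (PosNum e'0) => -[M _ /(_ (maxn N M))/= HM].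
  by exists (maxn N M); split; [apply: HN; rewrite leq_maxl|
    apply: HM; exact: leq_maxr].
have xl0 : nsq (x - l) = 0.
  apply: Stot => r Sr; apply/eqP; rewrite -sqrf_eq0 eq_le sqr_ge0 andbT.
  apply: (@eps_le0 R _ (4 * nsq r)) => e' /small[n [nl ne]].
  have b1 : dot r (x - s n) ^+ 2 <= nsq r * e'.
    apply: quadratic_bound (nsq_ge0 r) _ => t.
    have St : S (t *: r + s n) by exact: (SDZ).
    have := d_le _ St; have := sd n.
    rewrite /nsq !dotE !(dotC (s n) x) !(dotC r x) (dotC (s n) r).
    move: (n.+1%:R^-1) ne => a *; lra.
  have b2 := cauchy_schwarz r (s n - l).
  have b3 : nsq r * nsq (s n - l) <= nsq r * e' by rewrite ler_wpM2l ?nsq_ge0// ltW.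
  have -> : dot (x - l) r = dot r (x - s n) + dot r (s n - l).
    by rewrite -dotDr addrA subrK dotC.
  by apply: le_trans (sqrD_le _ _) _; lra.
have [n [nl _]] := small (e / 2) (divr_gt0 e0 (ltr0Sn _ _)).
exists (s n) => //; have := nsqD_le (x - l) (l - s n).
by rewrite addrA subrK xl0 nsqBC in nl *; lra.
Qed.

End SemiInner.

(** * Vectors with the same Gram matrix *)

Section Lin.
Context {R : realType} {V : lmodType R}.
Implicit Types (f : nat -> V) (p q : {poly R}).

(** Polynomials serve as names for the finite combinations of a sequence:
    [lin f] is the linear map that takes ['X^n] to [f n]. *)
Definition lin f p : V := \sum_(i < size p) p`_i *: f i.

Lemma lin_widen f p n : (size p <= n)%N -> lin f p = \sum_(i < n) p`_i *: f i.
Proof.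
move=> pn; rewrite /lin (big_ord_widen n (fun i => p`_i *: f i))//.
rewrite big_mkcond/=; apply: eq_bigr => i _; case: ltnP => // h.
by rewrite nth_default// scale0r.
Qed.

Lemma linDZ f a p q : lin f (a *: p + q) = a *: lin f p + lin f q.
Proof.
pose n := maxn (size (a *: p + q)) (maxn (size p) (size q)).
rewrite !(@lin_widen _ _ n) ?leq_max ?leqnn ?orbT//.
rewrite scaler_sumr -big_split/=; apply: eq_bigr => i _.
by rewrite coefD coefZ scalerDl scalerA.
Qed.

Lemma lin0 f : lin f 0 = 0.
Proof. by rewrite /lin size_poly0 big_ord0. Qed.

Lemma linB f p q : lin f (p - q) = lin f p - lin f q.
Proof. by have := linDZ f (-1) q p; rewrite !scaleN1r ![- _ + _]addrC. Qed.

Lemma linXn f n : lin f 'X^n = f n.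
Proof.
rewrite /lin size_polyXn (bigD1 ord_max)//= coefXn eqxx scale1r big1 ?addr0//.
by move=> i; rewrite coefXn -val_eqE/= => /negbTE ->; rewrite scale0r.
Qed.

End Lin.

Section Gram.
Context {R : realType} {Y Z : hspace R} (y : nat -> Y) (z : nat -> Z).
Hypothesis gram : forall i j, dot (y i) (y j) = dot (z i) (z j).
Hypothesis y_total : forall u, (forall n, dot u (y n) = 0) -> nsq u = 0.
Hypothesis z_total : forall u, (forall n, dot u (z n) = 0) -> nsq u = 0.

(** The graph, up to vectors of norm zero, of the unitary map that takes
    [y n] to [z n] for every [n]. *)
Definition corr (u : Y) (w : Z) := forall n, dot w (z n) = dot u (y n).

Lemma corrDZ a u u' w w' :
  corr u w -> corr u' w' -> corr (a *: u + u') (a *: w + w').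
Proof. by move=> c c' n; rewrite !dotE c c'. Qed.

Lemma corr_y n : corr (y n) (z n). Proof. by move=> m; rewrite gram. Qed.

Lemma dot_lin (V : hspace R) (f : nat -> V) p u :
  dot u (lin f p) = \sum_(i < size p) p`_i * dot u (f i).
Proof. by rewrite dot_sumr; apply: eq_bigr => i _; rewrite dotZr. Qed.

Lemma corr_lin u w p : corr u w -> dot w (lin z p) = dot u (lin y p).
Proof. by move=> c; rewrite !dot_lin; apply: eq_bigr => i _; rewrite c. Qed.

Lemma corr_linlin p : corr (lin y p) (lin z p).
Proof.
move=> n; rewrite dotC [RHS]dotC !dot_lin.
by apply: eq_bigr => i _; rewrite gram.
Qed.

Lemma nsq_linlin p : nsq (lin z p) = nsq (lin y p).
Proof. by rewrite /nsq (corr_lin _ (corr_linlin p)). Qed.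

End Gram.

Lemma lin_dense (R : realType) (V : hspace R) (f : nat -> V) :
  (forall u, (forall n, dot u (f n) = 0) -> nsq u = 0) ->
  forall u (e : R), 0 < e -> exists p, nsq (u - lin f p) < e.
Proof.
move=> tot u e e0.
have [|a x y [p ->] [q ->]|x xS|_ [p ->] ?] :=
  @total_dense _ V (fun s => exists p, s = lin f p) _ _ _ u e e0.
- by exists 0; rewrite lin0.
- by exists (a *: p + q); rewrite linDZ.
- by apply: tot => n; apply: xS; exists 'X^n; rewrite linXn.
- by exists p.
Qed.

Section GramExists.
Context {R : realType} {Y Z : hspace R} (y : nat -> Y) (z : nat -> Z).
Hypothesis gram : forall i j, dot (y i) (y j) = dot (z i) (z j).
Hypothesis y_total : forall u, (forall n, dot u (y n) = 0) -> nsq u = 0.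
Hypothesis z_total : forall u, (forall n, dot u (z n) = 0) -> nsq u = 0.

(** Combinations of the [y n] that approach [u] have mutual distances that are
    determined by the Gram matrix; the same combinations of the [z n] therefore
    form a Cauchy sequence. *)
Lemma corr_exists u : exists w, corr y z u w.
Proof.
have /choice[p pP] : forall k : nat, exists p, nsq (u - lin y p) < k.+1%:R^-1.
  by move=> k; apply: lin_dense => //; rewrite invr_gt0.
have inv_le (N n : nat) : (N <= n)%N -> n.+1%:R^-1 <= N.+1%:R^-1 :> R.
  by move=> Nn; rewrite lef_pV2 ?posrE ?ltr0n// ler_nat.
have [|w wP] := @dot_complete _ Z (fun k => lin z (p k)).
  move=> e e0; have e4 : 0 < e / 4 by rewrite divr_gt0.
  have := near_infty_natSinv_lt (PosNum e4) => -[N _ /(_ N (leqnn N))/= NE].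
  exists N => m n Nm Nn; rewrite -linB -/(nsq _) (nsq_linlin gram) linB.
  have -> : lin y (p m) - lin y (p n) = (u - lin y (p n)) - (u - lin y (p m)).
    by rewrite opprB [RHS]addrC addrA subrK.
  have := nsqD_le (u - lin y (p n)) (- (u - lin y (p m))).
  rewrite nsqN; have := pP m; have := pP n.
  have := inv_le _ _ Nm; have := inv_le _ _ Nn.
  by move: (n.+1%:R^-1) (m.+1%:R^-1) (N.+1%:R^-1) NE => a b c *; lra.
exists w => n; apply/eqP; rewrite -subr_eq0 -sqrf_eq0 eq_le sqr_ge0 andbT.
apply: (@eps_le0 R _ (4 * nsq (y n))) => e e0.
have [N NP] := wP _ e0.
have := near_infty_natSinv_lt (PosNum e0) => -[M _ /(_ (maxn N M) (leq_maxr _ _))/= ME].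
set k := maxn N M in ME; have := NP k (leq_maxl _ _); rewrite -/(nsq _) => wk.
have c1 := cauchy_schwarz (y n) (u - lin y (p k)).
have c2 := cauchy_schwarz (z n) (lin z (p k) - w).
have zy : nsq (z n) = nsq (y n) by rewrite /nsq gram.
have E : dot (y n) (lin y (p k)) = dot (z n) (lin z (p k)).
  by rewrite dotC [RHS]dotC (corr_linlin gram).
have -> : dot w (z n) - dot u (y n) =
    - (dot (y n) (u - lin y (p k)) + dot (z n) (lin z (p k) - w)).
  rewrite !dotBr E (dotC w) (dotC u); ring.
rewrite sqrrN; apply: le_trans (sqrD_le _ _) _.
have b1 : nsq (y n) * nsq (u - lin y (p k)) <= nsq (y n) * e.
  by rewrite ler_wpM2l ?nsq_ge0// ltW// (lt_trans (pP k)).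
have b2 : nsq (z n) * nsq (lin z (p k) - w) <= nsq (z n) * e.
  by rewrite ler_wpM2l ?nsq_ge0// ltW.
by rewrite zy in b2 c2; lra.
Qed.

Lemma corr_nsq_le u w : corr y z u w -> nsq u <= nsq w.
Proof.
move=> c; rewrite -subr_le0; apply: (@eps_le0 R _ 1) => e e0; rewrite mul1r.
have [p pe] := lin_dense y_total u e0.
have := nsq_ge0 (w - lin z p); rewrite nsqB (corr_lin _ c) (nsq_linlin gram).
move: pe; rewrite nsqB; lra.
Qed.

End GramExists.

Section GramUnitary.
Context {R : realType} {Y Z : hspace R} (y : nat -> Y) (z : nat -> Z).
Hypothesis gram : forall i j, dot (y i) (y j) = dot (z i) (z j).
Hypothesis y_total : forall u, (forall n, dot u (y n) = 0) -> nsq u = 0.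
Hypothesis z_total : forall u, (forall n, dot u (z n) = 0) -> nsq u = 0.

Lemma corr_sym u w : corr y z u w <-> corr z y w u.
Proof. by split => c n; rewrite c. Qed.

Lemma corr_nsq u w : corr y z u w -> nsq w = nsq u.
Proof.
move=> c; apply/eqP; rewrite eq_le (corr_nsq_le gram y_total c) andbT.
by apply: (@corr_nsq_le _ Z Y z y _ z_total w u) => [i j|]; [rewrite gram|exact/corr_sym].
Qed.

Lemma corr_dot u u' w w' : corr y z u w -> corr y z u' w' -> dot w w' = dot u u'.
Proof.
move=> c c'; have := corr_nsq (corrDZ 1 c c').
by rewrite !scale1r !nsqD (corr_nsq c) (corr_nsq c') => /addIr/addrI; lra.
Qed.

Lemma corr_uniq u w w' : corr y z u w -> corr y z u w' -> nsq (w - w') = 0.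
Proof. by move=> c c'; apply: z_total => n; rewrite dotBl c c' subrr. Qed.

(** The hypotheses are symmetric in [y] and [z]. *)
Lemma corr_surj w : exists u, corr y z u w.
Proof.
have [|u c] := @corr_exists _ _ _ z y _ z_total w.
  by move=> i j; rewrite gram.
by exists u; apply/corr_sym.
Qed.

End GramUnitary.

(** * Operators that anticommute with a positive operator *)

Section Anticommute.
Context {R : realType}.

(** For positive [N] the numbers [nsq ((1 + N) ^+ n z)] grow at least linearly,
    with slope [nsq (N z)]. *)
Lemma bounded_growth0 (Z : hspace R) (N : {linear Z -> Z}) (z : Z) (c : R) :
  (forall x, 0 <= dot (N x) x) ->
  (forall n, nsq (iter n (fun x => x + N x) z) <= c) -> nsq (N z) = 0.
Proof.
move=> N0 zc; pose F x := x + N x.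
have NF n x : N (iter n F x) = iter n F (N x).
  by elim: n => // n IH; rewrite !iterS /F linearD/= -IH.
have F_ge x : nsq x + nsq (N x) <= nsq (F x).
  by rewrite nsqD dotC; have := N0 x; lra.
have F_mono n x : nsq x <= nsq (iter n F x).
  elim: n => // n IH; rewrite iterS; apply: le_trans IH _.
  by have := F_ge (iter n F x); have := nsq_ge0 (N (iter n F x)); lra.
have lower n : n%:R * nsq (N z) <= nsq (iter n F z).
  elim: n => [|n IH]; first by rewrite mul0r nsq_ge0.
  rewrite iterS; have := F_ge (iter n F z); rewrite NF.
  by have := F_mono n (N z); rewrite -natr1; lra.
apply/eqP; rewrite eq_le nsq_ge0 andbT leNgt; apply/negP => Nz0.
have c0 : 0 <= c by apply: le_trans (zc 0%N); exact: nsq_ge0.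
have := archi_boundP (divr_ge0 c0 (ltW Nz0)); rewrite ltr_pdivrMr//.
by apply/negP; rewrite -leNgt; apply: le_trans (lower _) (zc _).
Qed.

(** If [D N1 = - N2 D] with [N1], [N2] positive, then
    [D (1 - N1) ^+ n = (1 + N2) ^+ n D], where the left-hand side stays bounded
    because [1 - N1] is a contraction: hence [N2 D = 0]. *)
Lemma anticommute0 (Y Z : hspace R) (P : Y -> Prop) (N1 : {linear Y -> Y})
    (N2 : {linear Z -> Z}) (D : Y -> Z) (c : R) :
  (forall x, nsq (N1 x) <= dot (N1 x) x) ->
  (forall x, 0 <= dot (N2 x) x) ->
  (forall x, nsq x = 0 -> nsq (N2 x) = 0) ->
  (forall x, P x -> P (x - N1 x)) ->
  0 <= c -> (forall x, P x -> nsq (D x) <= c * nsq x) ->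
  (forall x, P x -> nsq (D (x - N1 x) - (D x + N2 (D x))) = 0) ->
  forall x, P x -> nsq (N2 (D x)) = 0.
Proof.
move=> N1c N20 N2null PN c0 Dc DN x Px.
apply: (@bounded_growth0 _ _ _ (c * nsq x)) => // n.
pose B y := y - N1 y; pose F z := z + N2 z.
have B_le y : nsq (B y) <= nsq y.
  by rewrite nsqB dotC; have := N1c y; have := nsq_ge0 (N1 y); lra.
have PB m y : P y -> P (iter m B y) by move=> Py; elim: m => //= m; exact: PN.
have Bn_le m y : nsq (iter m B y) <= nsq y.
  by elim: m => //= m; apply: le_trans.
have DB m y : P y -> nsq (D (iter m B y) - iter m F (D y)) = 0.
  move=> Py; elim: m => [|m IH]; first by rewrite subrr nsq0.
  rewrite !iterS; set u := iter m B y in IH *; set w := iter m F (D y) in IH *.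
  have -> : D (B u) - F w = (D (B u) - F (D u)) + ((D u - w) + N2 (D u - w)).
    by rewrite /F linearB /= opprD [D u - w + _]addrACA -opprD addrA subrK.
  by apply: nsqD0; [exact/DN/PB|apply: nsqD0 => //; exact: N2null].
rewrite -(nsqB0 (DB n x Px)); apply: le_trans (Dc _ (PB _ _ Px)) _.
by rewrite ler_wpM2l.
Qed.

End Anticommute.

(** * Real square-integrable functions *)

Section L2real.
Context d (T : measurableType d) (R : realType).
Variables (m : {measure set T -> \bar R}) (D : set T) (mD : measurable D).
Implicit Types (f g : T -> R) (a : R).

Definition sqint f : Prop :=
  measurable_fun D f /\ m.-integrable D (EFin \o (fun x => f x ^+ 2)).

Lemma sqintP f : measurable_fun D f ->
  (\int[m]_(x in D) (f x ^+ 2)%:E < +oo)%E -> sqint f.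
Proof.
move=> mf f2; split=> //; apply/integrableP; split.
  by apply/measurable_EFinP; exact: measurable_funX.
by under eq_integral => x _ do rewrite /= ger0_norm ?sqr_ge0//.
Qed.

Lemma sqint_lty f : sqint f -> (\int[m]_(x in D) (f x ^+ 2)%:E < +oo)%E.
Proof. by move=> [_ f2]; exact: integrable_lty f2. Qed.

Lemma integrable_le (f g : T -> R) : measurable_fun D f ->
  m.-integrable D (EFin \o g) -> (forall x, D x -> `|f x| <= g x) ->
  m.-integrable D (EFin \o f).
Proof.
move=> mf ig fg; apply: (le_integrable mD _ _ ig); first exact/measurable_EFinP.
by move=> x Dx /=; rewrite lee_fin (le_trans (fg x Dx))// ler_norm.
Qed.

Lemma sqint_le f g : measurable_fun D f -> sqint g ->
  (forall x, D x -> `|f x| <= `|g x|) -> sqint f.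
Proof.
move=> mf [mg g2] fg; split=> //; apply: (integrable_le _ g2).
  exact: measurable_funX.
move=> x Dx; rewrite ger0_norm ?sqr_ge0//.
by rewrite -[leLHS]real_normK ?num_real// -[leRHS]real_normK ?num_real//
  ler_sqr ?nnegrE// fg.
Qed.

Lemma sqint_mul f g : sqint f -> sqint g ->
  m.-integrable D (EFin \o (fun x => f x * g x)).
Proof.
move=> [mf f2] [mg g2].
apply: (@integrable_le _ (fun x => f x ^+ 2 + g x ^+ 2)).
- exact: measurable_funM.
- exact: integrableD f2 g2.
move=> x _; rewrite normrM -(real_normK (num_real (f x))).
rewrite -(real_normK (num_real (g x))).
by have := sqr_ge0 (`|f x| - `|g x|); have := normr_ge0 (f x);
  have := normr_ge0 (g x); rewrite sqrrB; nra.
Qed.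

Definition l2_pred : {pred T -> R} := mem [set f | sqint f].

Lemma l2_submod_closed : submod_closed l2_pred.
Proof.
split=> [|a f g].
  rewrite inE; split; first exact: measurable_cst.
  by under eq_fun do rewrite /= expr0n /=; exact: integrable0.
rewrite !inE => -[mf f2] [mg g2].
have mfg : measurable_fun D (a *: f + g).
  by apply: measurable_funD => //; exact: measurable_funM.
split=> //.
apply: (@integrable_le _ (fun x => (2 * a ^+ 2) * f x ^+ 2 + 2 * g x ^+ 2)).
- exact: measurable_funX.
- apply: (@integrableD _ _ _ _ _ mD (fun x => (2 * a ^+ 2)%:E * (f x ^+ 2)%:E)%E
    (fun x => 2%:E * (g x ^+ 2)%:E)%E); exact: integrableZl.
move=> x _; rewrite ger0_norm ?sqr_ge0//.
by apply: le_trans (sqrD_le _ _) _; rewrite /= exprMn mulrA.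
Qed.

HB.instance Definition _ :=
  GRing.isSubmodClosed.Build _ _ l2_pred l2_submod_closed.

Record l2 := L2fun { l2val :> T -> R; l2valP : l2val \in l2_pred }.
HB.instance Definition _ := [isSub for l2val].
HB.instance Definition _ := gen_eqMixin l2.
HB.instance Definition _ := gen_choiceMixin l2.
HB.instance Definition _ := [SubChoice_isSubLmodule of l2 by <:].

Lemma l2P (f : l2) : sqint f.
Proof. by have := l2valP f; rewrite inE. Qed.

Definition mkl2 f (fP : sqint f) : l2 := L2fun (mem_set fP).

Lemma l2_meas (f : l2) : measurable_fun D f. Proof. by have [] := l2P f. Qed.

Lemma l2DZ a (f g : l2) x : (a *: f + g) x = a * f x + g x.
Proof. by []. Qed.

Lemma l2B (f g : l2) x : (f - g) x = f x - g x. Proof. by []. Qed.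

Lemma l2Z a (f : l2) x : (a *: f) x = a * f x. Proof. by []. Qed.

Definition l2dot (f g : l2) : R := \int[m]_(x in D) (f x * g x).

Lemma l2_mul (f g : l2) : m.-integrable D (EFin \o (fun x => f x * g x)).
Proof. exact: sqint_mul (l2P f) (l2P g). Qed.

Lemma l2dotC (f g : l2) : l2dot f g = l2dot g f.
Proof. by rewrite /l2dot; apply: eq_Rintegral => x _; rewrite mulrC. Qed.

Lemma l2dotDZl a (f g h : l2) : l2dot (a *: f + g) h = a * l2dot f h + l2dot g h.
Proof.
rewrite /l2dot -RintegralZl//; last exact: l2_mul.
rewrite -RintegralD//; [|
  exact: (integrableZl mD a (l2_mul f h))|exact: l2_mul].
by apply: eq_Rintegral => x _; rewrite l2DZ mulrDl mulrA.
Qed.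

Lemma l2dot_ge0 (f : l2) : 0 <= l2dot f f.
Proof. by apply: Rintegral_ge0 => x _; rewrite -expr2 sqr_ge0. Qed.

Lemma l2dotE (f : l2) : (l2dot f f)%:E = (\int[m]_(x in D) (f x ^+ 2)%:E)%E.
Proof.
rewrite /l2dot /Rintegral fineK.
  by apply: eq_integral => x _; rewrite expr2.
exact: (integrable_fin_num mD (l2_mul f f)).
Qed.

(** Riesz-Fischer: along a subsequence whose increments [d k] satisfy
    [l2dot (d k) (d k) < 4^-k], the sum of the [2^k (d k)^2] is integrable, so
    that the sum of the [|d k| <= 2^-k + 2^k (d k)^2] is finite almost
    everywhere.  Fatou's lemma then shows that the pointwise limit is the limit
    in the mean. *)
Lemma l2_complete (u : nat -> l2) :
  (forall e : R, 0 < e -> exists N, forall m n, (N <= m)%N -> (N <= n)%N ->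
     l2dot (u m - u n) (u m - u n) < e) ->
  exists l, forall e : R, 0 < e -> exists N, forall n, (N <= n)%N ->
     l2dot (u n - l) (u n - l) < e.
Proof.
move=> uC.
have /choice[N NP] : forall k : nat, exists N, forall m n, (N <= m)%N -> (N <= n)%N ->
    l2dot (u m - u n) (u m - u n) < 4 ^- k.
  by move=> k; apply: uC; rewrite invr_gt0 exprn_gt0.
pose phi k := (\sum_(i < k.+1) N i)%N.
have phi_ge k : (N k <= phi k)%N by rewrite /phi big_ord_recr leq_addl.
have phi_le k : (phi k <= phi k.+1)%N by rewrite {2}/phi big_ord_recr leq_addr.
have phi_mono j k : (j <= k)%N -> (phi j <= phi k)%N.
  by apply: (@homo_leq _ phi leq) => //; exact: leq_trans.
pose v k := u (phi k); pose dl k x := v k.+1 x - v k x.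
have mv k : measurable_fun D (v k) by exact: l2_meas.
have mdl k : measurable_fun D (dl k) by exact: measurable_funB.
pose q k x : \bar R := (2 ^+ k * dl k x ^+ 2)%:E.
have mq k : measurable_fun D (q k).
  apply/measurable_EFinP; apply: measurable_funM => //; exact: measurable_funX.
have q0 k x : (0 <= q k x)%E by rewrite lee_fin mulr_ge0 ?sqr_ge0// exprn_ge0.
have geo n : \sum_(i < n) 2 ^- i <= 2 - 2 ^- n * 2 :> R.
  elim: n => [|n IH]; first by rewrite big_ord0 expr0 invr1 mul1r subrr.
  rewrite big_ord_recr/= exprS invfM; move: (2 ^- n) IH => a; lra.
have geo2 n : \sum_(i < n) 2 ^- i <= 2 :> R.
  by apply: le_trans (geo n) _; rewrite gerBl mulr_ge0 ?invr_ge0// exprn_ge0.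
have int_q k : (\int[m]_(x in D) q k x <= (2 ^- k)%:E)%E.
  rewrite /q; under eq_integral do rewrite EFinM.
  rewrite ge0_integralZl//; last first.
  - by move=> x _; rewrite lee_fin sqr_ge0.
  - by apply/measurable_EFinP; exact: measurable_funX.
  rewrite (_ : (\int[m]_(x in D) _)%E = (l2dot (v k.+1 - v k) (v k.+1 - v k))%:E);
    last by rewrite l2dotE.
  rewrite -EFinM lee_fin.
  have /ltW := NP k (phi k.+1) (phi k) (leq_trans (phi_ge k) (phi_le k)) (phi_ge k).
  rewrite (_ : 4 = 2 * 2) ?exprMn ?invfM; last lra.
  move=> /(ler_wpM2l (exprn_ge0 k (ler0n R 2))) /le_trans; apply.
  by rewrite mulrA mulfV ?mul1r// expf_neq0.
have sum_q : (\int[m]_(x in D) (\sum_(0 <= k <oo) q k x) < +oo)%E.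
  rewrite integral_nneseries//; apply: le_lt_trans (ltry 2).
  apply: lime_le.
    by apply: is_cvg_nneseries => k _ _; exact: integral_ge0.
  apply: nearW => n; rewrite big_mkord.
  apply: (@le_trans _ _ (\sum_(i < n) (2 ^- i)%:E)%E).
    by apply: lee_sum => i _; exact: int_q.
  by rewrite sumEFin lee_fin.
have q_ae : {ae m, forall x, D x -> (\sum_(0 <= k <oo) q k x < +oo)%E}.
  have : m.-integrable D (fun x => \sum_(0 <= k <oo) q k x)%E.
    apply/integrableP; split.
      by apply: ge0_emeasurable_sum => // k x _ _; exact: q0.
    under eq_integral => x _ do
      (rewrite gee0_abs; last by apply: nneseries_ge0 => k _ _; exact: q0).
    exact: sum_q.
  move=> /(integrable_ae mD); apply: filterS => x xP Dx.
  by have := xP Dx; rewrite fin_numE ltey => /andP[].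
have v_cvg x : (\sum_(0 <= k <oo) q k x < +oo)%E -> cvgn (fun k => v k x).
  move=> qx; have qfin : (\sum_(0 <= k <oo) q k x \is a fin_num)%E.
    by rewrite ge0_fin_numE// nneseries_ge0// => k _ _; exact: q0.
  have dl_le k : `|dl k x| <= 2 ^- k + 2 ^+ k * dl k x ^+ 2.
    rewrite -(real_normK (num_real (dl k x))).
    have p0 : 0 < 2 ^+ k :> R by rewrite exprn_gt0.
    rewrite -(ler_pM2l p0) mulrDr mulfV ?gt_eqF// mulrA -expr2 -exprMn.
    set a := 2 ^+ k * _; have := sqr_ge0 (a - 1); have : 0 <= a ^+ 2 by exact: sqr_ge0.
    by rewrite sqrrB; lra.
  have : cvgn (series (fun k => dl k x)).
    apply: normed_cvg; apply: nondecreasing_is_cvgn.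
      apply/nondecreasing_seqP => n.
      by rewrite /normed_series_of seriesSr lerDl; exact: normr_ge0.
    exists (2 + fine (\sum_(0 <= k <oo) q k x)%E) => _ [n _ <-].
    rewrite /normed_series_of seriesEord/=.
    apply: (@le_trans _ _ (\sum_(i < n) (2 ^- i + 2 ^+ i * dl i x ^+ 2))).
      by apply: ler_sum => i _; exact: dl_le.
    rewrite big_split/= lerD ?geo2// -lee_fin fineK// -sumEFin.
    have := @nneseries_lim_ge _ (fun k => q k x) xpredT 0%N n (fun k _ _ => q0 k x).
    by rewrite big_mkord.
  have -> : series (fun k => dl k x) = (fun k => v k x) - cst (v 0%N x).
    by rewrite seriesEnat; apply/funext => n; rewrite /= telescope_sumr.
  move=> h; rewrite -[fun k => v k x](subrK (cst (v 0%N x))).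
  by apply: is_cvgD h _; exact: is_cvg_cst.
(* The upper limit is measurable, and it is the limit where there is one. *)
pose l0 x := fine (limn_esup (fun k => (v k x)%:E)).
have ml0 : measurable_fun D l0.
  apply: (@measurableT_comp _ _ _ _ _ _ (@fine R)); first exact: fine_measurable.
  by apply: measurable_fun_limn_esup => k; exact/measurable_EFinP.
have l0_lim x : cvgn (fun k => v k x) -> v k x @[k --> \oo] --> l0 x.
  move=> c; rewrite /l0; have /cvg_limn_einf_sup[_ ->] : (v k x)%:E @[k --> \oo] -->
      (limn (fun k => v k x))%:E by apply: cvg_EFin; [exact: nearW|exact: c].
  exact: c.
have fat n k0 : (N k0 <= n)%N ->
    (\int[m]_(x in D) ((u n x - l0 x) ^+ 2)%:E <= (4 ^- k0)%:E)%E.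
  move=> nk.
  have mun k : measurable_fun D (fun x => ((u n x - v k x) ^+ 2)%:E).
    apply/measurable_EFinP/measurable_funX/measurable_funB => //.
    exact: l2_meas.
  rewrite (@ge0_ae_eq_integral _ _ _ _ _ _
    (fun x => limn_einf (fun k => ((u n x - v k x) ^+ 2)%:E))) //; first last.
  - apply: filterS q_ae => x /[apply] /v_cvg/l0_lim xl; apply/esym.
    apply: (cvg_limn_einf_sup _).1; apply/cvg_EFin; first exact: nearW.
    by apply: cvgM; apply: cvgB => //; exact: cvg_cst.
  - move=> x _; rewrite limn_einf_lim; apply: lime_ge; first exact: is_cvg_einfs.
    by apply: nearW => k; apply: le_ereal_inf_tmp => _ [j _ <-]; rewrite lee_fin sqr_ge0.
  - by move=> x _; rewrite lee_fin sqr_ge0.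
  - rewrite (_ : (fun x => _) = fun x =>
        - limn_esup (fun k => - ((u n x - v k x) ^+ 2)%:E))%E; last first.
      apply/funext => x.
      by rewrite -limn_einfN; congr limn_einf; apply/funext => k; rewrite /comp oppeK.
    apply: measurableT_comp => //; apply: measurable_fun_limn_esup => k.
    exact: measurableT_comp (mun k).
  - apply/measurable_EFinP/measurable_funX/measurable_funB => //.
    exact: l2_meas.
  apply: le_trans (fatou m mD mun _) _; first by move=> k x _; rewrite lee_fin sqr_ge0.
  rewrite limn_einf_lim; apply: lime_le; first exact: is_cvg_einfs.
  apply: nearW => j; apply: ereal_inf_le.
  exists (\int[m]_(x in D) ((u n x - v (maxn j k0) x) ^+ 2)%:E)%E.
    by exists (maxn j k0) => //=; exact: leq_maxl.
  rewrite (_ : (\int[m]_(x in D) _)%E =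
    (l2dot (u n - v (maxn j k0)) (u n - v (maxn j k0)))%:E); last by rewrite l2dotE.
  rewrite lee_fin ltW//; apply: NP => //.
  by apply: leq_trans (phi_ge k0) (phi_mono _ _ (leq_maxr _ _)).
have lP : sqint l0.
  have dP : sqint (fun x => u (N 0%N) x - l0 x).
    apply: sqintP; first by apply: measurable_funB => //; exact: l2_meas.
    exact: le_lt_trans (fat (N 0%N) 0%N (leqnn _)) (ltry _).
  have := l2P (u (N 0%N) - mkl2 dP).
  by congr sqint; apply/funext => x; rewrite l2B/= opprB addrC subrK.
exists (mkl2 lP) => e e0.
have [k ke] : exists k, 4 ^- k < e.
  have := @cvg_geometric R 1 4^-1.
  rewrite ger0_norm ?invr_ge0// => /(_ _)/cvgrPdist_lt -/(_ _ e e0)[].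
    by rewrite invf_lt1//; lra.
  move=> k _ /(_ k (leqnn k)); rewrite /geometric/= sub0r normrN mul1r.
  by rewrite exprVn ger0_norm ?invr_ge0 ?exprn_ge0// => ?; exists k.
exists (N k) => n nk; apply: le_lt_trans ke.
by rewrite -lee_fin l2dotE; exact: fat.
Qed.

Definition L2space : hspace R :=
  HSpace l2dotC l2dotDZl l2dot_ge0 l2_complete.

Lemma dotL2 (f g : L2space) : dot f g = \int[m]_(x in D) (f x * g x).
Proof. by []. Qed.

Lemma nsqL2 (f : L2space) : (nsq f)%:E = (\int[m]_(x in D) (f x ^+ 2)%:E)%E.
Proof. exact: l2dotE. Qed.

Lemma nsqL20P (f : L2space) : nsq f = 0 <-> {ae m, forall x, D x -> f x = 0}.
Proof.
have mf2 : measurable_fun D (fun x => (f x ^+ 2)%:E).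
  by apply/measurable_EFinP/measurable_funX; exact: l2_meas.
have -> : (nsq f = 0) <-> (\int[m]_(x in D) `|(f x ^+ 2)%:E| = 0)%E.
  under eq_integral => x _ do rewrite gee0_abs ?lee_fin ?sqr_ge0//.
  by rewrite -nsqL2; split => [->//|[]].
rewrite (ae_eq_integral_abs m mD mf2); split; apply: filterS => x xP Dx.
  by have [/eqP] := xP Dx; rewrite sqrf_eq0 => /eqP.
by rewrite /= xP// expr0n.
Qed.

End L2real.

(** * The Hausdorff moment problem *)

Section RegularizedCumulative.
Context {R : realType}.

Lemma cvgn_eq (f g : nat -> R) (l l' : R) (N : nat) : f n @[n --> \oo] --> l ->
  (forall n, (N <= n)%N -> f n = g n) -> l = l' -> g n @[n --> \oo] --> l'.
Proof.
move=> fl fg <-; apply: cvg_trans fl; apply: near_eq_cvg.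
by exists N => // n; exact: fg.
Qed.

(** Limits along an ultrafilter exist for all arguments of the distribution
    functions at once, so that no subsequence has to be extracted. *)
Lemma ultra_bounded_cvg (U : set_system nat) (u : nat -> R) (a b : R) :
  UltraFilter U -> (forall n, a <= u n <= b) -> cvg (u @ U).
Proof.
move=> UU uab; have PU : ProperFilter U by exact: ultra_proper.
have [|p [_]] := @segment_compact R a b (u @ U) _.
  by apply: (@filterE _ U) => n /=; rewrite in_itv/= uab.
move=> clp; apply/cvg_ex; exists p => A pA.
have [|UnA] := in_ultra_setVsetC (u @^-1` A) UU; first by [].
by have [y []] := clp _ _ (UnA : (u @ U) (~` A)) pA.
Qed.

Variables (F : R -> R) (c : R).
Hypothesis F_nd : {homo F : x y / x <= y}.
Hypothesis F_lb : forall x, c <= F x.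

(** The right-continuous function that agrees with the nondecreasing function
    [F] up to arbitrarily small shifts of the argument. *)
Definition rreg (x : R) : R := inf [set F y | y in [set y | x < y]].

Lemma rreg_le x y : x < y -> rreg x <= F y.
Proof.
by move=> xy; apply: ge_inf; [exists c => _ [z _ <-]|exists y].
Qed.

Lemma le_rreg x : F x <= rreg x.
Proof.
apply: lb_le_inf; first by exists (F (x + 1)), (x + 1) => //=; rewrite ltrDl.
by move=> _ [y /ltW xy <-]; exact: F_nd.
Qed.

Lemma rreg_nd : {homo rreg : x y / x <= y}.
Proof.
move=> x y xy; apply: lb_le_inf.
  by exists (F (y + 1)), (y + 1) => //=; rewrite ltrDl.
by move=> _ [z /(le_lt_trans xy) xz <-]; exact: rreg_le.
Qed.

Lemma rreg_rc : right_continuous rreg.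
Proof.
move=> x; apply/cvgrPdist_lt => e e0.
have ne : [set F y | y in [set y | x < y]] !=set0.
  by exists (F (x + 1)), (x + 1) => //=; rewrite ltrDl.
have hi : has_inf [set F y | y in [set y | x < y]].
  by split => //; exists c => _ [z _ <-].
have [_ [y /= xy <-] ye] := inf_adherent e0 hi.
near=> z; have xz : x < z by near: z; exact: nbhs_right_gt.
have zy : z < y by near: z; exact: nbhs_right_lt.
rewrite distrC ger0_norm ?subr_ge0 ?rreg_nd ?(ltW xz)// ltrBlDl.
exact: le_lt_trans (rreg_le zy) ye.
Unshelve. all: by end_near. Qed.

End RegularizedCumulative.

Section StepSandwich.
Context {R : realType} (N M : nat).

Definition gridpt (j : nat) : R := j%:R / M.+1%:R.
Definition gridinc (j : nat) : R := gridpt j.+1 ^+ N - gridpt j ^+ N.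

Lemma gridpt_ge0 j : 0 <= gridpt j.
Proof. by rewrite divr_ge0. Qed.

Lemma gridptS j : gridpt j <= gridpt j.+1.
Proof. by rewrite ler_pM2r ?invr_gt0// ler_nat. Qed.

Lemma gridpt_max : gridpt M.+1 = 1.
Proof. by rewrite /gridpt divff. Qed.

Lemma gridinc_ge0 j : 0 <= gridinc j.
Proof. by rewrite subr_ge0 lerXn2r ?nnegrE ?gridpt_ge0// gridptS. Qed.

Lemma lerBX (a b : R) n : 0 <= b -> b <= a -> a <= 1 ->
  a ^+ n - b ^+ n <= n%:R * (a - b).
Proof.
move=> b0 ba a1; elim: n => [|n IH]; first by rewrite !expr0 subrr mul0r.
have a0 := le_trans b0 ba.
have -> : a ^+ n.+1 - b ^+ n.+1 = a * (a ^+ n - b ^+ n) + b ^+ n * (a - b).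
  by rewrite !exprS; ring.
rewrite -natr1 mulrDl mul1r lerD//.
  apply: le_trans IH; rewrite ler_piMl// subr_ge0.
  by rewrite lerXn2r ?nnegrE.
by rewrite ler_piMl ?subr_ge0// exprn_ile1// (le_trans ba).
Qed.

Lemma gridinc_le j : (j < M.+1)%N -> gridinc j <= N%:R / M.+1%:R.
Proof.
move=> jM; apply: le_trans (lerBX _ (gridpt_ge0 j) (gridptS j) _) _.
  by rewrite ler_pdivrMr// mul1r ler_nat.
by rewrite /gridpt -mulrBl -natrB// subSnn mul1r.
Qed.

(** Telescoping of [max (gridpt j) x ^+ N] in [j]. *)
Lemma step_sum (x : R) : 0 <= x <= 1 ->
  \sum_(j < M.+1) gridinc j * (x <= gridpt j)%R%:R <= 1 - x ^+ N /\
  1 - x ^+ N <= \sum_(j < M.+1) gridinc j * (x <= gridpt j.+1)%R%:R.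
Proof.
move=> /andP[x0 x1]; pose t j := Num.max (gridpt j) x ^+ N.
have -> : 1 - x ^+ N = \sum_(j < M.+1) (t j.+1 - t j).
  rewrite -(big_mkord xpredT (fun j => t j.+1 - t j)) telescope_sumr//.
  rewrite /t gridpt_max (max_idPl x1) expr1n.
  by rewrite (_ : gridpt 0 = 0) ?(max_idPr x0)// /gridpt mul0r.
split; apply: ler_sum => j _.
  case: (leP x (gridpt j)) => xj.
    rewrite mulr1 /gridinc /t (max_idPl xj) (max_idPl _)//.
    exact: le_trans (gridptS j).
  rewrite mulr0 subr_ge0 lerXn2r ?nnegrE ?le_max ?x0 ?orbT//.
  by rewrite [X in _ || X]ge_max (ltW xj) lexx orbT.
case: (leP x (gridpt j.+1)) => xj.
  rewrite mulr1 /gridinc /t (max_idPl xj) lerB// lerXn2r ?nnegrE ?gridpt_ge0//.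
    by rewrite le_max x0 orbT.
  by rewrite le_max lexx.
rewrite mulr0 subr_le0 /t (max_idPr (ltW xj)) (max_idPr _)//.
exact: le_trans (gridptS j) (ltW xj).
Qed.

(** Each weight is at most [N / (M + 1)] and the differences of the values of [F]
    telescope, so that the gap vanishes as the grid is refined. *)
Lemma step_gap (F : R -> R) (a : R) : {homo F : x y / x <= y} ->
  (forall x, 0 <= F x <= a) ->
  \sum_(j < M.+1) gridinc j * F (gridpt j.+1) -
  \sum_(j < M.+1) gridinc j * F (gridpt j - M.+1%:R^-1) <= N%:R / M.+1%:R * (2 * a).
Proof.
move=> F_nd F_bd.
have F0 x : 0 <= F x by have /andP[] := F_bd x.
have Fa x : F x <= a by have /andP[] := F_bd x.
rewrite -sumrB; pose G j := F (gridpt j - M.+1%:R^-1).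
have GE j : G j.+1 = F (gridpt j).
  by rewrite /G /gridpt -natr1 mulrDl mul1r addrK.
apply: (@le_trans _ _ (\sum_(j < M.+1) N%:R / M.+1%:R * (G j.+2 - G j))).
  apply: ler_sum => j _; rewrite GE -mulrBr ler_wpM2r ?gridinc_le//.
  rewrite subr_ge0; apply: F_nd; apply: le_trans (gridptS j).
  by rewrite gerBl.
rewrite -mulr_sumr ler_wpM2l ?divr_ge0//.
have -> : \sum_(j < M.+1) (G j.+2 - G j) =
    \sum_(0 <= j < M.+1) (G j.+2 - G j.+1) + \sum_(0 <= j < M.+1) (G j.+1 - G j).
  by rewrite -big_split/= big_mkord; apply: eq_bigr => j _; rewrite addrA subrK.
rewrite (@telescope_sumr _ 0 M.+1 (fun j => G j.+1))// telescope_sumr//.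
have := Fa (gridpt M.+1); have := Fa (gridpt M); have := F0 (gridpt 0).
by have := F0 (gridpt 0 - M.+1%:R^-1); rewrite !GE /G; lra.
Qed.

End StepSandwich.

Section HausdorffWeights.
Context {R : realType} (mom : nat -> R).

(** The linear functional on polynomials that takes ['X^n] to [mom n]. *)
Definition Lam (p : {poly R}) : R := lin (mom : nat -> R^o) p.

Lemma LamDZ a p q : Lam (a *: p + q) = a * Lam p + Lam q.
Proof. exact: linDZ. Qed.

Lemma LamXn n : Lam 'X^n = mom n. Proof. exact: linXn. Qed.

Lemma LamZ a p : Lam (a *: p) = a * Lam p.
Proof. by rewrite -[a *: p]addr0 LamDZ /Lam lin0 addr0. Qed.

Lemma Lam_sum (I : Type) (r : seq I) (P : pred I) (f : I -> {poly R}) :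
  Lam (\sum_(i <- r | P i) f i) = \sum_(i <- r | P i) Lam (f i).
Proof.
apply: (big_morph Lam) => [p q|]; last by rewrite /Lam lin0.
by rewrite -[p]scale1r LamDZ mul1r scale1r.
Qed.

Hypothesis mom_pos : forall k n, 0 <= Lam ('X^k * (1 - 'X) ^+ n).

(** The weight, at the point [k / n], of the Bernstein approximation. *)
Definition wt (n k : nat) : R := 'C(n, k)%:R * Lam ('X^k * (1 - 'X) ^+ (n - k)).

Lemma wt_ge0 n k : 0 <= wt n k.
Proof. by rewrite mulr_ge0. Qed.

Lemma bin_ffactM n k d : (d <= k <= n)%N ->
  ('C(n, k) * k ^_ d = n ^_ d * 'C(n - d, k - d))%N.
Proof.
move=> /andP[dk kn]; elim: d dk => [|d IH] dk.
  by rewrite !ffactn0 muln1 mul1n !subn0.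
rewrite !ffactnSr mulnA IH 1?ltnW// -!mulnA; congr muln.
have := mul_bin_diag (n - d) (k - d.+1).
by rewrite -subnS subnSK// => ->; rewrite mulnC.
Qed.

(** The factorial moments of the Bernstein weights are exact, by the binomial
    expansion of [((1 - 'X) + 'X) ^+ (n - d)]; ordinary moments are exact only
    in the limit. *)
Lemma wt_ffact n d :
  \sum_(k < n.+1) wt n k * (k ^_ d)%:R = (n ^_ d)%:R * mom d.
Proof.
transitivity (Lam (\sum_(k < n.+1)
    ('C(n, k) * k ^_ d)%:R *: ('X^k * (1 - 'X) ^+ (n - k)))).
  by rewrite Lam_sum; apply: eq_bigr => k _; rewrite LamZ /wt natrM mulrAC.
rewrite -LamXn -LamZ; congr Lam.
case: (leqP d n) => dn; last first.
  rewrite ffact_small// scale0r big1// => k _.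
  by rewrite ffact_small ?muln0 ?scale0r//; apply: leq_trans dn; case: k.
have -> : n.+1 = (d + (n - d).+1)%N by rewrite addnS subnKC.
rewrite big_split_ord/= big1 ?add0r => [|k _]; last first.
  by rewrite ffact_small ?muln0 ?scale0r.
have -> : (n ^_ d)%:R *: 'X^d =
    (n ^_ d)%:R *: ('X^d * ((1 - 'X) + 'X) ^+ (n - d)) :> {poly R}.
  by rewrite subrK expr1n mulr1.
rewrite exprDn mulr_sumr scaler_sumr; apply: eq_bigr => k _.
rewrite bin_ffactM; last by rewrite leq_addr/=; case: k => k/=; lia.
rewrite addKn natrM -scalerA; congr (_ *: _).
rewrite scaler_nat mulrnAr; congr (_ *+ _).
by rewrite exprD subnDA -!mulrA; congr (_ * _); rewrite mulrC.
Qed.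

Lemma wt_total n : \sum_(k < n.+1) wt n k = mom 0.
Proof.
by rewrite -[RHS]mul1r -[1]/((n ^_ 0)%:R) -wt_ffact; apply: eq_bigr => k _;
  rewrite ffactn0 mulr1.
Qed.

Lemma ffact_ratio_cvg d : (n.+1 ^_ d)%:R / n.+1%:R ^+ d @[n --> \oo] --> (1 : R).
Proof.
elim: d => [|d IH].
  by under eq_fun do rewrite ffactn0 expr0 divr1; exact: cvg_cst.
rewrite -[1 in X in _ --> X](mulr1 1).
have -> : (fun n => (n.+1 ^_ d.+1)%:R / n.+1%:R ^+ d.+1) =
    (fun n => (n.+1 ^_ d)%:R / n.+1%:R ^+ d * ((n.+1 - d)%:R / n.+1%:R)) :> (nat -> R).
  by apply/funext => n; rewrite ffactnSr natrM exprSr invfM mulrACA.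
apply: cvgM => //.
apply: (@cvgn_eq _ _ _ _ _ d
  (cvgB (cvg_cst (1 : R)) (cvgM (cvg_cst (d%:R : R)) (@cvg_harmonic R)))).
  move=> n dn; rewrite /= /harmonic natrB ?leqW// mulrBl divff//.
by rewrite mulr0 subr0.
Qed.

(** Induction on [e]: since [k * k ^_ d = k ^_ d.+1 + d * k ^_ d], a factor [k]
    can be absorbed in the falling factorial at a cost of order [1 / n]. *)
Lemma mixed_moment_cvg e d :
  \sum_(k < n.+2) wt n.+1 k * (k ^_ d)%:R * k%:R ^+ e / n.+1%:R ^+ (d + e)
    @[n --> \oo] --> mom (d + e).
Proof.
elim: e d => [|e IH] d.
  apply: (@cvgn_eq _ _ _ _ _ 0%N (cvgM (@ffact_ratio_cvg d) (cvg_cst (mom d)))).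
    move=> n _ /=; rewrite addn0.
    by under eq_bigr do rewrite expr0 mulr1; rewrite -mulr_suml wt_ffact mulrAC.
  by rewrite mul1r addn0.
apply: (@cvgn_eq _ _ _ _ _ 0%N (cvgD (IH d.+1)
  (cvgM (cvgM (cvg_cst (d%:R : R)) (@cvg_harmonic R)) (IH d)))); last first.
  by rewrite mulr0 mul0r addr0 addSnnS.
move=> n _; rewrite [LHS]/= /harmonic mulr_sumr -big_split/=.
apply: eq_bigr => k _.
rewrite addnS exprS exprSr ffactnSr.
have [dk|kd] := leqP d k.
  by rewrite natrM natrB// invfM; ring.
by rewrite ffact_small// !(mulr0, mul0r, muln0, mul0n, addr0).
Qed.

Lemma moment_cvg d :
  \sum_(k < n.+2) wt n.+1 k * (k%:R / n.+1%:R) ^+ d @[n --> \oo] --> mom d.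
Proof.
apply: (@cvgn_eq _ _ _ _ _ 0%N (@mixed_moment_cvg d 0)) => [n _|]; last by rewrite add0n.
apply: eq_bigr => k _.
by rewrite ffactn0 mulr1 expr_div_n mulrA.
Qed.

Lemma cvg_sumM (U : set_system nat) (UF : Filter U) (M : nat) (a : nat -> R)
    (f : nat -> nat -> R) (l : nat -> R) :
  (forall j, f j n @[n --> U] --> l j) ->
  \sum_(j < M) a j * f j n @[n --> U] --> \sum_(j < M) a j * l j.
Proof.
move=> fl; elim: M => [|M IH].
  by rewrite big_ord0; under eq_fun do rewrite big_ord0; exact: cvg_cst.
rewrite big_ord_recr; under eq_fun do rewrite big_ord_recr.
by apply: cvgD => //; apply: cvgM => //; exact: cvg_cst.
Qed.

(** Distribution functions of the Bernstein approximations. *)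
Definition wcdf (n : nat) (c : R) : R :=
  \sum_(k < n.+2) wt n.+1 k * (k%:R / n.+1%:R <= c)%R%:R.

Lemma wcdf_bd n c : 0 <= wcdf n c <= mom 0.
Proof.
apply/andP; split; first by apply: sumr_ge0 => k _; rewrite mulr_ge0 ?wt_ge0.
rewrite -(wt_total n.+1); apply: ler_sum => k _.
by rewrite ler_piMr ?wt_ge0// lern1 leq_b1.
Qed.

Lemma wcdf_nd n : {homo wcdf n : x y / x <= y}.
Proof.
move=> x y xy; apply: ler_sum => k _; rewrite ler_wpM2l ?wt_ge0//.
by rewrite ler_nat; case: leP => // /le_trans/(_ xy) ->.
Qed.

Lemma wcdf_lt0 n c : c < 0 -> wcdf n c = 0.
Proof.
move=> c0; rewrite /wcdf big1// => k _.
by rewrite lt_geF ?mulr0// (lt_le_trans c0)// divr_ge0.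
Qed.

Lemma wcdf_ge1 n c : 1 <= c -> wcdf n c = mom 0.
Proof.
move=> c1; rewrite -(wt_total n.+1); apply: eq_bigr => k _.
rewrite (_ : (_ <= c)%R = true) ?mulr1//; apply: le_trans c1.
by rewrite ler_pdivrMr// mul1r ler_nat -ltnS; case: k.
Qed.

Lemma wcdf_step N M n :
  \sum_(j < M.+1) gridinc N M j * wcdf n (gridpt M j) <=
    mom 0 - \sum_(k < n.+2) wt n.+1 k * (k%:R / n.+1%:R) ^+ N /\
  mom 0 - \sum_(k < n.+2) wt n.+1 k * (k%:R / n.+1%:R) ^+ N <=
    \sum_(j < M.+1) gridinc N M j * wcdf n (gridpt M j.+1).
Proof.
rewrite -(wt_total n.+1) -sumrB.
have E (c : nat -> R) : \sum_(j < M.+1) gridinc N M j * wcdf n (c j) =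
    \sum_(k < n.+2) wt n.+1 k *
      \sum_(j < M.+1) gridinc N M j * (k%:R / n.+1%:R <= c j)%R%:R.
  rewrite (eq_bigr _ (fun j _ => mulr_sumr _ _ _ _)) exchange_big/=.
  by apply: eq_bigr => k _; rewrite mulr_sumr; apply: eq_bigr => j _; ring.
have x01 (k : 'I_n.+2) : 0 <= (k%:R / n.+1%:R : R) <= 1.
  by rewrite divr_ge0//= ler_pdivrMr// mul1r ler_nat -ltnS; case: k.
rewrite (E (gridpt M)) (E (fun j => gridpt M j.+1)).
split; apply: ler_sum => k _; have [lo up] := step_sum N M (x01 k).
  by rewrite -[X in _ <= X - _]mulr1 -mulrBr ler_wpM2l ?wt_ge0.
by rewrite -[X in X - _ <= _]mulr1 -mulrBr ler_wpM2l ?wt_ge0.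
Qed.

(** [F] is the limit of the distribution functions along an ultrafilter, made
    right-continuous.  The regularization changes the values by less than a shift
    of the argument does, which is why the lower sum has its thresholds shifted
    by a full grid step. *)
Lemma mom_step : exists F : R -> R,
  [/\ {homo F : x y / x <= y}, right_continuous F, forall c, 0 <= F c <= mom 0,
      (forall c, c < 0 -> F c = 0) /\ (forall c, 1 <= c -> F c = mom 0) &
      forall N M,
  \sum_(j < M.+1) gridinc N M j * F (gridpt M j - M.+1%:R^-1) <= mom 0 - mom N /\
  mom 0 - mom N <= \sum_(j < M.+1) gridinc N M j * F (gridpt M j.+1)].
Proof.
have [U [UU Uoo]] := @ultraFilterLemma nat \oo _.
have PU : ProperFilter U by exact: ultra_proper.
have cv c : cvg (wcdf n c @[n --> U]).
  by apply: (@ultra_bounded_cvg R U _ 0 (mom 0)) => n; exact: wcdf_bd.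
pose FU c := lim (wcdf n c @[n --> U]).
have FU_bd c : 0 <= FU c <= mom 0.
  apply/andP; split.
    by apply: limr_ge => //; apply: (@filterE _ U) => n; have /andP[] := wcdf_bd n c.
  by apply: limr_le => //; apply: (@filterE _ U) => n; have /andP[] := wcdf_bd n c.
have FU0 c : 0 <= FU c by have /andP[] := FU_bd c.
have FU_nd : {homo FU : x y / x <= y}.
  move=> x y xy; apply: (ler_cvg_to (cv x) (cv y)).
  by apply: (@filterE _ U) => n; exact: wcdf_nd.
have FU_lt0 c : c < 0 -> FU c = 0.
  move=> c0; rewrite /FU (_ : (fun n => wcdf n c) = cst 0) ?lim_cst//.
  by apply/funext => n; exact: wcdf_lt0.
have FU_ge1 c : 1 <= c -> FU c = mom 0.
  move=> c0; rewrite /FU (_ : (fun n => wcdf n c) = cst (mom 0)) ?lim_cst//.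
  by apply/funext => n; exact: wcdf_ge1.
have step N M : \sum_(j < M.+1) gridinc N M j * FU (gridpt M j) <= mom 0 - mom N /\
    mom 0 - mom N <= \sum_(j < M.+1) gridinc N M j * FU (gridpt M j.+1).
  have momU : mom 0 - \sum_(k < n.+2) wt n.+1 k * (k%:R / n.+1%:R) ^+ N
      @[n --> U] --> mom 0 - mom N.
    apply: cvgB; first exact: cvg_cst.
    by apply: cvg_trans (@moment_cvg N); exact: cvg_fmap2.
  split.
    apply: (ler_cvg_to (@cvg_sumM U _ M.+1 (gridinc N M)
      (fun j n => wcdf n (gridpt M j)) _ (fun j => cv (gridpt M j))) momU).
    by apply: (@filterE _ U) => n; have [] := wcdf_step N M n.
  apply: (ler_cvg_to momU
    (@cvg_sumM U _ M.+1 (gridinc N M)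
    (fun j n => wcdf n (gridpt M j.+1)) _ (fun j => cv (gridpt M j.+1)))).
  by apply: (@filterE _ U) => n; have [] := wcdf_step N M n.
have r_bd c : 0 <= rreg FU c <= mom 0.
  apply/andP; split; first exact: le_trans (FU0 c) (le_rreg FU_nd c).
  apply: le_trans (rreg_le FU0 (_ : c < c + 1)) _; first by rewrite ltrDl.
  by have /andP[] := FU_bd (c + 1).
exists (rreg FU); split => //.
- exact: rreg_nd.
- exact: rreg_rc FU0.
- split => c hc.
    apply/eqP; rewrite eq_le; have /andP[-> _] := r_bd c; rewrite andbT.
    rewrite -(FU_lt0 (c / 2)); last by rewrite pmulr_llt0 ?invr_gt0.
    by apply: (rreg_le FU0); lra.
  apply/eqP; rewrite eq_le; have /andP[_ ->] := r_bd c.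
  by rewrite -(FU_ge1 c hc) le_rreg.
move=> N M; have [lo up] := step N M; split.
  apply: le_trans lo; apply: ler_sum => j _; rewrite ler_wpM2l ?gridinc_ge0//.
  by apply: (rreg_le FU0); rewrite gtrBl invr_gt0.
apply: (le_trans up); apply: ler_sum => j _; rewrite ler_wpM2l ?gridinc_ge0//.
exact: le_rreg.
Qed.

End HausdorffWeights.

Section HausdorffMeasure.
Context {R : realType} (mom : nat -> R).
Hypothesis mom_pos : forall k n, 0 <= Lam mom ('X^k * (1 - 'X) ^+ n).
Let I01 : set (measurableTypeR R) := `[0%R, 1%R]%classic.

Lemma lebesgue_stieltjes_itvoc (F : cumulative R R) (a b : R) : a <= b ->
  lebesgue_stieltjes_measure F `]a, b]%classic = (F b - F a)%:E.
Proof.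
move=> ab; rewrite /lebesgue_stieltjes_measure /measure_extension.
rewrite measurable_mu_extE/= ?wlength_itv_bnd//; exact: is_ocitv.
Qed.

(** The measure with distribution function [F] represents the moments: for each
    grid the integral of [1 - x ^+ N] and [mom 0 - mom N] lie in one and the
    same interval, of length [O(1 / M)]. *)
Lemma hausdorff01 : exists s : {finite_measure set (measurableTypeR R) -> \bar R},
  s (~` I01) = 0%E /\
  forall N, (\int[s]_(x in I01) (x ^+ N)%:E = (mom N)%:E)%E.
Proof.
have [F0 [F_nd F_rc F_bd [F_lt0 F_ge1] F_step]] := mom_step mom_pos.
pose F : cumulative R R := HB.pack F0 (isCumulative.Build R _ R F0 F_nd F_rc).
pose ls : {measure set (measurableTypeR R) -> \bar R} := lebesgue_stieltjes_measure F.
have lsE (a b : R) : a <= b -> ls `]a, b]%classic = (F0 b - F0 a)%:E.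
  exact: lebesgue_stieltjes_itvoc.
(* Starting at [-1] keeps the mass that [F] may have at [0]. *)
pose J : set (measurableTypeR R) := `](-1)%R, 1%R]%classic.
have mJ : measurable J by exact: measurable_itv.
have lsJ : (ls J < +oo)%E by rewrite lsE ?ltry//; lra.
pose s : {finite_measure set (measurableTypeR R) -> \bar R} := mfrestr mJ lsJ.
have sE A : s A = ls (A `&` J) by [].
have ls_neg : ls `]-1, 0[%classic = 0%E.
  have -> : `]-1, 0[%classic = \bigcup_k `]-1, - k.+1%:R^-1]%classic :> set R.
    apply/seteqP; split => x /=; rewrite in_itv/=.
      move=> /andP[x1 x0]; have nx0 : 0 < - x by rewrite oppr_gt0.
      have := near_infty_natSinv_lt (PosNum nx0) => -[k _ /(_ k (leqnn k))/= kx].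
      by exists k => //=; rewrite in_itv/= x1/= lerNr ltW.
    move=> [k _ /=]; rewrite in_itv/= => /andP[-> /le_lt_trans]; apply.
    by rewrite oppr_lt0 invr_gt0.
  apply/negligibleP.
    by apply: bigcup_measurable => k _; exact: measurable_itv.
  apply: negligible_bigcup => k; apply/negligibleP; first exact: measurable_itv.
  apply: etrans (lsE _ _ _) _; first by rewrite lerN2 invf_le1// ler1n.
  by rewrite !F_lt0 ?subrr// oppr_lt0 ?invr_gt0.
have mI : measurable I01 by exact: measurable_itv.
have s_out : s (~` I01) = 0%E.
  apply/eqP; rewrite eq_le measure_ge0 andbT sE -ls_neg le_measure ?inE//.
    by apply: measurableI => //; exact: measurableC.
  move=> x [/= xI]; rewrite /J/= !in_itv/= => /andP[-> x1] /=; rewrite ltNge.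
  by apply/negP => x0; apply: xI; rewrite /I01/= in_itv/= x0 x1.
have s_ray (c : R) : 0 <= c <= 1 -> s (`]-oo, c]%classic `&` I01) = (F0 c)%:E.
  move=> /andP[c0 c1].
  have -> : `]-oo, c]%classic `&` I01 = `[0, c]%classic :> set R.
    apply/seteqP; split => x /=; rewrite /I01/= !in_itv/=.
      by move=> [-> /andP[->]].
    by move=> /andP[-> xc]; rewrite xc (le_trans xc c1).
  have -> : s `[0, c]%classic = ls `[0, c]%classic.
    rewrite sE; congr (ls _); apply/seteqP; split => x /=; first by case.
    move=> h; split => //; move: h; rewrite /J/= !in_itv/= => /andP[x0 xc].
    by rewrite (le_trans xc c1) andbT; lra.
  have := lsE (-1) c; rewrite (F_lt0 (-1)) ?subr0; last lra.
  move=> <-; last lra.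
  have -> : `]-1, c]%classic = `]-1, 0[%classic `|` `[0, c]%classic :> set R.
    apply/seteqP; split => x /=; rewrite !in_itv/=.
      by move=> /andP[-> ->]; case: (ltP x 0) => _; [left|right].
    by case=> /andP[] h1 h2; apply/andP; split; lra.
  rewrite measureU//.
    by rewrite -[LHS]add0e; congr (_ + _)%E; apply/esym; exact: ls_neg.
  apply/seteqP; split => x //=; rewrite !in_itv/= => -[/andP[_ h1] /andP[h2 _]].
  by move: h1; rewrite ltNge h2.
have int_step N M (c : nat -> R) : (forall j, (j < M.+1)%N -> 0 <= c j <= 1) ->
    (\int[s]_(x in I01) (\sum_(j < M.+1) gridinc N M j * (x <= c j)%R%:R)%:E =
     (\sum_(j < M.+1) gridinc N M j * F0 (c j))%:E)%E.
  move=> c01; under eq_integral do rewrite -sumEFin.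
  have ind j : (fun x : measurableTypeR R => (x <= c j)%R%:R) = \1_(`]-oo, c j]%classic) :> (R -> R).
    by apply/funext => x; rewrite indicE mem_setE in_itv.
  have mind j : measurable_fun I01 (fun x : measurableTypeR R => ((x <= c j)%R%:R : R)).
    by rewrite ind; apply: measurable_indic; exact: measurable_itv.
  rewrite ge0_integral_sum//=; last 2 first.
  - by move=> j; apply/measurable_EFinP/measurable_funM => //; exact: mind.
  - by move=> j x _; rewrite lee_fin mulr_ge0 ?gridinc_ge0.
  rewrite -sumEFin; apply: eq_bigr => j _.
  under eq_integral do rewrite EFinM.
  rewrite ge0_integralZl//.
  - rewrite EFinM; congr (_ * _)%E.
    rewrite (_ : (fun x => _) = (fun x => (\1_(`]-oo, c j]%classic) x)%:E)); last first.
      by apply/funext => x; rewrite indicE mem_setE in_itv.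
    by rewrite integral_indic//; exact: (s_ray _ (c01 j (ltn_ord j))).
  - by apply/measurable_EFinP; exact: mind.
  - by rewrite lee_fin gridinc_ge0.
exists s; split => // N.
have mXn : measurable_fun I01 (fun x : measurableTypeR R => (x ^+ N)%:E).
  by apply/measurable_EFinP/measurable_funX; exact: measurable_id.
have m1X : measurable_fun I01 (fun x : measurableTypeR R => (1 - x ^+ N)%:E).
  apply/measurable_EFinP/measurable_funB; first exact: measurable_cst.
  by apply: measurable_funX; exact: measurable_id.
have x1X x : I01 x -> (0 <= (1 - x ^+ N)%:E)%E.
  rewrite /I01/= in_itv/= => /andP[x0 x1].
  by rewrite lee_fin subr_ge0 exprn_ile1.
have xXn x : I01 x -> (0 <= (x ^+ N)%:E)%E.
  by rewrite /I01/= in_itv/= => /andP[x0 x1]; rewrite lee_fin exprn_ge0.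
have mstep M (c : nat -> R) : measurable_fun I01
    (fun x : measurableTypeR R => (\sum_(j < M.+1) (gridinc N M j : R) * (x <= c j)%R%:R)%:E).
  apply/measurable_EFinP; apply: measurable_sum => j; apply: measurable_funM => //.
  rewrite (_ : (fun x => _) = \1_(`]-oo, c j]%classic)).
    by apply: measurable_indic; exact: measurable_itv.
  by apply/funext => x; rewrite indicE mem_setE in_itv.
have sI : s I01 = (mom 0)%:E.
  rewrite -(F_ge1 1)// -(s_ray 1) ?ler01 ?lexx//; congr (s _).
  apply/seteqP; split => x /=; last by case.
  by rewrite /I01/= !in_itv/= => /andP[-> ->].
set i := (\int[s]_(x in I01) (1 - x ^+ N)%:E)%E.
have i_split : (i + \int[s]_(x in I01) (x ^+ N)%:E = (mom 0)%:E)%E.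
  rewrite /i -ge0_integralD//; under eq_integral do rewrite -EFinD subrK.
  by rewrite integral_cst// mul1e.
suff iE : i = (mom 0 - mom N)%:E.
  have := i_split; rewrite iE => h.
  have : ((mom 0 - mom N)%:E + \int[s]_(x in I01) (x ^+ N)%:E - (mom 0 - mom N)%:E)%E =
    ((mom 0)%:E - (mom 0 - mom N)%:E)%E by rewrite h.
  by rewrite addeAC subee// add0e => ->; rewrite -EFinB opprB addrC subrK.
have i_bd M : (((\sum_(j < M.+1) gridinc N M j * F0 (gridpt M j - M.+1%:R^-1))%:E <= i)
    /\ (i <= (\sum_(j < M.+1) gridinc N M j * F0 (gridpt M j.+1))%:E))%E.
  have g01 j : (j < M.+1)%N -> 0 <= (gridpt M j.+1 : R) <= 1.
    by move=> jM; rewrite gridpt_ge0/= ler_pdivrMr// mul1r ler_nat.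
  split.
    apply: (@le_trans _ _ (\sum_(j < M.+1) gridinc N M j * F0 (gridpt M j))%:E).
      rewrite lee_fin; apply: ler_sum => j _; rewrite ler_wpM2l ?gridinc_ge0//.
      by apply: (F_nd); rewrite gerBl.
    rewrite -(int_step N M (gridpt M)) => [|j jM]; last first.
      by rewrite gridpt_ge0/= (le_trans (gridptS M j))//; have /andP[] := g01 j jM.
    apply: ge0_le_integral => //.
      by move=> x _; rewrite lee_fin sumr_ge0// => j _; rewrite mulr_ge0 ?gridinc_ge0.
    move=> x xI; rewrite lee_fin; apply: (step_sum N M _).1.
    by move: xI; rewrite /I01/= in_itv.
  rewrite -(int_step N M (fun j => gridpt M j.+1))//.
  apply: ge0_le_integral => //.
    exact: (mstep M (fun j => gridpt M j.+1)).
  move=> x xI; rewrite lee_fin; apply: (step_sum N M _).2.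
  by move: xI; rewrite /I01/= in_itv.
have i_fin : i \is a fin_num.
  have [lo up] := i_bd 0%N.
  by rewrite fin_numElt (lt_le_trans (ltNyr _) lo) (le_lt_trans up (ltry _)).
rewrite -[LHS](fineK i_fin); congr (_%:E); apply/eqP.
rewrite -subr_eq0 -normr_le0; apply: (@eps_le0 R _ (N%:R * (2 * mom 0))) => e e0.
have := near_infty_natSinv_lt (PosNum e0) => -[M _ /(_ M (leqnn M))/= /ltW Me].
have gap := step_gap N M F_nd F_bd; have [flo fup] := F_step N M.
have [] := i_bd M; rewrite -(fineK i_fin) !lee_fin => ilo iup.
have m0 : 0 <= mom 0 by have /andP[] := F_bd 1; rewrite F_ge1.
have := ler_wpM2l (mulr_ge0 (ler0n R N) (mulr_ge0 (ler0n R 2) m0)) Me.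
rewrite mulrAC => Ke; move: (le_trans gap Ke) flo fup ilo iup; rewrite /= ler_norml.
move: (\sum_(j < M.+1) _) (\sum_(j < M.+1) _) (_ * e) (fine i) => a b c k *.
by apply/andP; split; lra.
Qed.

(** The same on [[0, B]], by scaling. *)
Lemma hausdorff (B : R) : 0 < B ->
  exists s : {finite_measure set (measurableTypeR R) -> \bar R},
  s (~` `[0%R, B]%classic) = 0%E /\
  forall N, (\int[s]_(x in `[0%R, B]) (x ^+ N)%:E = (B ^+ N * mom N)%:E)%E.
Proof.
move=> B0; have [s1 [s1_out s1_mom]] := hausdorff01.
have mB : measurable_fun setT (fun x : measurableTypeR R => B * x : measurableTypeR R).
  by apply: measurable_funM; [exact: measurable_cst|exact: measurable_id].
pose phi := fun x : measurableTypeR R => B * x : measurableTypeR R.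
pose q := (pushforward s1 phi : {measure set (measurableTypeR R) -> \bar R}).
pose p : {measure set (measurableTypeR R) -> \bar R} := q mB.
have pT : (p setT < +oo)%E.
  by rewrite /p/= /pushforward preimage_setT; exact: fin_num_fun_lty.
pose s : {finite_measure set (measurableTypeR R) -> \bar R} := mfrestr measurableT pT.
have sE A : s A = s1 (phi @^-1` A) by rewrite /s/= /mfrestr/= /mrestr setIT.
have pre : phi @^-1` `[0, B]%classic = I01.
  apply/seteqP; split => x; rewrite /I01/= !in_itv/= pmulr_rge0//.
    by move=> /andP[-> ]; rewrite -[X in _ <= X]mulr1 ler_pM2l.
  by move=> /andP[-> x1]; rewrite -[X in _ <= X]mulr1 ler_pM2l.
exists s; split.
  by apply: etrans (sE _) _; apply: etrans s1_out; rewrite -pre.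
move=> N; transitivity (\int[p]_(x in `[0%R, B]) (x ^+ N)%:E)%E.
  by apply: eq_measure_integral => A mA _; exact: sE.
have mI : measurable (`[0, B]%classic : set (measurableTypeR R)) by exact: measurable_itv.
rewrite (@ge0_integral_pushforward _ _ _ _ _ phi mB s1)//.
- rewrite pre; under eq_integral => x _ do rewrite /= exprMn EFinM.
  rewrite ge0_integralZl//.
  + by rewrite s1_mom EFinM.
  + exact: measurable_itv.
  + by apply/measurable_EFinP/measurable_funX; exact: measurable_id.
  + by move=> x; rewrite /I01/= in_itv/= => /andP[x0 _]; rewrite lee_fin exprn_ge0.
  + by rewrite lee_fin exprn_ge0// ltW.
- by apply/measurable_EFinP/measurable_funX; exact: measurable_id.
- by move=> x; rewrite inE/= in_itv/= => /andP[x0 _]; rewrite lee_fin exprn_ge0.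
Qed.

End HausdorffMeasure.

(** * Totality of the powers of a bounded function *)

Section PolynomialStep.
Context {R : realType}.
Implicit Types (s t r c : R) (n N : nat).

Lemma bernoulli_ge (t : R) N : 0 <= t -> 1 + N%:R * t <= (1 + t) ^+ N.
Proof.
move=> t0; elim: N => [|N IH]; first by rewrite mul0r addr0 expr0.
rewrite exprS; apply: le_trans (ler_wpM2l _ IH); last by rewrite addr_ge0.
rewrite -natr1; have : 0 <= N%:R * t ^+ 2 by rewrite mulr_ge0// sqr_ge0.
by lra.
Qed.

Lemma bernoulli_sub (t : R) N : 0 <= t <= 1 -> 1 - N%:R * t <= (1 - t) ^+ N.
Proof.
move=> /andP[t0 t1]; elim: N => [|N IH]; first by rewrite mul0r subr0 expr0.
rewrite exprS; apply: le_trans (ler_wpM2l _ IH); last by rewrite subr_ge0.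
rewrite -natr1; have : 0 <= N%:R * t ^+ 2 by rewrite mulr_ge0// sqr_ge0.
by lra.
Qed.

Lemma natM_expr_cvg0 (r : R) : 0 <= r < 1 -> n%:R * r ^+ n @[n --> \oo] --> (0 : R).
Proof.
move=> /andP[r0 r1]; pose u := (1 + r) / 2; pose d := u^-1 - 1.
have u0 : 0 < u by rewrite /u; lra.
have u1 : u < 1 by rewrite /u; lra.
have d0 : 0 < d by rewrite subr_gt0 invf_gt1.
have ru : r <= u ^+ 2.
  by rewrite -subr_ge0 (_ : _ - _ = ((1 - r) / 2) ^+ 2) ?sqr_ge0// /u; field.
have bound n : n.+1%:R * r ^+ n.+1 <= (d ^+ 2)^-1 * n.+1%:R^-1.
  have un : u ^+ n.+1 * (1 + n.+1%:R * d) <= 1.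
    apply: le_trans (ler_wpM2l (exprn_ge0 _ (ltW u0)) (bernoulli_ge _ (ltW d0))) _.
    by rewrite -exprMn /d addrC subrK mulfV ?gt_eqF// expr1n.
  have nd : 0 < n.+1%:R * d by rewrite mulr_gt0.
  have un' : u ^+ n.+1 * (n.+1%:R * d) <= 1.
    apply: le_trans un; rewrite ler_wpM2l ?exprn_ge0 ?ltW//.
    by rewrite ltrDr.
  have -> : (d ^+ 2)^-1 * n.+1%:R^-1 = (d ^+ 2 * n.+1%:R)^-1 by rewrite [RHS]invfM.
  rewrite -[leRHS]div1r ler_pdivlMr ?mulr_gt0 ?exprn_gt0//.
  apply: (@le_trans _ _ ((u ^+ n.+1 * (n.+1%:R * d)) ^+ 2)).
    have h : r ^+ n.+1 <= (u ^+ n.+1) ^+ 2.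
      by rewrite -exprM mulnC exprM lerXn2r ?nnegrE ?sqr_ge0.
    rewrite (_ : n.+1%:R * r ^+ n.+1 * (d ^+ 2 * n.+1%:R) =
                 r ^+ n.+1 * (n.+1%:R * d) ^+ 2); last by ring.
    by rewrite [leRHS]exprMn ler_wpM2r ?sqr_ge0.
  by rewrite exprn_ile1// mulr_ge0 ?exprn_ge0 ?ltW.
rewrite -cvg_shiftS /=.
apply: (@squeeze_cvgr _ _ _ _ (cst 0) (fun n => (d ^+ 2)^-1 * n.+1%:R^-1)).
- by apply: nearW => n; rewrite bound mulr_ge0 ?exprn_ge0.
- exact: cvg_cst.
- rewrite -[X in _ --> X](mulr0 (d ^+ 2)^-1).
  by apply: cvgM; [exact: cvg_cst|exact: cvg_harmonic].
Qed.

(** Polynomials in [s] that converge on [[0, 1]], boundedly, to the indicator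
    function of [s < 1 / 2]: the mean number [n * 2 ^ n * s ^ n] of successes in
    [n * 2 ^ n] trials of probability [s ^ n] tends to [0] for [s < 1 / 2] and to
    infinity for [s >= 1 / 2]. *)
Definition stepq n s : R := (1 - s ^+ n) ^+ (n * 2 ^ n).

Lemma stepq_01 n s : 0 <= s <= 1 -> 0 <= stepq n s <= 1.
Proof.
move=> /andP[s0 s1]; have sn : 0 <= s ^+ n <= 1 by rewrite exprn_ge0 ?exprn_ile1.
by rewrite exprn_ge0 ?exprn_ile1//; lra.
Qed.

Lemma stepq_cvg s : 0 <= s <= 1 -> stepq n s @[n --> \oo] --> ((s < 2^-1)%R%:R : R).
Proof.
move=> s01; have /andP[s0 s1] := s01.
have sn n : 0 <= s ^+ n <= 1 by rewrite exprn_ge0 ?exprn_ile1.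
case: (ltP s 2^-1) => s2.
  apply: (@squeeze_cvgr _ _ _ _ (fun n => 1 - n%:R * (2 * s) ^+ n) (cst 1)).
  - apply: nearW => n; have /andP[_ ->] := stepq_01 n s01; rewrite andbT.
    by have := @bernoulli_sub _ (n * 2 ^ n) (sn n); rewrite natrM natrX exprMn mulrA.
  - rewrite -[X in _ --> X](subr0 1); apply: cvgB; first exact: cvg_cst.
    apply: natM_expr_cvg0; apply/andP; split; lra.
  - exact: cvg_cst.
rewrite -cvg_shiftS /=.
apply: (@squeeze_cvgr _ _ _ _ (cst 0) (fun n => n.+1%:R^-1)).
- apply: nearW => n; have /andP[-> _] := stepq_01 n.+1 s01; rewrite /=.
  set N := (n.+1 * 2 ^ n.+1)%N; set t := s ^+ n.+1.
  have t0 : 0 <= t by have /andP[] := sn n.+1.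
  have t1 : t <= 1 by have /andP[] := sn n.+1.
  have Nt : n.+1%:R <= N%:R * t.
    rewrite /N /t natrM -mulrA ler_peMr// natrX -exprMn.
    by rewrite exprn_ege1//; lra.
  rewrite -[leRHS]div1r ler_pdivlMr//.
  apply: (@le_trans _ _ ((1 - t) ^+ N * (1 + N%:R * t))).
    by rewrite ler_wpM2l ?exprn_ge0 ?subr_ge0//; lra.
  apply: le_trans (ler_wpM2l (exprn_ge0 _ _) (bernoulli_ge N t0)) _.
    by rewrite subr_ge0.
  rewrite -exprMn exprn_ile1//; first by rewrite mulr_ge0//; lra.
  by have := sqr_ge0 t; lra.
- exact: cvg_cst.
- exact: cvg_harmonic.
Qed.

End PolynomialStep.

Section PowersTotal.
Context {R : realType} (m : {measure set (measurableTypeR R) -> \bar R}).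
Local Notation T := (measurableTypeR R).
Variables (D : set T) (mD : measurable D) (r s g : R -> R).
Hypothesis mr : measurable_fun (D : set T) (r : T -> T).
Hypothesis ms : measurable_fun setT (s : T -> T).
Hypothesis r01 : forall x, D x -> 0 <= r x <= 1.
Hypothesis sr : forall x, D x -> s (r x) = x.
Hypothesis ig : m.-integrable D (EFin \o g).
Hypothesis g_pow : forall n : nat, \int[m]_(x in D) (g x * r x ^+ n) = 0.

Let mg : measurable_fun D g.
Proof. by apply/measurable_EFinP; exact: measurable_int ig. Qed.

Let mrp (p : {poly R}) : measurable_fun D (fun x => p.[r x]).
Proof.
under eq_fun do rewrite horner_coef.
apply: measurable_sum => i; apply: measurable_funM => //.
exact: measurable_funX.
Qed.

Let ig_mul (q : R -> R) : measurable_fun D q -> (forall x, D x -> `|q x| <= 1) ->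
  m.-integrable D (EFin \o (fun x => g x * q x)).
Proof.
move=> mq q1; apply: (integrable_le mD _ (integrable_abse ig)).
  exact: measurable_funM.
by move=> x Dx /=; rewrite normrM ler_piMr// q1.
Qed.

Let g_poly (p : {poly R}) : \int[m]_(x in D) (g x * p.[r x]) = 0.
Proof.
have igX i : m.-integrable D (EFin \o (fun x => g x * r x ^+ i)).
  apply: ig_mul => [|x /r01/andP[r0 r1]]; first exact: measurable_funX.
  by rewrite ger0_norm ?exprn_ge0 ?exprn_ile1.
suff H n (a : nat -> R) :
    m.-integrable D (EFin \o (fun x => \sum_(i < n) a i * (g x * r x ^+ i))) /\
    \int[m]_(x in D) (\sum_(i < n) a i * (g x * r x ^+ i)) = 0.
  rewrite -[RHS](H (size p) (fun i => p`_i)).2; apply: eq_Rintegral => x _.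
  by rewrite horner_coef mulr_sumr; apply: eq_bigr => i _; ring.
elim: n => [|n [IHi IH0]].
  split; first by under eq_fun do rewrite big_ord0; exact: integrable0.
  under eq_Rintegral do rewrite big_ord0.
  by rewrite /Rintegral integral0.
have ia : m.-integrable D (EFin \o (fun x => a n * (g x * r x ^+ n))).
  exact: (integrableZl mD (a n) (igX n)).
split.
  under eq_fun do rewrite big_ord_recr/=.
  exact: (integrableD mD IHi ia).
under eq_Rintegral do rewrite big_ord_recr/=.
by rewrite RintegralD// IH0 RintegralZl// g_pow mulr0 addr0.
Qed.

(** The test [r x < c] is turned into [h x < 1 / 2] for an affine function [h]
    of [r] with values in [[0, 1]]. *)
Let g_ray01 c : 0 <= c <= 1 -> \int[m]_(x in D) (g x * (r x < c)%R%:R) = 0.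
Proof.
move=> /andP[c0 c1].
pose h x := (1 + r x - c) / 2.
have h01 x : D x -> 0 <= h x <= 1.
  by move=> /r01 /andP[r0 r1]; rewrite /h; apply/andP; split; lra.
pose q n : {poly R} := (1 - (2^-1 *: ('X + (1 - c)%:P)) ^+ n) ^+ (n * 2 ^ n).
have qE n x : (q n).[r x] = stepq n (h x).
  rewrite /q /stepq horner_exp hornerD hornerN horner_exp hornerZ.
  by rewrite hornerD hornerX !hornerC /h mulrC addrCA addrA.
have mc : measurable_fun D (fun x => ((r x < c)%R%:R : R)).
  rewrite (_ : (fun x => _) = (\1_(`]-oo, c[%classic) : R -> R) \o r).
    exact: (measurable_comp measurableT).
  by apply/funext => x; rewrite /= indicE mem_setE in_itv.
have [_ _ cv] := @dominated_convergence _ _ _ m D mD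
  (fun n x => (g x * (q n).[r x])%:E) (fun x => (g x * (r x < c)%R%:R)%:E)
  (fun x => `|(g x)%:E|%E)
  (fun n => (measurable_EFinP _ _).2 (measurable_funM mg (mrp (q n))))
  ((measurable_EFinP _ _).2 (measurable_funM mg mc))
  ltac:(apply: aeW => x Dx; apply: cvg_EFin; [exact: nearW|];
    apply: cvgM; [exact: cvg_cst|];
    under eq_fun do rewrite qE; have -> : (r x < c) = (h x < 2^-1);
    [rewrite /h; apply/idP/idP; lra|exact/stepq_cvg/h01])
  (integrable_abse ig)
  ltac:(apply: aeW => x n Dx; rewrite lee_fin normrM ler_piMr// qE;
    have /andP[? ?] := stepq_01 n (h01 _ Dx); rewrite ger0_norm//).
have : (\int[m]_(x in D) (g x * (r x < c)%R%:R)%:E = 0)%E.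
  apply: cvg_unique cv _ => //; apply: cvg_near_cst; apply: nearW => n /=.
  rewrite -(@fineK _ (\int[m]_(x in D) _)%E).
    by congr (_%:E); exact: (g_poly (q n)).
  apply: (integrable_fin_num mD).
  apply: (ig_mul (mrp (q n))) => x Dx; rewrite qE.
  by have /andP[? ?] := stepq_01 n (h01 _ Dx); rewrite ger0_norm.
by rewrite /Rintegral => ->.
Qed.

Let g_ray c : (\int[m]_(x in D `&` r @^-1` `]-oo, c[%classic) (g x)%:E = 0)%E.
Proof.
have intE : (\int[m]_(x in D `&` r @^-1` `]-oo, c[%classic) (g x)%:E =
    \int[m]_(x in D) (g x * (r x < c)%R%:R)%:E)%E.
  rewrite integral_mkcondr; apply: eq_integral => x _.
  rewrite patchE; case: (ltP (r x) c) => rc.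
    by rewrite mem_set ?mulr1//= in_itv.
  by rewrite memNset ?mulr0//= in_itv/= ltNge rc.
have fin : (\int[m]_(x in D) (g x * (r x < c)%R%:R)%:E \is a fin_num)%E.
  apply: (integrable_fin_num mD); apply: ig_mul => [|x _].
    rewrite (_ : (fun x => _) = (\1_(`]-oo, c[%classic) : R -> R) \o r).
      exact: (measurable_comp measurableT).
    by apply/funext => x; rewrite /= indicE mem_setE in_itv.
  by case: (_ < _); rewrite ?normr1 ?normr0.
rewrite intE -(fineK fin); congr (_%:E).
rewrite -/(Rintegral m D (fun x => g x * (r x < c)%R%:R)).
case: (ltP c 0) => [c0|c0].
  under eq_Rintegral => x xD.
    have /andP[r0 _] := r01 (set_mem xD).
    rewrite ltNge (ltW (lt_le_trans c0 r0)) mulr0; over.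
  by rewrite /Rintegral integral0.
case: (leP c 1) => [c1|c1]; first by apply: g_ray01; rewrite c0.
rewrite -(g_pow 0); apply: eq_Rintegral => x xD.
by have /andP[_ r1] := r01 (set_mem xD); rewrite (le_lt_trans r1 c1) expr0.
Qed.

(** A pi-lambda argument from the rays. *)
Let g_preim (S : set T) : measurable S -> (\int[m]_(x in D `&` r @^-1` S) (g x)%:E = 0)%E.
Proof.
have mS (S' : set T) : measurable S' -> measurable (D `&` r @^-1` S') by move=> ?; exact: mr.
have igS (S' : set T) : measurable S' -> m.-integrable (D `&` r @^-1` S') (EFin \o g).
  by move=> ?; apply: (integrableS mD (mS _ _) _ ig) => //; exact: subIsetl.
have mE : @measurable _ T = <<s @RGenInftyO.G R >> by exact: RGenInftyO.measurableE.
rewrite [X in X S -> _]mE; move: S.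
apply: (@dynkin_induction _ T (@RGenInftyO.G R)
  (fun S => (\int[m]_(x in D `&` r @^-1` S) (g x)%:E = 0)%E)).
- exact: RGenInftyO.measurableE.
- move=> _ _ [x ->] [y ->]; exists (Num.min x y).
  by apply/seteqP; split => z /=; rewrite !in_itv/= lt_min => /andP.
- rewrite preimage_setT setIT; have := g_pow 0.
  under eq_Rintegral do rewrite expr0 mulr1.
  rewrite /Rintegral => h; rewrite -(fineK (integrable_fin_num mD ig)).
  by congr (_%:E).
- by move=> _ [c ->]; exact: g_ray.
- move=> S mS0 S0.
  have := @integral_setU_EFin _ _ _ m (D `&` r @^-1` S) (D `&` r @^-1` (~` S)) g.
  have DE : D `&` r @^-1` S `|` D `&` r @^-1` (~` S) = D.
    by rewrite -setIUr -preimage_setU setUv preimage_setT setIT.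
  rewrite DE S0 add0e => <-//.
  + rewrite -(fineK (integrable_fin_num mD ig)); congr (_%:E).
    by rewrite -(g_pow 0); apply: eq_Rintegral => x _; rewrite expr0 mulr1.
  + exact: mS.
  + by apply: mS; exact: measurableC.
  + apply/disj_setPS => x [[_ /= Sx] [_ /= nSx]]; exact: nSx.
- move=> F mF tF F0.
  rewrite preimage_bigcup setI_bigcupr integral_bigcup//=.
  + by rewrite eseries0// => i _ _; exact: F0.
  + apply/trivIsetP => i j _ _ ij.
    move/trivIsetP : tF => /(_ i j I I ij) Fij.
    rewrite setIACA setIid -preimage_setI Fij preimage_set0 setI0//.
  + by move=> i; exact: mS.
  + rewrite -setI_bigcupr -preimage_bigcup; apply: igS.
    exact: bigcup_measurable.
Qed.

(** The powers of [r] determine the integrals of [g] over the sets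
    [r @^-1` S], among which, [r] being injective, is the set [g > 0]. *)
Lemma powers_total : {ae m, forall x, D x -> g x = 0}.
Proof.
pose P : set T := D `&` [set x | 0 < g x].
have mP : measurable P.
  rewrite (_ : P = D `&` g @^-1` `]0, +oo[%classic); first exact: mg.
  by apply/seteqP; split => x []/= Dx gx; split => //; move: gx; rewrite /= in_itv/= andbT.
have mS : measurable (s @^-1` P) by rewrite -[X in measurable X]setTI; exact: ms.
have PE : D `&` r @^-1` (s @^-1` P) = P.
  apply/seteqP; split => x /=; first by move=> [Dx]; rewrite sr.
  by move=> Px; have [Dx _] := Px; rewrite sr.
have intP : (\int[m]_(x in P) (g x)%:E = 0)%E by rewrite -{1}PE g_preim.
have intD : (\int[m]_(x in D) (g x)%:E = 0)%E.
  have := g_preim measurableT; by rewrite preimage_setT setIT.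
have intN : (\int[m]_(x in D `\` P) (g x)%:E = 0)%E.
  have := @integral_setU_EFin _ _ _ m P (D `\` P) g.
  rewrite setDUK; last exact: subIsetl.
  rewrite intD intP add0e => <-//.
  - exact: measurableD.
  - by apply/disj_setPS => x [Px [_]].
have abs0 : (\int[m]_(x in D) `|(g x)%:E| = 0)%E.
  have mDP : measurable (D `\` P) by exact: measurableD.
  have -> : D = P `|` (D `\` P) by rewrite setDUK//; exact: subIsetl.
  rewrite ge0_integral_setU//=.
  - under eq_integral => x xP.
      rewrite ger0_norm; last by have [_ /ltW] := set_mem xP.
      over.
    rewrite intP add0e.
    under eq_integral => x xN.
      rewrite ler0_norm; last first.
        have [Dx nP] := set_mem xN; rewrite leNgt; apply/negP => gx; exact: nP.
      rewrite EFinN; over.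
    rewrite integralN/= ?intN ?oppe0//.
    have igN := integrableS mD mDP (@subDsetl _ _ _) ig.
    apply: fin_num_adde_defl; rewrite fin_numN.
    exact: (integrable_neg_fin_num mDP igN).
  - apply/measurable_EFinP; rewrite setDUK; last exact: subIsetl.
    exact: measurableT_comp.
  - by apply/disj_setPS => x [Px [_]].
have /(ae_eq_integral_abs m mD) := abs0.
move=> /(_ ((measurable_EFinP _ _).2 mg)); apply: filterS => x /[apply].
by move=> /= [].
Qed.

End PowersTotal.

(** * Iterated integrals over product domains *)

Section IteratedIntegrals.
Context d1 d2 (T1 : measurableType d1) (T2 : measurableType d2) (R : realType).
Variables (m1 : {sigma_finite_measure set T1 -> \bar R})
  (m2 : {sigma_finite_measure set T2 -> \bar R}).
Variables (D1 : set T1) (D2 : set T2).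
Hypotheses (mD1 : measurable D1) (mD2 : measurable D2).
Implicit Types k : T1 * T2 -> \bar R.

Let mD12 : measurable (D1 `*` D2). Proof. exact: measurableX. Qed.

Lemma patch_section1 k x y : (k \_ (D1 `*` D2)) (x, y) =
  if x \in D1 then ((fun y => k (x, y)) \_ D2) y else 0%E.
Proof. by rewrite !patchE in_setX/=; case: (x \in D1). Qed.

Lemma patch_section2 k x y : (k \_ (D1 `*` D2)) (x, y) =
  if y \in D2 then ((fun x => k (x, y)) \_ D1) x else 0%E.
Proof. by rewrite !patchE in_setX/= andbC; case: (y \in D2). Qed.

Lemma integral_patch1 k x : (\int[m2]_y (k \_ (D1 `*` D2)) (x, y) =
  ((fun x => \int[m2]_(y in D2) k (x, y)) \_ D1) x)%E.
Proof.
under eq_integral do rewrite patch_section1.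
rewrite [RHS]patchE; case: ifPn => xD; first by rewrite -integral_mkcond.
exact: integral0.
Qed.

Lemma integral_patch2 k y : (\int[m1]_x (k \_ (D1 `*` D2)) (x, y) =
  ((fun y => \int[m1]_(x in D1) k (x, y)) \_ D2) y)%E.
Proof.
under eq_integral do rewrite patch_section2.
rewrite [RHS]patchE; case: ifPn => xD; first by rewrite -integral_mkcond.
exact: integral0.
Qed.

Section Nonneg.
Variable k : T1 * T2 -> \bar R.
Hypotheses (mk : measurable_fun (D1 `*` D2) k)
  (k0 : forall x y, D1 x -> D2 y -> (0 <= k (x, y))%E).

Let mkp : measurable_fun setT (k \_ (D1 `*` D2)).
Proof. exact: (measurable_restrictT _ mD12).1. Qed.

Let kp0 z : (0 <= (k \_ (D1 `*` D2)) z)%E.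
Proof.
rewrite patchE; case: ifPn => //; rewrite inE; case: z => x y [] /=.
exact: k0.
Qed.

Lemma tonelli_on : (\int[m1]_(x in D1) \int[m2]_(y in D2) k (x, y) =
  \int[m2]_(y in D2) \int[m1]_(x in D1) k (x, y))%E.
Proof.
rewrite integral_mkcond [RHS]integral_mkcond.
under eq_integral do rewrite -integral_patch1.
under [RHS]eq_integral do rewrite -integral_patch2.
exact: fubini_tonelli.
Qed.

Lemma measurable_tonelli : measurable_fun D2 (fun y => \int[m1]_(x in D1) k (x, y))%E.
Proof.
apply/measurable_restrictT => //.
have -> : (fun y => \int[m1]_(x in D1) k (x, y))%E \_ D2 =
    fubini_G m1 (k \_ (D1 `*` D2)).
  by apply/funext => y; rewrite /fubini_G integral_patch2.
exact: measurable_fun_fubini_tonelli_G.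
Qed.

End Nonneg.

Lemma fubini_on (k : T1 * T2 -> R) : measurable_fun (D1 `*` D2) k ->
  (forall x, D1 x -> m2.-integrable D2 (fun y => (k (x, y))%:E)) ->
  (forall y, D2 y -> m1.-integrable D1 (fun x => (k (x, y))%:E)) ->
  (\int[m1]_(x in D1) \int[m2]_(y in D2) `|k (x, y)|%:E < +oo)%E ->
  \int[m1]_(x in D1) \int[m2]_(y in D2) k (x, y) =
  \int[m2]_(y in D2) \int[m1]_(x in D1) k (x, y).
Proof.
move=> mk i2 i1 k12; rewrite /Rintegral; congr fine.
under eq_integral => x /set_mem Dx do rewrite fineK ?(integrable_fin_num mD2 (i2 x Dx))//.
under [RHS]eq_integral => y /set_mem Dy
  do rewrite fineK ?(integrable_fin_num mD1 (i1 y Dy))//.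
have mkp : measurable_fun setT ((EFin \o k) \_ (D1 `*` D2)).
  by apply: (measurable_restrictT _ mD12).1; apply: measurableT_comp.
have ip : (m1 \x m2)%E.-integrable setT ((EFin \o k) \_ (D1 `*` D2)).
  apply/(integrable12ltyP m1 m2 mkp).
  have -> : (\int[m1]_x \int[m2]_y `|((EFin \o k) \_ (D1 `*` D2)) (x, y)| =
      \int[m1]_(x in D1) \int[m2]_(y in D2) `|k (x, y)|%:E)%E; last by [].
    rewrite [RHS]integral_mkcond; apply: eq_integral => x _.
    rewrite -(integral_patch1 (fun z => `|k z|%:E)); apply: eq_integral => y _.
    by rewrite !patchE; case: ifP => //; rewrite abse0.
rewrite integral_mkcond [RHS]integral_mkcond.
under eq_integral do rewrite -(integral_patch1 (EFin \o k)).
under [RHS]eq_integral do rewrite -(integral_patch2 (EFin \o k)).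
exact: Fubini.
Qed.

End IteratedIntegrals.

(** * Integrals over the half-line *)

Section HalfLine.
Context {R : realType}.
Local Notation T := (measurableTypeR R).
Local Notation leb := (@lebesgue_measure R).
Local Notation Rpos := (@Rpos R).
Implicit Types (f F : R -> R) (a b c t x y : R).

Lemma RposP x : Rpos x <-> 0 < x.
Proof. by rewrite /Defs.Rpos/= in_itv/= andbT. Qed.

Lemma mRpos : measurable (Rpos : set T).
Proof. exact: measurable_itv. Qed.

Lemma Rpos_open : open Rpos.
Proof. exact: interval_open. Qed.

Lemma continuous_Rpos_measurable f : (forall x, 0 < x -> {for x, continuous f}) ->
  measurable_fun (Rpos : set T) f.
Proof.
move=> cf; apply: open_continuous_measurable_fun; first exact: Rpos_open.
by move=> x /set_mem/RposP; exact: cf.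
Qed.

Lemma is_derive_cont f x (df : R) : is_derive x 1 f df -> {for x, continuous f}.
Proof. by move=> [fx _]; apply/differentiable_continuous/derivable1_diffP. Qed.

Lemma is_derive_scale k f x (df : R) : is_derive x 1 f df ->
  is_derive x 1 (fun y => k * f y) (k * df).
Proof. by move=> h; exact: is_deriveZ. Qed.

Lemma is_derive_opp f x (df : R) : is_derive x 1 f df ->
  is_derive x 1 (fun y => - f y) (- df).
Proof. by move=> h; exact: is_deriveN. Qed.

Lemma derivable_is_derive f x : derivable f x 1 -> is_derive x 1 f (derive1 f x).
Proof. by move=> d; rewrite derive1E; exact: derivableP. Qed.

Lemma derivable_continuous f x : derivable f x 1 -> {for x, continuous f}.
Proof. by move=> /derivable1_diffP; exact: differentiable_continuous. Qed.

(** Monotone convergence along the intervals [1/(n+1), n+2]. *)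
Lemma improper_le f F c : (forall x, 0 < x -> 0 <= f x) ->
  (forall x, 0 < x -> {for x, continuous f}) ->
  (forall x, 0 < x -> is_derive x 1 F (f x)) ->
  (forall a b, 0 < a -> a < b -> F b - F a <= c) ->
  (\int[leb]_(x in Rpos) (f x)%:E <= c%:E)%E.
Proof.
move=> f0 cf dF Fc.
pose I n : set T := `[n.+1%:R^-1, n.+2%:R]%classic.
have Ipos n x : I n x -> 0 < x.
  by rewrite /I/= in_itv/= => /andP[+ _]; apply: lt_le_trans; rewrite invr_gt0.
have IU : \bigcup_n I n = Rpos.
  apply/seteqP; split => [x [n _ /Ipos x0]|x /RposP x0]; first exact/RposP.
  pose n := maxn (Num.truncn x) (Num.truncn x^-1).
  exists n => //; rewrite /I/= in_itv/=; apply/andP; split.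
    rewrite invf_ple ?posrE//; apply/ltW/(lt_le_trans (truncnS_gt _)).
    by rewrite ler_nat ltnS leq_maxr.
  apply/ltW/(lt_le_trans (truncnS_gt _)).
  by rewrite ler_nat ltnS (leq_trans (leq_maxl _ (Num.truncn x^-1)))// leqW.
rewrite -IU.
have mf : measurable_fun (Rpos : set T) (EFin \o f).
  by apply: measurableT_comp => //; exact: continuous_Rpos_measurable.
have h : (\int[leb]_(x in I i) (f x)%:E)%E @[i --> \oo] -->
    (\int[leb]_(x in \bigcup_i I i) (f x)%:E)%E.
  apply: (@ge0_nondecreasing_set_cvg_integral _ T R I (EFin \o f) leb).
  - move=> m n mn; apply/subsetPset => x; rewrite /I/= !in_itv/= => /andP[x1 x2].
    apply/andP; split.
      by apply: le_trans x1; rewrite lef_pV2 ?posrE// ler_nat ltnS.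
    by apply: (le_trans x2); rewrite ler_nat !ltnS.
  - by move=> n; exact: measurable_itv.
  - move=> n; apply: measurable_funS mf; first exact: mRpos.
    by move=> x /Ipos/RposP.
  - by move=> n x /Ipos x0; rewrite lee_fin f0.
apply: cvge_le h.
apply: nearW => n.
have n12 : n.+1%:R^-1 < n.+2%:R :> R.
  apply: (@le_lt_trans _ _ 1); last by rewrite ltr1n.
  by rewrite invf_le1// ler1n.
have n0 : 0 < n.+1%:R^-1 :> R by rewrite invr_gt0.
rewrite (@continuous_FTC2 _ f F)//.
- by rewrite -EFinB lee_fin Fc.
- by apply: continuous_in_subspaceT => x /set_mem/Ipos/cf.
- split.
  + move=> x; rewrite in_itv/= => /andP[x1 _].
    by have [] := dF x (lt_trans n0 x1).
  + apply: cvg_at_right_filter; exact: is_derive_cont (dF _ n0).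
  + apply: cvg_at_left_filter.
    exact: is_derive_cont (dF _ (lt_trans n0 n12)).
- move=> x; rewrite in_itv/= => /andP[x1 _].
  by rewrite derive1E; have [_ ->] := dF x (lt_trans n0 x1).
Qed.

Lemma continuous_Rsqrt x : {for x, continuous (@Num.sqrt R)}.
Proof. exact: sqrt_continuous. Qed.

(** The primitive is [2 t^(-1/2) atan (sqrt (x / t))]. *)
Lemma int_stieltjes t : 0 < t ->
  (\int[leb]_(x in Rpos) ((Num.sqrt x)^-1 / (x + t))%:E <= (pi / Num.sqrt t)%:E)%E.
Proof.
move=> t0; have st0 : 0 < Num.sqrt t by rewrite sqrtr_gt0.
pose F x := 2 / Num.sqrt t * atan ((Num.sqrt t)^-1 * Num.sqrt x).
apply: (@improper_le (fun x => (Num.sqrt x)^-1 / (x + t)) F).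
- by move=> x x0; rewrite mulr_ge0 ?invr_ge0 ?sqrtr_ge0// addr_ge0 ?ltW.
- move=> x x0; apply: continuousM; apply: continuousV.
  + by rewrite gt_eqF// sqrtr_gt0.
  + exact: continuous_Rsqrt.
  + by rewrite gt_eqF// addr_gt0.
  + by apply: continuousD => //; exact: cvg_cst.
- move=> x x0; have sx0 : 0 < Num.sqrt x by rewrite sqrtr_gt0.
  have d1 : is_derive x 1 (fun x => (Num.sqrt t)^-1 * Num.sqrt x)
      ((Num.sqrt t)^-1 * (2 * Num.sqrt x)^-1).
    exact: is_derive_scale (is_derive1_sqrt x0).
  have d2 := is_derive1_comp (is_derive1_atan _) d1.
  have d3 := is_derive_scale (2 / Num.sqrt t) d2.
  apply: is_derive_eq d3 _.
  rewrite (_ : x + t = Num.sqrt x ^+ 2 + Num.sqrt t ^+ 2); last first.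
    by rewrite !sqr_sqrtr// ltW.
  move: (Num.sqrt x) (Num.sqrt t) sx0 st0 => u v u0 v0.
  field.
  by rewrite !gt_eqF//= addr_gt0// exprn_gt0.
- move=> a b a0 ab; rewrite /F -mulrBr.
  have h : atan ((Num.sqrt t)^-1 * Num.sqrt b) - atan ((Num.sqrt t)^-1 * Num.sqrt a)
      <= pi / 2.
    have := atan_ltpi2 ((Num.sqrt t)^-1 * Num.sqrt b).
    have : 0 <= atan ((Num.sqrt t)^-1 * Num.sqrt a).
      by rewrite -[leLHS]atan0 le_atan// mulr_ge0 ?invr_ge0 ?sqrtr_ge0.
    by move: (atan _) (atan _) => u v; lra.
  apply: le_trans (ler_wpM2l _ h) _; first by rewrite divr_ge0// ltW.
  by rewrite (_ : 2 / _ * _ = pi / Num.sqrt t)//; field; rewrite gt_eqF.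
Qed.

Lemma mulVr_sqrtV y : 0 < y -> y^-1 / Num.sqrt y^-1 = (Num.sqrt y)^-1.
Proof.
move=> y0; rewrite sqrtrV ?ltW// invrK -[in y^-1](sqr_sqrtr (ltW y0)) expr2 invfM.
by rewrite -mulrA mulVf ?mulr1// gt_eqF// sqrtr_gt0.
Qed.

Lemma expRN_le x : 0 <= x -> expR (- x) <= (1 + x)^-1.
Proof.
move=> x0; rewrite expRN lef_pV2 ?posrE ?expR_gt0//; last by rewrite ltr_pwDl.
exact: expR_ge1Dx.
Qed.

Lemma mul_expRN_le x y : 0 < y -> x * expR (- (y * x)) <= 2 / y * expR (- (y / 2 * x)).
Proof.
move=> y0; have -> : - (y * x) = - (y / 2 * x) - (y / 2 * x) by field.
rewrite expRD mulrA ler_wpM2r ?expR_ge0//.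
rewrite {1}(_ : x = 2 / y * (y / 2 * x)); last by field; rewrite gt_eqF.
move: (y / 2 * x) => w; rewrite -(mulrA (2 / y)) ger_pMr ?divr_gt0//.
rewrite expRN ler_pdivrMr ?expR_gt0// mul1r.
by apply: le_trans (expR_ge1Dx w); rewrite lerDr.
Qed.

Lemma sqrt_expRN_le x y : 0 < y -> 0 < x ->
  Num.sqrt x * expR (- (y * x)) <= 1 + y^-1.
Proof.
move=> y0 x0; apply: (@le_trans _ _ ((1 + x) * (1 + y * x)^-1)).
  rewrite ler_pM ?expR_ge0 ?sqrtr_ge0//; last by rewrite expRN_le// mulr_ge0// ltW.
  rewrite -[in leRHS](sqr_sqrtr (ltW x0)).
  by have := sqr_ge0 (Num.sqrt x - 1); rewrite sqrrB expr1n mulr1; move: (Num.sqrt x) => a; nra.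
have yx : 0 < 1 + y * x by rewrite addr_gt0// mulr_gt0.
rewrite ler_pdivrMr// mulrDl !mul1r mulrDr mulr1 mulKf ?gt_eqF//.
have : 0 < y * x by rewrite mulr_gt0.
have : 0 < y^-1 by rewrite invr_gt0.
lra.
Qed.

Lemma measurable_exp_mul y (D : set T) : measurable_fun D (fun x : T => expR (- (y * x))).
Proof.
apply: (measurableT_comp (@measurable_expR R)); exact: measurableT_comp.
Qed.

Lemma measurable_Rsqrt (D : set T) : measurable_fun D (@Num.sqrt R : T -> T).
Proof.
apply: measurable_funTS; apply: continuous_measurable_fun.
exact: sqrt_continuous.
Qed.

Lemma measurable_sqrtV : measurable_fun (Rpos : set T) (fun x : T => (Num.sqrt x)^-1).
Proof.
apply: continuous_Rpos_measurable => x x0; apply: continuousV.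
  by rewrite gt_eqF// sqrtr_gt0.
exact: continuous_Rsqrt.
Qed.

Lemma int_exp_sqrt y : 0 < y ->
  (\int[leb]_(x in Rpos) (expR (- (y * x)) / Num.sqrt x)%:E <= (pi / Num.sqrt y)%:E)%E.
Proof.
move=> y0; apply: (@le_trans _ _ (\int[leb]_(x in Rpos)
    (y^-1%:E * ((Num.sqrt x)^-1 / (x + y^-1))%:E))%E).
  apply: ge0_le_integral; first exact: mRpos.
  - by move=> x _; rewrite lee_fin divr_ge0 ?expR_ge0 ?sqrtr_ge0.
  - apply/measurable_EFinP/measurable_funM; first exact: measurable_exp_mul.
    exact: measurable_sqrtV.
  - apply/measurable_EFinP/measurable_funM => //.
    apply: measurable_funM; first exact: measurable_sqrtV.
    apply: continuous_Rpos_measurable => x x0; apply: continuousV.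
      by rewrite gt_eqF// addr_gt0// invr_gt0.
    by apply: continuousD => //; exact: cvg_cst.
  - move=> x /RposP x0; rewrite -EFinM lee_fin mulrCA mulrC ler_wpM2l ?invr_ge0 ?sqrtr_ge0//.
    apply: le_trans (expRN_le _) _; first by rewrite mulr_ge0// ltW.
    rewrite -invfM mulrDr mulfV ?gt_eqF// [_ + 1]addrC lexx//.
rewrite ge0_integralZl//; last 4 first.
- exact: mRpos.
- apply/measurable_EFinP/measurable_funM; first exact: measurable_sqrtV.
  apply: continuous_Rpos_measurable => x x0; apply: continuousV.
    by rewrite gt_eqF// addr_gt0// invr_gt0.
  by apply: continuousD => //; exact: cvg_cst.
- move=> x /RposP x0; rewrite lee_fin divr_ge0 ?invr_ge0 ?sqrtr_ge0//.
  by rewrite addr_ge0 ?invr_ge0 ?ltW.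
- by rewrite lee_fin invr_ge0 ltW.
apply: le_trans (lee_wpmul2l _ (int_stieltjes _)) _.
- by rewrite lee_fin invr_ge0 ltW.
- by rewrite invr_gt0.
- by rewrite -EFinM lee_fin mulrCA mulVr_sqrtV.
Qed.

Lemma int_exp_tail l y : 0 < y ->
  (\int[leb]_(x in `]l, +oo[) (y * expR (- (y * x)))%:E = (expR (- (y * l)))%:E)%E.
Proof.
move=> y0.
have cE : continuous (fun x => expR (- (y * x))).
  move=> x; apply: continuous_comp; last exact: continuous_expR.
  by apply: continuousN; apply: continuousM => //; exact: cvg_cst.
have dE x : is_derive x 1 (fun x => - expR (- (y * x))) (y * expR (- (y * x))).
  have d1 : is_derive x 1 (fun x => - (y * x)) (- y).
    have := is_derive_opp (is_derive_scale y (is_derive_id x 1)).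
    by rewrite mulr1.
  have := is_derive_opp (is_derive1_comp (is_derive_expR _) d1).
  by move=> h; apply: is_derive_eq h _; rewrite mulrN opprK mulrC.
rewrite integral_itv_obnd_cbnd; last first.
  apply/measurable_EFinP/measurable_funM => //; exact: measurable_exp_mul.
rewrite (@ge0_continuous_FTC2y _ _ (fun x => - expR (- (y * x))) _ 0).
- by rewrite sub0e -EFinN opprK.
- by move=> x _; rewrite mulr_ge0 ?expR_ge0 ?ltW.
- apply: continuous_subspaceT => x; apply: cvgM; last exact: cE.
  exact: cvg_cst.
- rewrite -oppr0; apply: cvgN.
  apply: (@cvg_comp _ _ _ (fun x => y * x) (fun x => expR (- x)) _ +oo%R);
    last exact: cvgr_expR.
  exact: gt0_cvgMry.
- by move=> x _; have [] := dE x.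
- by apply: cvg_at_right_filter; apply: cvgN; exact: cE.
- by move=> x _; rewrite derive1E; have [_ ->] := dE x.
Qed.

End HalfLine.

(** * Carleson measures and the Schur test *)

Section Carleson.
Context {R : realType}.
Local Notation T := (measurableTypeR R).
Local Notation leb := (@lebesgue_measure R).
Local Notation Rpos := (@Rpos R).
Implicit Types (m : {measure set T -> \bar R}) (c t x y l : R) (f g : R -> R).

Lemma measurable_on1 f : measurable_fun (Rpos : set T) f ->
  measurable_fun (Rpos `*` Rpos : set (T * T)) (fun z => f z.1).
Proof.
move=> mf; apply: (measurable_comp mRpos _ mf).
  by move=> _ [z [z1 _] <-].
exact: measurable_funTS measurable_fst.
Qed.

Lemma measurable_on2 f : measurable_fun (Rpos : set T) f ->
  measurable_fun (Rpos `*` Rpos : set (T * T)) (fun z => f z.2).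
Proof.
move=> mf; apply: (measurable_comp mRpos _ mf).
  by move=> _ [z [_ z2] <-].
exact: measurable_funTS measurable_snd.
Qed.

Lemma measurable_exp2 (D : set (T * T)) :
  measurable_fun D (fun z : T * T => expR (- (z.1 * z.2))).
Proof.
apply: measurable_funTS; apply: (measurableT_comp (@measurable_expR R)).
apply: measurableT_comp => //.
by apply: measurable_funM; [exact: measurable_fst|exact: measurable_snd].
Qed.

(** The hypothesis of the Schur test for the kernel [expR (- (x * y))] with the
    weight [x^(-1/2)]. *)
Definition schur m c := forall y, 0 < y ->
  (\int[m]_(x in Rpos) (expR (- (y * x)) / Num.sqrt x)%:E <= (c / Num.sqrt y)%:E)%E.

(** On [s <= 1 / x] the integrand is at least [sqrt x / e]. *)
Lemma inv_sqrt_le x : 0 < x -> (((Num.sqrt x)^-1)%:E <=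
  (expR 1)%:E * \int[leb]_(s in Rpos) (expR (- (x * s)) / Num.sqrt s)%:E)%E.
Proof.
move=> x0.
have mk : measurable_fun (Rpos : set T) (fun s => (expR (- (x * s)) / Num.sqrt s)%:E).
  apply/measurable_EFinP/measurable_funM; first exact: measurable_exp_mul.
  exact: measurable_sqrtV.
pose I : set T := `]0%R, x^-1]%classic.
have mI : measurable I by exact: measurable_itv.
have sub : I `<=` Rpos.
  by move=> s; rewrite /I/= in_itv/= => /andP[s0 _]; exact/RposP.
have h : ((expR (- 1) * Num.sqrt x * x^-1)%:E <=
    \int[leb]_(s in Rpos) (expR (- (x * s)) / Num.sqrt s)%:E)%E.
  have h0 : (\int[leb]_(s in I) (expR (- (x * s)) / Num.sqrt s)%:E <=
      \int[leb]_(s in Rpos) (expR (- (x * s)) / Num.sqrt s)%:E)%E.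
    apply: ge0_subset_integral => //.
    exact: mRpos.
  apply: le_trans h0.
  apply: (@le_trans _ _ (\int[leb]_(s in I)
    (expR (- 1) * Num.sqrt x)%:E)%E).
    rewrite integral_cst//= /I lebesgue_measure_itv/= lte_fin invr_gt0 x0.
    by rewrite sube0 EFinM.
  apply: ge0_le_integral => //.
  - by apply: (measurable_funS _ sub mk); exact: mRpos.
  - move=> s; rewrite /I/= in_itv/= => /andP[s0 sx].
    rewrite lee_fin ler_pM ?expR_ge0 ?sqrtr_ge0//.
      by rewrite ler_expR lerN2 -ler_pdivlMl// mulr1.
    rewrite -[leLHS]invrK lef_pV2 ?posrE ?invr_gt0 ?sqrtr_gt0//.
    by rewrite -(sqrtrV (ltW x0)) ler_wsqrtr.
apply: le_trans (lee_wpmul2l _ h); last by rewrite lee_fin expR_ge0.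
rewrite -EFinM lee_fin expRN !mulrA mulfV ?gt_eqF ?expR_gt0// mul1r.
rewrite -[in x^-1](sqr_sqrtr (ltW x0)) expr2 invfM mulrA mulfV ?mul1r//.
by rewrite gt_eqF ?sqrtr_gt0.
Qed.

Section CarlesonBounds.
Variables (mu : {sigma_finite_measure set T -> \bar R}) (C : R).
Hypothesis C_bound : forall a : R, 0 < a -> (mu `[0%R, a[%classic <= (C * a)%:E)%E.

Let C_ge0 : 0 <= C.
Proof.
have := C_bound ltr01; rewrite mulr1 -lee_fin; apply: le_trans.
exact: measure_ge0.
Qed.

(** Layer-cake: [expR (- (t * l))] is the integral of [t * expR (- (t * x))] over
    [x > l], so that Tonelli's theorem brings in the measures of the intervals
    [[0, x[]. *)
Lemma carleson_laplace t : 0 < t ->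
  (\int[mu]_(l in Rpos) (expR (- (t * l)))%:E <= (4 * C / t)%:E)%E.
Proof.
move=> t0.
pose k (z : T * T) : \bar R := if z.1 < z.2 then (t * expR (- (t * z.2)))%:E else 0%E.
have k0 z : (0 <= k z)%E.
  by rewrite /k; case: ifP => // _; rewrite lee_fin mulr_ge0 ?expR_ge0 ?ltW.
have mk : measurable_fun (Rpos `*` Rpos : set (T * T)) k.
  apply: measurable_funTS; apply: measurable_fun_ifT => //.
    by apply: measurable_fun_ltr; [exact: measurable_fst|exact: measurable_snd].
  apply: measurableT_comp => //; apply: measurable_funM => //.
  apply: (measurableT_comp (@measurable_expR R)); apply: measurableT_comp => //.
  by apply: measurable_funM => //; exact: measurable_snd.
have -> : (\int[mu]_(l in Rpos) (expR (- (t * l)))%:E =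
    \int[mu]_(l in Rpos) \int[leb]_(x in Rpos) k (l, x))%E.
  apply: eq_integral => l /set_mem/RposP l0; rewrite -int_exp_tail//.
  rewrite integral_mkcond [RHS]integral_mkcond; apply: eq_integral => x _.
  rewrite !patchE; case: ifPn => [/set_mem|/negP].
    rewrite /= in_itv/= andbT => lx; rewrite ifT; last exact/mem_set/RposP/(lt_trans l0).
    by rewrite /k/= lx.
  move=> xl; case: ifPn => // _; rewrite /k/= ifF//; apply/negP => lx; apply: xl.
  by apply/mem_set; rewrite /= in_itv/= lx.
rewrite (tonelli_on mu leb mRpos mRpos mk); last by move=> *; exact: k0.
apply: (@le_trans _ _ (\int[leb]_(x in Rpos)
    ((4 * C / t)%:E * (t / 2 * expR (- (t / 2 * x)))%:E))%E).
  apply: ge0_le_integral; first exact: mRpos.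
  - by move=> x _; exact: integral_ge0.
  - by apply: (measurable_tonelli mu mRpos mRpos mk) => *; exact: k0.
  - apply/measurable_EFinP/measurable_funM => //; apply: measurable_funM => //.
    exact: measurable_exp_mul.
  move=> x /RposP x0.
  have -> : (\int[mu]_(l in Rpos) k (l, x) =
      (t * expR (- (t * x)))%:E * mu (`]-oo, x[%classic `&` Rpos))%E.
    rewrite -integral_indic//; last exact: mRpos.
    rewrite -ge0_integralZl//; last 3 first.
    + exact: mRpos.
    + by apply/measurable_EFinP; exact: measurable_indic.
    + by rewrite lee_fin mulr_ge0 ?expR_ge0 ?ltW.
    apply: eq_integral => l _; rewrite /k/= indicE.
    have -> : (l \in (`]-oo, x[%classic : set R)) = (l < x).
      by apply/idP/idP => [/set_mem|lx]; rewrite ?inE/= in_itv.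
    by case: ifP; rewrite ?mule1 ?mule0.
  apply: (@le_trans _ _ ((t * expR (- (t * x)))%:E * (C * x)%:E)%E).
    apply: lee_wpmul2l; first by rewrite lee_fin mulr_ge0 ?expR_ge0 ?ltW.
    apply: le_trans (C_bound x0); apply: le_measure; rewrite ?inE//.
      by apply: measurableI => //; exact: mRpos.
    by move=> l [/=]; rewrite in_itv/= => lx /RposP l0; rewrite in_itv/= lx ltW.
  rewrite -!EFinM lee_fin.
  have -> : t * expR (- (t * x)) * (C * x) = C * t * (x * expR (- (t * x))) by ring.
  have -> : 4 * C / t * (t / 2 * expR (- (t / 2 * x))) =
      C * t * (2 / t * expR (- (t / 2 * x))) by field; rewrite gt_eqF.
  by rewrite ler_wpM2l ?mul_expRN_le// mulr_ge0// ltW.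
rewrite ge0_integralZl//; last 4 first.
- exact: mRpos.
- apply/measurable_EFinP/measurable_funM => //; exact: measurable_exp_mul.
- by move=> x _; rewrite lee_fin mulr_ge0 ?expR_ge0// divr_ge0 ?ltW.
- by rewrite lee_fin divr_ge0 ?mulr_ge0// ltW.
by rewrite /Defs.Rpos int_exp_tail ?divr_gt0// mulr0 oppr0 expR0 mule1.
Qed.

(** By [inv_sqrt_le] the weight [1 / sqrt x] is dominated by a superposition of
    exponentials, to which [carleson_laplace] applies; what
    remains is the integral of [1 / (sqrt s * (s + y))]. *)
Lemma schur_carleson : schur mu (4 * C * expR 1 * pi).
Proof.
move=> y y0.
pose k (z : T * T) : \bar R := (expR (- ((y + z.2) * z.1)) / Num.sqrt z.2)%:E.
have k0 z : (0 <= k z)%E by rewrite lee_fin divr_ge0 ?expR_ge0 ?sqrtr_ge0.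
have mk : measurable_fun (Rpos `*` Rpos : set (T * T)) k.
  apply/measurable_EFinP/measurable_funM; last first.
    by apply: (measurable_on2 (f := fun x => (Num.sqrt x)^-1)); exact: measurable_sqrtV.
  apply: measurable_funTS; apply: (measurableT_comp (@measurable_expR R)).
  apply: measurableT_comp => //; apply: measurable_funM => //.
  exact: measurable_funD.
have my x : measurable_fun (Rpos : set T) (fun s => (expR (- (x * s)) / Num.sqrt s)%:E).
  apply/measurable_EFinP/measurable_funM; first exact: measurable_exp_mul.
  exact: measurable_sqrtV.
have e0 : (0 <= (expR 1 : R)%:E)%E by rewrite lee_fin expR_ge0.
have kint x : Rpos x -> (\int[leb]_(s in Rpos) k (x, s) = (expR (- (y * x)))%:E *
    \int[leb]_(s in Rpos) (expR (- (x * s)) / Num.sqrt s)%:E)%E.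
  move=> _; rewrite -ge0_integralZl//; last exact: mRpos.
  apply: eq_integral => s _; rewrite /k/= -EFinM mulrA -expRD; congr ((expR _ / _)%:E).
  by ring.
have mI1 : measurable_fun (Rpos : set T) (fun x => \int[leb]_(s in Rpos) k (x, s))%E.
  pose k' z := k (z.2, z.1).
  apply: (@measurable_tonelli _ _ _ _ _ leb Rpos Rpos mRpos mRpos k') => //.
  rewrite /k'/k/=; apply/measurable_EFinP/measurable_funM; last first.
    by apply: (measurable_on1 (f := fun x => (Num.sqrt x)^-1)); exact: measurable_sqrtV.
  apply: measurable_funTS; apply: (measurableT_comp (@measurable_expR R)).
  apply: measurableT_comp => //; apply: measurable_funM => //.
  - exact: measurable_funD.
  - by move=> *; exact: k0.
apply: (@le_trans _ _ (\int[mu]_(x in Rpos)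
    ((expR 1)%:E * \int[leb]_(s in Rpos) k (x, s)))%E).
  apply: ge0_le_integral; first exact: mRpos.
  - by move=> x _; rewrite lee_fin divr_ge0 ?expR_ge0 ?sqrtr_ge0.
  - exact: my.
  - by apply: measurable_funeM.
  - move=> x xR; rewrite kint// muleCA EFinM.
    apply: lee_wpmul2l; first by rewrite lee_fin expR_ge0.
    by apply: inv_sqrt_le; exact/RposP.
rewrite ge0_integralZl//; last 2 first.
- exact: mRpos.
- by move=> x _; exact: integral_ge0.
rewrite (tonelli_on mu leb mRpos mRpos mk); last by move=> *; exact: k0.
apply: (@le_trans _ _ ((expR 1)%:E * \int[leb]_(s in Rpos)
    ((4 * C)%:E * ((Num.sqrt s)^-1 / (s + y))%:E))%E).
  apply: lee_wpmul2l => //; apply: ge0_le_integral; first exact: mRpos.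
  - by move=> x _; exact: integral_ge0.
  - by apply: (measurable_tonelli mu mRpos mRpos mk) => *; exact: k0.
  - apply/measurable_EFinP/measurable_funM => //.
    apply: measurable_funM; first exact: measurable_sqrtV.
    apply: continuous_Rpos_measurable => x x0; apply: continuousV.
      by rewrite gt_eqF// addr_gt0.
    by apply: continuousD => //; exact: cvg_cst.
  move=> s /RposP s0; have ys : 0 < y + s by rewrite addr_gt0.
  rewrite /k/=; under eq_integral do rewrite mulrC EFinM.
  rewrite ge0_integralZl//; last 2 first.
  - exact: mRpos.
  - by apply/measurable_EFinP; exact: measurable_exp_mul.
  apply: le_trans (lee_wpmul2l _ (carleson_laplace ys)) _.
    by rewrite lee_fin invr_ge0 sqrtr_ge0.
  by rewrite -!EFinM lee_fin mulrCA (addrC s).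
rewrite ge0_integralZl//; last 4 first.
- exact: mRpos.
- apply/measurable_EFinP; apply: measurable_funM; first exact: measurable_sqrtV.
  apply: continuous_Rpos_measurable => x x0; apply: continuousV.
    by rewrite gt_eqF// addr_gt0.
  by apply: continuousD => //; exact: cvg_cst.
- move=> x /RposP x0; rewrite lee_fin divr_ge0 ?invr_ge0 ?sqrtr_ge0//.
  by rewrite addr_ge0 ?ltW.
- by rewrite lee_fin mulr_ge0.
rewrite muleA -EFinM; apply: le_trans (lee_wpmul2l _ (int_stieltjes y0)) _.
  by rewrite lee_fin !mulr_ge0 ?expR_ge0.
by rewrite -EFinM lee_fin mulrA (mulrC (expR 1)).
Qed.

End CarlesonBounds.

Lemma schur_lebesgue : schur leb pi.
Proof. by move=> y y0; exact: int_exp_sqrt. Qed.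

(** A Carleson measure carried by the half-line is finite on the intervals
    [[-n, n[]. *)
Lemma carleson_sigma_finite m : carried_by_Rpos m -> Carleson m ->
  exists m' : {sigma_finite_measure set T -> \bar R}, (m' : {measure set T -> \bar R}) = m.
Proof.
move=> m0 [C mC].
have sf : sigma_finite setT m.
  exists (fun n : nat => `](- n.+1%:R : R), n.+1%:R[%classic).
    apply/esym; rewrite -subTset => x _; exists (Num.truncn `|x|) => //=.
    by rewrite in_itv/= -ltr_norml truncnS_gt.
  move=> n; split; first exact: measurable_itv.
  apply: (@le_lt_trans _ _ (m (~` Rpos) + m `[0%R, n.+1%:R[%classic)%E).
    apply: le_trans (measureU2 _ _ _) => //; last first.
      by apply: measurableC; exact: mRpos.
    apply: le_measure; rewrite ?inE//.
      by apply: measurableU => //; apply: measurableC; exact: mRpos.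
    move=> x; rewrite /= in_itv/= => /andP[_ xn].
    have [x0|x0] := ltP 0 x; last by left => /RposP; rewrite ltNge x0.
    by right; rewrite /= in_itv/= xn ltW.
  rewrite m0 add0e; apply: le_lt_trans (mC _ _) (ltry _); exact: ltr0Sn.
pose H1 := isSFinite.Build _ _ _ _ (sfinite_measure_sigma_finite sf).
pose H2 := isSigmaFinite.Build _ _ _ _ sf.
pose m' := HB.pack_for (SigmaFiniteMeasure.type T R) (Measure.sort m) H1 H2.
by exists m'; exact: eq_measure.
Qed.

End Carleson.

(** * The Laplace transform *)

Section Laplace.
Context {R : realType}.
Local Notation T := (measurableTypeR R).
Local Notation leb := (@lebesgue_measure R).
Local Notation Rpos := (@Rpos R).
Implicit Types (m : {measure set T -> \bar R}) (c t x y : R) (f g : R -> R).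

Definition lap m f y : R := \int[m]_(x in Rpos) (expR (- (y * x)) * f x).

(** The condition holds for every square integrable [f] when [m] satisfies
    [schur], and unlike square integrability it is stable under multiplication by the variable, that is,
    under differentiation of the transform. *)
Definition lapable m f : Prop := measurable_fun (Rpos : set T) f /\
  forall y, 0 < y -> m.-integrable Rpos (EFin \o (fun x => expR (- (y * x)) * f x)).

Lemma ae_imp m (P Q : R -> Prop) : (forall x, P x -> Q x) ->
  {ae m, forall x, P x} -> {ae m, forall x, Q x}.
Proof. by move=> PQ; apply: (@filterS _ _ (ae_filter_ringOfSetsType m)). Qed.

Lemma ae_and m (P Q : R -> Prop) : {ae m, forall x, P x} -> {ae m, forall x, Q x} ->
  {ae m, forall x, P x /\ Q x}.
Proof. exact: (@filterI _ _ (ae_filter_ringOfSetsType m)). Qed.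

Lemma EFin_Rintegral m f : m.-integrable Rpos (EFin \o f) ->
  (\int[m]_(x in Rpos) (f x)%:E)%E = (\int[m]_(x in Rpos) f x)%:E.
Proof.
by move=> fi; rewrite /Rintegral fineK//; exact: (integrable_fin_num mRpos fi).
Qed.

Lemma schur_exp_sqint m c y : schur m c -> 0 < y ->
  sqint m Rpos (fun x => expR (- (y * x))).
Proof.
move=> mS y0; apply: sqintP; first exact: measurable_exp_mul.
have mk : measurable_fun (Rpos : set T) (fun x => (expR (- (y * x)) / Num.sqrt x)%:E).
  apply/measurable_EFinP/measurable_funM; first exact: measurable_exp_mul.
  exact: measurable_sqrtV.
have k0 x : Rpos x -> (0 <= (expR (- (y * x)) / Num.sqrt x)%:E)%E.
  by move=> _; rewrite lee_fin divr_ge0 ?expR_ge0 ?sqrtr_ge0.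
have yV : 0 <= 1 + y^-1 by rewrite addr_ge0 ?invr_ge0 ?ltW.
apply: (@le_lt_trans _ _ (\int[m]_(x in Rpos)
    ((1 + y^-1)%:E * (expR (- (y * x)) / Num.sqrt x)%:E))%E).
  apply: ge0_le_integral; first exact: mRpos.
  - by move=> x _; rewrite lee_fin sqr_ge0.
  - by apply/measurable_EFinP; apply: measurable_funX; exact: measurable_exp_mul.
  - exact: measurable_funeM.
  - move=> x /RposP x0; rewrite -EFinM lee_fin expr2 mulrCA ler_wpM2l ?expR_ge0//.
    by rewrite ler_pdivlMr ?sqrtr_gt0// mulrC sqrt_expRN_le.
rewrite ge0_integralZl ?lee_fin//; last exact: mRpos.
by apply: le_lt_trans (lee_wpmul2l _ (mS y y0)) _; rewrite ?lee_fin// -EFinM ltry.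
Qed.

Lemma lapable_sqint m c f : schur m c -> sqint m Rpos f -> lapable m f.
Proof.
move=> mS fP; split=> [|y y0]; first by case: fP.
by apply: (sqint_mul mRpos) => //; exact: schur_exp_sqint mS y0.
Qed.

Lemma lapableMx m f : lapable m f -> lapable m (fun x => - x * f x).
Proof.
move=> [mf fi]; split.
  by apply: measurable_funM => //; exact: measurable_funN.
move=> y y0; have y20 : 0 < y / 2 by rewrite divr_gt0.
apply: (@integrable_le _ _ _ _ _ mRpos _
  (fun x => 2 / y * `|expR (- (y / 2 * x)) * f x|)).
- apply: measurable_funM; first exact: measurable_exp_mul.
  by apply: measurable_funM => //; exact: measurable_funN.
- exact: (integrableZl mRpos (2 / y) (integrable_abse (fi _ y20))).
move=> x /RposP x0; rewrite !normrM normrN mulrCA mulrA !(ger0_norm (expR_ge0 _)).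
rewrite (gtr0_norm x0) [leRHS]mulrA ler_wpM2r//; exact: mul_expRN_le.
Qed.

Lemma is_derive_exp_mul (b a y : R) :
  is_derive y 1 (fun y => expR (- (y * a)) * b) (expR (- (y * a)) * (- a * b)).
Proof.
have d1 : is_derive y 1 (fun y => - (a * y)) (- a).
  by have := is_derive_opp (is_derive_scale a (is_derive_id y 1)); rewrite mulr1.
have := is_derive_scale b (is_derive1_comp (is_derive_expR _) d1).
have -> : (fun y0 => b * (expR \o (fun y1 => - (a * y1))) y0) =
    (fun y => expR (- (y * a)) * b).
  by apply/funext => z /=; rewrite mulrC (mulrC a).
by move=> h; apply: is_derive_eq h _; rewrite (mulrC a y); ring.
Qed.

(** Near [y] the integrands are dominated by the one at [y / 2]. *)
Lemma lap_is_derive m f y : lapable m f -> 0 < y ->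
  is_derive y 1 (lap m f) (lap m (fun x => - x * f x) y).
Proof.
move=> fL y0; have y20 : 0 < y / 2 by rewrite divr_gt0.
pose F z x := expR (- (z * x)) * f x.
have part z x : partial1of2 F z x = expR (- (z * x)) * (- x * f x).
  by rewrite partial1of2E; have [_ ->] := is_derive_exp_mul (f x) x z.
have Iy : `]y / 2, 2 * y[%classic y by rewrite /= in_itv/=; apply/andP; split; lra.
have Ipos z : `]y / 2, 2 * y[%classic z -> 0 < z.
  by rewrite /= in_itv/= => /andP[+ _]; exact: lt_trans.
have intF z : `]y / 2, 2 * y[%classic z -> m.-integrable Rpos (EFin \o F z).
  by move=> /Ipos z0; exact: fL.2.
have derF z x : `]y / 2, 2 * y[%classic z -> Rpos x -> derivable (F ^~ x) z 1.
  by move=> _ _; have [] := is_derive_exp_mul (f x) x z.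
pose G x : R := `|expR (- (y / 2 * x)) * (- x * f x)|.
have G0 x : 0 <= G x by exact: normr_ge0.
have iG : m.-integrable Rpos (EFin \o G).
  exact: (integrable_abse ((lapableMx fL).2 _ y20)).
have FG z x : `]y / 2, 2 * y[%classic z -> Rpos x -> `|partial1of2 F z x| <= G x.
  rewrite /= in_itv/= => /andP[z1 _] /RposP x0.
  rewrite part /G normrM [leRHS]normrM ler_wpM2r// !(ger0_norm (expR_ge0 _)).
  by rewrite ler_expR lerN2 ler_wpM2r ?ltW.
have d := derivable_under_integral mRpos Iy intF derF G0 iG FG.
have e := differentiation_under_integral mRpos Iy intF derF G0 iG FG.
split; first exact: d.
by rewrite -derive1E e; apply: eq_Rintegral => x _; rewrite part.
Qed.

Lemma lap_cont m f y : lapable m f -> 0 < y -> {for y, continuous (lap m f)}.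
Proof. by move=> fL y0; exact: is_derive_cont (lap_is_derive fL y0). Qed.

Lemma lap_measurable m f : lapable m f -> measurable_fun (Rpos : set T) (lap m f).
Proof. by move=> fL; apply: continuous_Rpos_measurable => y; exact: lap_cont. Qed.

Lemma lap_smooth m f n t : lapable m f -> 0 < t -> derivable (derive1n n (lap m f)) t 1.
Proof.
move=> fL t0.
suff [g gL gE] : exists2 g, lapable m g &
    forall t, 0 < t -> derive1n n (lap m f) t = lap m g t.
  apply: (@near_eq_derivable _ _ _ (lap m g)).
    near=> s; rewrite gE//; near: s; exact: lt_nbhsr.
  by have [] := lap_is_derive gL t0.
elim: n t t0 => [|n IH] t t0; first by exists f.
have [g gL gE] := IH t t0; exists (fun x => - x * g x); first exact: lapableMx.
move=> s s0; rewrite derive1nS derive1E.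
have [_ <-] := lap_is_derive gL s0; apply: near_eq_derive.
by near=> u; rewrite gE//; near: u; exact: lt_nbhsr.
Unshelve. all: by end_near. Qed.

(** Cauchy-Schwarz after splitting the kernel as
    [sqrt (e / sqrt x) * sqrt (e * sqrt x)]. *)
Lemma lap_sqr_le m c f y : schur m c -> sqint m Rpos f -> 0 < y ->
  ((lap m f y ^+ 2)%:E <= (c / Num.sqrt y)%:E *
    \int[m]_(x in Rpos) (expR (- (y * x)) * Num.sqrt x * f x ^+ 2)%:E)%E.
Proof.
move=> mS fP y0.
pose e x := expR (- (y * x)).
have me : measurable_fun (Rpos : set T) e by exact: measurable_exp_mul.
have sq (a : R -> R) : measurable_fun (Rpos : set T) a ->
    measurable_fun (Rpos : set T) (fun x => Num.sqrt (a x)).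
  move=> ma; apply: (@measurableT_comp _ _ _ _ _ _ (@Num.sqrt R)) => //.
  exact: measurable_Rsqrt.
pose a x := Num.sqrt (e x / Num.sqrt x); pose b x := Num.sqrt (e x * Num.sqrt x) * f x.
have a2 x : a x ^+ 2 = e x / Num.sqrt x.
  by rewrite sqr_sqrtr// divr_ge0 ?expR_ge0 ?sqrtr_ge0.
have b2 x : b x ^+ 2 = e x * Num.sqrt x * f x ^+ 2.
  by rewrite exprMn sqr_sqrtr// mulr_ge0 ?expR_ge0 ?sqrtr_ge0.
have aP : sqint m Rpos a.
  apply: sqintP.
    by apply: sq; apply: measurable_funM => //; exact: measurable_sqrtV.
  under eq_integral do rewrite a2.
  by apply: le_lt_trans (mS y y0) _; rewrite ltry.
have mb : measurable_fun (Rpos : set T) b.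
  apply: measurable_funM; last by case: fP.
  by apply: sq; apply: measurable_funM => //; exact: measurable_Rsqrt.
have bP : sqint m Rpos b.
  split=> //; apply: (@integrable_le _ _ _ _ _ mRpos _
      (fun x => (1 + y^-1) * f x ^+ 2)).
  - exact: measurable_funX.
  - exact: (integrableZl mRpos (1 + y^-1) fP.2).
  move=> x /RposP x0; rewrite b2 ger0_norm; last first.
    by rewrite mulr_ge0 ?sqr_ge0// mulr_ge0 ?expR_ge0 ?sqrtr_ge0.
  by rewrite ler_wpM2r ?sqr_ge0// mulrC sqrt_expRN_le.
pose u : L2space m mRpos := mkl2 aP; pose v : L2space m mRpos := mkl2 bP.
have -> : lap m f y = dot u v.
  rewrite dotL2; apply: eq_Rintegral => x /set_mem/RposP x0.
  rewrite /u /v/= mulrA -sqrtrM; last by rewrite divr_ge0 ?expR_ge0 ?sqrtr_ge0.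
  rewrite mulrACA mulVf ?mulr1; last by rewrite gt_eqF// sqrtr_gt0.
  by rewrite -expr2 sqrtr_sqr ger0_norm ?expR_ge0.
apply: (@le_trans _ _ (nsq u * nsq v)%:E); first by rewrite lee_fin cauchy_schwarz.
rewrite EFinM !nsqL2 /u /v/=.
under eq_integral do rewrite a2.
under [X in (_ * X <= _)%E]eq_integral do rewrite b2.
apply: lee_wpmul2r; last exact: mS.
by apply: integral_ge0 => x _; rewrite lee_fin mulr_ge0 ?sqr_ge0// mulr_ge0 ?expR_ge0 ?sqrtr_ge0.
Qed.

(** In the variable [expR (- x)] the values at the integers are moments on
    [[0, 1]]. *)
Lemma lap_inj m f : lapable m f -> (forall n, lap m f n.+1%:R = 0) ->
  {ae m, forall x, Rpos x -> f x = 0}.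
Proof.
move=> fL f0.
have := @powers_total _ m Rpos mRpos (fun x => expR (- x)) (fun u => - ln u)
  (fun x => expR (- (1 * x)) * f x).
move=> h; have {}h : {ae m, forall x, Rpos x -> expR (- (1 * x)) * f x = 0}.
  apply: h.
  - apply: (measurableT_comp (@measurable_expR R)); exact: measurable_funN.
  - by apply: measurableT_comp => //; exact: measurable_ln.
  - move=> x /RposP x0; rewrite expR_ge0/= -expR0 ler_expR; lra.
  - by move=> x _; rewrite expRK opprK.
  - exact: fL.2.
  move=> n; rewrite -[RHS](f0 n); apply: eq_Rintegral => x _.
  rewrite -expRM_natl mulrAC -expRD; congr (expR _ * _).
  by rewrite -natr1; ring.
apply: ae_imp h => x xP Rx; have /eqP := xP Rx.
by rewrite mulf_eq0 gt_eqF ?expR_gt0//= => /eqP.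
Qed.

Lemma ae0_continuous f : (forall x, 0 < x -> {for x, continuous f}) ->
  {ae leb, forall x, Rpos x -> f x = 0} -> forall x, 0 < x -> f x = 0.
Proof.
move=> cf [N [mN N0 fN]] x x0; apply: contrapT => /eqP fx.
have : \forall z \near x, f z != 0 /\ 0 < z.
  apply: filterI; last exact: lt_nbhsr.
  exact: cvgr_neq0 (cf x x0) fx.
case=> e /= e0 eP.
have : (`]x - e, x + e[%classic : set T) `<=` N.
  move=> z; rewrite /= in_itv/= => /andP[z1 z2]; apply: fN.
  have [fz z0] : f z != 0 /\ 0 < z.
    by apply: eP; rewrite /ball_/= ltr_norml; apply/andP; split; lra.
  by move=> /(_ (proj2 (RposP z) z0))/eqP; exact/negP.
move=> xN; pose I : set T := `]x - e, x + e[%classic; have : (leb I <= 0)%E.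
  by rewrite -[leRHS]N0; apply: le_measure; rewrite ?inE//; exact: measurable_itv.
rewrite /I lebesgue_measure_itv/= lte_fin ifT; last lra.
by rewrite -EFinB lee_fin; lra.
Qed.

Lemma sqint_norm m f : sqint m Rpos f -> sqint m Rpos (fun x => `|f x|).
Proof.
move=> fP; apply: (sqint_le mRpos _ fP) => [|x _]; last by rewrite normr_id.
by apply: measurableT_comp => //; case: fP.
Qed.

Section TwoMeasures.
Variables (m1 m2 : {sigma_finite_measure set T -> \bar R}) (c1 c2 : R).
Hypotheses (m1S : schur m1 c1) (m2S : schur m2 c2).

(** Schur's test: [lap_sqr_le] uses the weight on the side of [m1]; after the
    order of integration is exchanged, the hypothesis on [m2] is used for the
    remaining integral. *)
Lemma lap_bounded f : 0 <= c1 -> sqint m1 Rpos f ->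
  (\int[m2]_(y in Rpos) (lap m1 f y ^+ 2)%:E <=
   (c1 * c2)%:E * \int[m1]_(x in Rpos) (f x ^+ 2)%:E)%E.
Proof.
move=> c10 fP; have [mf _] := fP.
pose k (z : T * T) : \bar R :=
  (expR (- (z.1 * z.2)) / Num.sqrt z.2 * (Num.sqrt z.1 * f z.1 ^+ 2))%:E.
have k0 z : (0 <= k z)%E.
  by rewrite lee_fin mulr_ge0 ?divr_ge0 ?expR_ge0 ?sqrtr_ge0// mulr_ge0 ?sqrtr_ge0 ?sqr_ge0.
have mw : measurable_fun (Rpos : set T) (fun x => Num.sqrt x * f x ^+ 2).
  by apply: measurable_funM; [exact: measurable_Rsqrt|exact: measurable_funX].
have mk : measurable_fun (Rpos `*` Rpos : set (T * T)) k.
  apply/measurable_EFinP/measurable_funM; last exact: (measurable_on1 mw).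
  apply: measurable_funM; first exact: measurable_exp2.
  by apply: (measurable_on2 (f := fun x => (Num.sqrt x)^-1)); exact: measurable_sqrtV.
have w0 x : 0 <= Num.sqrt x * f x ^+ 2 by rewrite mulr_ge0 ?sqrtr_ge0 ?sqr_ge0.
have c10' : (0 <= c1%:E)%E by rewrite lee_fin.
have mI : measurable_fun (Rpos : set T) (fun y => \int[m1]_(x in Rpos) k (x, y))%E.
  by apply: (measurable_tonelli m1 mRpos mRpos mk) => *; exact: k0.
apply: (@le_trans _ _ (\int[m2]_(y in Rpos) (c1%:E * \int[m1]_(x in Rpos) k (x, y)))%E).
  apply: ge0_le_integral; first exact: mRpos.
  - by move=> x _; rewrite lee_fin sqr_ge0.
  - apply/measurable_EFinP/measurable_funX; apply: lap_measurable.
    exact: lapable_sqint m1S fP.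
  - exact: measurable_funeM.
  move=> y /RposP y0; apply: le_trans (lap_sqr_le m1S fP y0) _.
  rewrite EFinM -muleA; apply: lee_wpmul2l => //.
  rewrite -ge0_integralZl.
  - rewrite le_eqVlt; apply/orP; left; apply/eqP/eq_integral => x _.
    by rewrite /k/= -EFinM (mulrC x y); congr EFin; ring.
  - exact: mRpos.
  - apply/measurable_EFinP; apply: measurable_funM; last exact: measurable_funX.
    by apply: measurable_funM; [exact: measurable_exp_mul|exact: measurable_Rsqrt].
  - by move=> x _; rewrite lee_fin -mulrA mulr_ge0 ?expR_ge0.
  - by rewrite lee_fin invr_ge0 sqrtr_ge0.
rewrite ge0_integralZl//; [|exact: mRpos|by move=> *; exact: integral_ge0].
rewrite EFinM -muleA; apply: lee_wpmul2l => //.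
rewrite -(tonelli_on m1 m2 mRpos mRpos mk); last by move=> *; exact: k0.
have mI2 : measurable_fun (Rpos : set T) (fun x => \int[m2]_(y in Rpos) k (x, y))%E.
  pose k' z := k (z.2, z.1).
  apply: (@measurable_tonelli _ _ _ _ _ m2 Rpos Rpos mRpos mRpos k').
    rewrite /k'/k/=; apply/measurable_EFinP/measurable_funM; last exact: (measurable_on2 mw).
    apply: measurable_funM.
      under eq_fun do rewrite mulrC.
      exact: measurable_exp2.
    by apply: (measurable_on1 (f := fun x => (Num.sqrt x)^-1)); exact: measurable_sqrtV.
  by move=> *; exact: k0.
have c20 : 0 <= c2.
  have := m2S ltr01; rewrite sqrtr1 divr1 -lee_fin; apply: le_trans.
  by apply: integral_ge0 => x _; rewrite lee_fin divr_ge0 ?expR_ge0 ?sqrtr_ge0.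
have f20 x : Rpos x -> (0 <= (f x ^+ 2)%:E)%E by rewrite lee_fin sqr_ge0.
have mf2 : measurable_fun (Rpos : set T) (fun x => (f x ^+ 2)%:E).
  exact/measurable_EFinP/measurable_funX.
rewrite -ge0_integralZl//; last exact: mRpos.
apply: ge0_le_integral; first exact: mRpos.
- by move=> x _; exact: integral_ge0.
- exact: mI2.
- exact: measurable_funeM.
move=> x /RposP x0; rewrite /k/=.
under eq_integral do rewrite mulrC EFinM.
rewrite ge0_integralZl; last 4 first.
- exact: mRpos.
- apply/measurable_EFinP; apply: measurable_funM; first exact: measurable_exp_mul.
  exact: measurable_sqrtV.
- by move=> y _; rewrite lee_fin divr_ge0 ?expR_ge0 ?sqrtr_ge0.
- by rewrite lee_fin.
apply: le_trans (lee_wpmul2l _ (m2S x0)) _; first by rewrite lee_fin.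
rewrite -!EFinM lee_fin.
have sx0 : Num.sqrt x != 0 by rewrite gt_eqF// sqrtr_gt0.
move: (Num.sqrt x) (f x) sx0 => u v u0.
by rewrite (_ : u * v ^+ 2 * (c2 / u) = c2 * v ^+ 2)//; field.
Qed.

Lemma lap_sqint f : sqint m1 Rpos f -> sqint m2 Rpos (lap m1 f).
Proof.
move=> fP; apply: sqintP.
  by apply: lap_measurable; exact: lapable_sqint m1S fP.
have c10 : 0 <= c1.
  have := m1S ltr01; rewrite sqrtr1 divr1 -lee_fin; apply: le_trans.
  by apply: integral_ge0 => x _; rewrite lee_fin divr_ge0 ?expR_ge0 ?sqrtr_ge0.
apply: le_lt_trans (lap_bounded c10 fP) _.
by rewrite (EFin_Rintegral fP.2) -EFinM ltry.
Qed.

End TwoMeasures.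

Lemma lap_adjoint (m1 m2 : {sigma_finite_measure set T -> \bar R}) c1 c2 f g :
  schur m1 c1 -> schur m2 c2 -> sqint m1 Rpos f -> sqint m2 Rpos g ->
  \int[m2]_(y in Rpos) (lap m1 f y * g y) = \int[m1]_(x in Rpos) (f x * lap m2 g x).
Proof.
move=> m1S m2S fP gP; have [mf _] := fP; have [mg _] := gP.
have fL := lapable_sqint m1S fP; have gL := lapable_sqint m2S gP.
pose k (z : T * T) : R := expR (- (z.1 * z.2)) * (f z.1 * g z.2).
have mk : measurable_fun (Rpos `*` Rpos : set (T * T)) k.
  apply: measurable_funM; first exact: measurable_exp2.
  by apply: measurable_funM; [exact: measurable_on1|exact: measurable_on2].
have kx x : (fun y => (k (x, y))%:E) = (fun y => (f x)%:E * (expR (- (x * y)) * g y)%:E)%E.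
  by apply/funext => y; rewrite /k/= -EFinM mulrCA.
have ky y : (fun x => (k (x, y))%:E) = (fun x => (g y)%:E * (expR (- (y * x)) * f x)%:E)%E.
  by apply/funext => x; rewrite /k/= -EFinM (mulrC x y); congr EFin; ring.
have i2 x : Rpos x -> m2.-integrable Rpos (fun y => (k (x, y))%:E).
  by move=> /RposP x0; rewrite kx; exact: (integrableZl mRpos _ (gL.2 _ x0)).
have i1 y : Rpos y -> m1.-integrable Rpos (fun x => (k (x, y))%:E).
  by move=> /RposP y0; rewrite ky; exact: (integrableZl mRpos _ (fL.2 _ y0)).
have gnL := lapable_sqint m2S (sqint_norm gP).
have k12 : (\int[m1]_(x in Rpos) \int[m2]_(y in Rpos) `|k (x, y)|%:E < +oo)%E.
  rewrite (_ : (\int[m1]_(x in Rpos) _)%E =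
      \int[m1]_(x in Rpos) (`|f x| * lap m2 (fun y => `|g y|) x)%:E)%E.
    apply: (integrable_lty mRpos (sqint_mul mRpos (sqint_norm fP) _)).
    exact: lap_sqint m2S m1S _ (sqint_norm gP).
  apply: eq_integral => x /set_mem/RposP x0.
  rewrite EFinM -(EFin_Rintegral (gnL.2 _ x0)) -(integralZl mRpos (gnL.2 _ x0)).
  apply: eq_integral => y _; rewrite /k/= -EFinM !normrM (ger0_norm (expR_ge0 _)).
  by rewrite mulrCA.
have := fubini_on mRpos mRpos mk i2 i1 k12 => h.
transitivity (\int[m2]_(y in Rpos) \int[m1]_(x in Rpos) k (x, y)).
  apply: eq_Rintegral => y /set_mem/RposP y0; rewrite /lap mulrC.
  rewrite -RintegralZl; [|exact: mRpos|exact: fL.2].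
  apply: eq_Rintegral => x _.
  by rewrite /k/= (mulrC x y); ring.
rewrite -h; apply: eq_Rintegral => x /set_mem/RposP x0; rewrite /lap.
rewrite -RintegralZl; [|exact: mRpos|exact: gL.2].
apply: eq_Rintegral => y _.
by rewrite /k/= mulrCA.
Qed.

End Laplace.

(** * The spectral measure of a positive operator *)

Section OperatorPolynomials.
Context {R : realType} {Y : hspace R} (N : {linear Y -> Y}).
Hypothesis N_sym : forall x y, dot (N x) y = dot x (N y).
Hypothesis N_le : forall x, nsq (N x) <= dot (N x) x.
Implicit Types (p q : {poly R}) (x y : Y).

Definition opoly p x : Y := lin (fun n => iter n N x) p.

Lemma opolyX p x : opoly ('X * p) x = N (opoly p x).
Proof.
rewrite /opoly (@lin_widen _ _ _ _ (size p).+1); last first.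
  by rewrite (leq_trans (size_polyMleq _ _))// size_polyX.
rewrite big_ord_recl coefXM scale0r add0r /lin linear_sum/=.
by apply: eq_bigr => i _; rewrite linearZ/= coefXM/=.
Qed.

Lemma opoly1X p x : opoly ((1 - 'X) * p) x = opoly p x - N (opoly p x).
Proof. by rewrite mulrBl mul1r -opolyX /opoly linB. Qed.

Lemma opoly_comm p x : N (opoly p x) = opoly p (N x).
Proof.
rewrite /opoly /lin linear_sum/=; apply: eq_bigr => i _.
by rewrite linearZ/= -iterS iterSr.
Qed.

Lemma opolyB p x y : opoly p (x - y) = opoly p x - opoly p y.
Proof.
rewrite /opoly /lin -sumrB; apply: eq_bigr => i _; rewrite -scalerBr.
by congr (_ *: _); elim: (nat_of_ord i) => //= n ->; rewrite linearB.
Qed.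

Lemma dot_op_ge0 x : 0 <= dot (N x) x.
Proof. exact: le_trans (nsq_ge0 _) (N_le x). Qed.

Lemma dot_op_le x : dot (N x) x <= nsq x.
Proof.
have := N_le x; have := nsq_ge0 (x - N x); rewrite nsqB dotC; lra.
Qed.

Definition op_nonneg p := forall x, 0 <= dot (opoly p x) x.

Lemma op_nonnegXX p : op_nonneg p -> op_nonneg ('X * ('X * p)).
Proof. by move=> p0 x; rewrite !opolyX N_sym opoly_comm; exact: p0. Qed.

Lemma op_nonnegYY p : op_nonneg p -> op_nonneg ((1 - 'X) * ((1 - 'X) * p)).
Proof.
move=> p0 x; rewrite !opoly1X; set y := opoly p x.
suff -> : dot (y - N y - N (y - N y)) x = dot (opoly p (x - N x)) (x - N x) by [].
by rewrite opolyB -opoly_comm -/y linearB/= !dotE !N_sym; ring.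
Qed.

Lemma two_step (P : nat -> Prop) : P 0%N -> P 1%N ->
  (forall n, P n -> P n.+2) -> forall n, P n.
Proof. by move=> P0 P1 PS n; suff [] : P n /\ P n.+1 by []; elim: n => // n [? ?]; split; auto. Qed.

(** Multiplication by ['X ^+ 2] or [(1 - 'X) ^+ 2] amounts to a conjugation by a
    symmetric operator and preserves positivity, so that only [1], ['X], [1 - 'X]
    and ['X * (1 - 'X)] are to be checked.  This replaces square roots. *)
Lemma op_nonneg_bernstein k n : op_nonneg ('X^k * (1 - 'X) ^+ n).
Proof.
have op1 x : opoly 1 x = x by rewrite /opoly -(expr0 'X) linXn.
elim/two_step: n => [||n IH].
- rewrite expr0 mulr1; elim/two_step: k => [||k IH].
  + by move=> x; rewrite expr0 op1 nsq_ge0.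
  + by move=> x; rewrite expr1 -['X]mulr1 opolyX op1 dot_op_ge0.
  + by rewrite !exprS; exact: op_nonnegXX.
- rewrite expr1; elim/two_step: k => [||k IH].
  + move=> x; rewrite expr0 mulrC opoly1X op1 dotBl subr_ge0; exact: dot_op_le.
  + move=> x; rewrite expr1 opolyX -[1 - 'X]mulr1 opoly1X op1 linearB/= dotBl N_sym.
    by rewrite subr_ge0 (N_sym (N x)) (dotC x); exact: N_le.
  + by rewrite !exprS -!mulrA; exact: op_nonnegXX.
- rewrite !exprS; have -> : 'X^k * ((1 - 'X) * ((1 - 'X) * (1 - 'X) ^+ n)) =
    (1 - 'X) * ((1 - 'X) * ('X^k * (1 - 'X) ^+ n)) :> {poly R} by ring.
  exact: op_nonnegYY.
Qed.

End OperatorPolynomials.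

Section SpectralMeasure.
Context {R : realType} {Y : hspace R} (G : {linear Y -> Y}) (B : R) (v : Y).
Hypothesis G_sym : forall x y, dot (G x) y = dot x (G y).
Hypothesis B_gt0 : 0 < B.
Hypothesis G_le : forall x, nsq (G x) <= B * dot (G x) x.

Let N : {linear Y -> Y} := B^-1 \*: G.

Lemma contr_sym x y : dot (N x) y = dot x (N y).
Proof. by rewrite /= !dotE G_sym. Qed.

Lemma contr_le x : nsq (N x) <= dot (N x) x.
Proof.
rewrite /= nsqZ dotZl expr2 -mulrA ler_pM2l ?invr_gt0//.
by rewrite mulrC ler_pdivrMr// mulrC.
Qed.

Lemma iter_contr n x : iter n N x = B ^- n *: iter n G x.
Proof.
elim: n => [|n IH]; first by rewrite expr0 invr1 scale1r.
by rewrite !iterS IH /= linearZ/= scalerA exprS invfM.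
Qed.

Lemma spectral_measure :
  exists s : {finite_measure set (measurableTypeR R) -> \bar R},
  s (~` `[0%R, B]%classic) = 0%E /\
  forall n, (\int[s]_(x in `[0%R, B]) (x ^+ n)%:E = (dot (iter n G v) v)%:E)%E.
Proof.
pose mom n := dot (iter n N v) v.
have mom_pos k n : 0 <= Lam mom ('X^k * (1 - 'X) ^+ n).
  have := op_nonneg_bernstein contr_sym contr_le k n v.
  by rewrite /opoly dotC dot_lin => /le_trans; apply; rewrite /Lam /lin;
    apply: ler_sum => i _; rewrite dotC.
have [s [s0 sm]] := hausdorff mom_pos B_gt0.
exists s; split => // n; rewrite sm /mom iter_contr dotZl mulrA mulfV ?mul1r//.
by rewrite expf_neq0// gt_eqF.
Qed.

End SpectralMeasure.

(** * Multiplication and Stieltjes operators on the spectral side *)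

Section SpectralSide.
Context {R : realType} (s : {finite_measure set (measurableTypeR R) -> \bar R}).
Local Notation T := (measurableTypeR R).
Variables (D : set T) (mD : measurable D) (B : R).
Hypotheses (B_gt0 : 0 < B) (D_le : forall x, D x -> 0 <= x <= B).
Local Notation Z := (L2space s mD).
Implicit Types (w : Z) (x E : R).

Lemma s_lty : (s D < +oo)%E. Proof. by rewrite ltey_eq fin_num_measure. Qed.

Lemma bounded_sqint (f : R -> R) (c : R) : measurable_fun D f ->
  (forall x, D x -> `|f x| <= c) -> sqint s D f.
Proof.
move=> mf fc; apply: (sqint_le mD mf (g := cst c)).
  apply: sqintP => //; rewrite (eq_integral (cst (c ^+ 2)%:E))// integral_cst//.
  by rewrite lte_mul_pinfty// ?lee_fin ?sqr_ge0//; exact: s_lty.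
by move=> x Dx; rewrite (le_trans (fc x Dx))// ler_norm.
Qed.

Lemma pow_sqint n : sqint s D (fun x => x ^+ n).
Proof.
apply: (@bounded_sqint _ (B ^+ n)); first exact: measurable_funX.
by move=> x /D_le /andP[x0 xB]; rewrite normrX ger0_norm// lerXn2r ?nnegrE// (le_trans x0).
Qed.

Definition zpow n : Z := mkl2 (pow_sqint n).

Lemma l2_integrable w : s.-integrable D (EFin \o w).
Proof.
have := l2_mul mD w (zpow 0); congr (_.-integrable _ _).
by apply/funext => x /=; rewrite expr0 mulr1.
Qed.

Lemma dot_zpow w n : dot w (zpow n) = \int[s]_(x in D) (w x * x ^+ n).
Proof. by rewrite dotL2. Qed.

Lemma zpow_total w : (forall n, dot w (zpow n) = 0) -> nsq w = 0.
Proof.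
move=> w0; apply/nsqL20P.
apply: (powers_total mD (r := fun x => x / B) (s := fun x => x * B)).
- exact: measurable_funM.
- exact: measurable_funM.
- move=> x /D_le /andP[x0 xB].
  apply/andP; split; first by rewrite divr_ge0// ltW.
  by rewrite ler_pdivrMr// mul1r.
- by move=> x _; rewrite divfK// gt_eqF.
- exact: l2_integrable.
- move=> n; under eq_Rintegral do rewrite expr_div_n mulrA mulrC.
  by rewrite RintegralZl//; [rewrite -dot_zpow w0 mulr0|exact: (l2_mul mD w (zpow n))].
Qed.

Lemma mulX_sqint w : sqint s D (fun x => x * w x).
Proof.
have -> : (fun x => x * w x) = (fun x => B * ((x / B) * w x)).
  by apply/funext => x; rewrite mulrA mulrCA mulfV ?mulr1// gt_eqF.
have : sqint s D (fun x => (x / B) * w x).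
  apply: (sqint_le mD _ (l2P w)) => [|x /D_le /andP[x0 xB]].
    by apply: measurable_funM; [exact: measurable_funM|exact: l2_meas].
  rewrite normrM ler_piMl// ger0_norm ?divr_ge0 ?(ltW B_gt0)//.
  by rewrite ler_pdivrMr// mul1r.
by move=> h; exact: (l2P (B *: mkl2 h)).
Qed.

Definition mulX w : Z := mkl2 (mulX_sqint w).

Lemma mulX_linear : linear mulX.
Proof. move=> a w w'; apply/val_inj/funext => x.
by change (x * (a * w x + w' x) = a * (x * w x) + x * w' x); ring. Qed.

HB.instance Definition _ := GRing.isLinear.Build R Z Z _ mulX mulX_linear.

Lemma dot_mulX_zpow w n : dot (mulX w) (zpow n) = dot w (zpow n.+1).
Proof. by rewrite !dot_zpow; apply: eq_Rintegral => x _ /=; rewrite exprS; ring. Qed.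

Lemma dot_mulX_ge0 w : 0 <= dot (mulX w) w.
Proof.
rewrite dotL2; apply: Rintegral_ge0 => x /D_le /andP[x0 _] /=.
by rewrite -mulrA mulr_ge0// -expr2 sqr_ge0.
Qed.

Lemma mulX_null w : nsq w = 0 -> nsq (mulX w) = 0.
Proof.
move=> /nsqL20P w0; apply/nsqL20P; apply: ae_imp w0 => x h Dx /=.
by rewrite h// mulr0.
Qed.

Lemma stj_integrable w E : 0 < E ->
  s.-integrable D (EFin \o (fun x => x / (x + E) * w x)).
Proof.
move=> E0; apply: (integrable_le mD _ (integrable_abse (l2_integrable w))).
  apply: measurable_funM; last exact: l2_meas.
  apply: measurable_funM => //; apply: (measurable_comp (F := Rpos)).
  - exact: mRpos.
  - by move=> _ [x /D_le/andP[x0 _] <-]; apply/RposP; rewrite ltr_wpDl.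
  - apply: continuous_Rpos_measurable => x x0; apply: continuousV => //.
    by rewrite gt_eqF.
  - exact: measurable_funD.
move=> x /D_le/andP[x0 _] /=; rewrite normrM ler_piMl//.
have xE : 0 < x + E by rewrite ltr_wpDl.
by rewrite ger0_norm ?divr_ge0// ?(ltW xE)// ler_pdivrMr// mul1r lerDl ltW.
Qed.

Definition stj w E : R :=
  if 0 < E then \int[s]_(x in D) (x / (x + E) * w x) else 0.

Definition absint w : R := \int[s]_(x in D) `|w x|.

Lemma stj_le w E : `|stj w E| <= absint w.
Proof.
rewrite /stj; case: ifPn => E0; last first.
  by rewrite normr0; apply: Rintegral_ge0.
apply: le_trans (le_normr_Rintegral mD (stj_integrable w E0)) _.
apply: le_Rintegral => //.
- exact: (integrable_abse (stj_integrable w E0)).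
- exact: (integrable_abse (l2_integrable w)).
move=> x /D_le/andP[x0 _] /=; rewrite normrM ler_piMl//.
have xE : 0 < x + E by rewrite ltr_wpDl.
by rewrite ger0_norm ?divr_ge0// ?(ltW xE)// ler_pdivrMr// mul1r lerDl ltW.
Qed.

Lemma absint_le w : absint w ^+ 2 <= nsq w * nsq (zpow 0).
Proof.
have wP : sqint s D (fun x => `|w x|).
  apply: (sqint_le mD _ (l2P w)) => [|x _]; last by rewrite normr_id.
  by apply: measurableT_comp => //; exact: l2_meas.
pose w' : Z := mkl2 wP.
have -> : nsq w = nsq w'.
  by rewrite /nsq !dotL2; apply: eq_Rintegral => x _ /=; rewrite -!expr2 real_normK ?num_real.
have -> : absint w = dot w' (zpow 0).
  by rewrite dotL2; apply: eq_Rintegral => x _ /=; rewrite expr0 mulr1.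
exact: cauchy_schwarz.
Qed.

Lemma stj_cont w E : 0 < E -> {for E, continuous (stj w)}.
Proof.
move=> E0; have a0 : 0 <= absint w by apply: Rintegral_ge0.
apply/cvgrPdist_le => e e0.
near=> F.
have F0 : 0 < F by near: F; exact: lt_nbhsr.
have FE : `|E - F| <= e * E / (absint w + 1).
  near: F; apply: cvgr_dist_le => //.
  by rewrite divr_gt0 ?mulr_gt0// ltr_wpDl.
apply: (@le_trans _ _ (`|E - F| / E * absint w)); last first.
  have -> : e = e * E / (absint w + 1) / E * (absint w + 1).
    by field; rewrite !gt_eqF// ltr_wpDl.
  apply: ler_pM => //; first by rewrite divr_ge0 ?(ltW E0).
  - by rewrite ler_pM2r ?invr_gt0.
  - by rewrite lerDl.
rewrite /stj E0 F0 -RintegralB//; [|exact: stj_integrable..].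
have iB := integrableB mD (stj_integrable w E0) (stj_integrable w F0).
apply: le_trans (le_normr_Rintegral mD iB) _.
rewrite /absint -RintegralZl//; last exact: (integrable_abse (l2_integrable w)).
apply: le_Rintegral => //.
- exact: (integrable_abse iB).
- exact: (integrableZl mD (`|E - F| / E) (integrable_abse (l2_integrable w))).
move=> x /D_le/andP[x0 _]; rewrite -mulrBl normrM ler_wpM2r//.
have xE : 0 < x + E by rewrite ltr_wpDl.
have xF : 0 < x + F by rewrite ltr_wpDl.
have -> : x / (x + E) - x / (x + F) = (F - E) * (x / (x + F)) / (x + E).
  by field; rewrite !gt_eqF.
rewrite normrM normfV (gtr0_norm xE) normrM distrC.
rewrite ler_pM ?invr_ge0 ?(ltW xE)//; last by rewrite lef_pV2 ?posrE// lerDr.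
rewrite ler_piMr// ger0_norm ?divr_ge0 ?(ltW xF)// ler_pdivrMr// mul1r.
by rewrite lerDl ltW.
Unshelve. all: by end_near. Qed.

Section PositiveSupport.
Hypothesis D_gt0 : forall x, D x -> 0 < x.

Lemma stj_measurable w : measurable_fun D (stj w).
Proof.
apply: (measurable_funS mRpos) => [x /D_gt0 /RposP //|].
by apply: continuous_Rpos_measurable => E; exact: stj_cont.
Qed.

Lemma stj_sqint w : sqint s D (stj w).
Proof. by apply: (@bounded_sqint _ (absint w)) => [|x _]; [exact: stj_measurable|exact: stj_le]. Qed.

Definition stjop w : Z := mkl2 (stj_sqint w).

Lemma stjDZ a w w' E : stj (a *: w + w') E = a * stj w E + stj w' E.
Proof.
rewrite /stj; case: ifPn => E0; last by rewrite mulr0 addr0.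
rewrite -RintegralZl//; last exact: stj_integrable.
rewrite -RintegralD//; [|exact: (integrableZl mD a (stj_integrable w E0))
  |exact: stj_integrable].
by apply: eq_Rintegral => x _; rewrite l2DZ; ring.
Qed.

Lemma stjop_linear : linear stjop.
Proof. by move=> a w w'; apply/val_inj/funext => x; exact: stjDZ. Qed.

HB.instance Definition _ := GRing.isLinear.Build R Z Z _ stjop stjop_linear.

Lemma nsq_stjop_le w : nsq (stjop w) <= nsq (zpow 0) ^+ 2 * nsq w.
Proof.
rewrite expr2 -mulrA [_ * nsq w]mulrC.
apply: le_trans (ler_wpM2l (nsq_ge0 _) (absint_le w)).
have a0 : 0 <= absint w by apply: Rintegral_ge0.
rewrite /nsq !dotL2 mulrC -RintegralZl//; last exact: (l2_mul mD (zpow 0) (zpow 0)).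
apply: le_Rintegral => //.
- exact: (l2_mul mD (stjop w) (stjop w)).
- exact: (integrableZl mD _ (l2_mul mD (zpow 0) (zpow 0))).
move=> x _ /=; rewrite expr0 !mulr1 -expr2 -[leLHS]real_normK ?num_real//.
by rewrite lerXn2r ?nnegrE// stj_le.
Qed.

(** Up to null functions, the Stieltjes operator and the multiplication by the
    variable satisfy the same commutation relation as [A] and [G] do, because
    [E * (x / (x + E)) + (x / (x + E)) * x = x]. *)
Lemma mulX_stjop w : nsq (mulX (stjop w) + stjop (mulX w) - dot w (zpow 1) *: zpow 0) = 0.
Proof.
apply/nsqL20P; apply: aeW => E /D_gt0 E0.
change (E * stj w E + stj (mulX w) E - dot w (zpow 1) * E ^+ 0 = 0).
rewrite expr0 mulr1 dot_zpow /stj E0 -RintegralZl//; last exact: stj_integrable.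
rewrite -RintegralD//; [|exact: (integrableZl mD E (stj_integrable w E0))
  |exact: stj_integrable].
apply/eqP; rewrite subr_eq0; apply/eqP; apply: eq_Rintegral => x /set_mem/D_le/andP[x0 _].
change (E * (x / (x + E) * w x) + x / (x + E) * (x * w x) = w x * x ^+ 1).
by rewrite expr1; field; rewrite gt_eqF// ltr_wpDl.
Qed.

Lemma nsq_mulX0 w : nsq (mulX w) = 0 -> nsq w = 0.
Proof.
move=> /nsqL20P w0; apply/nsqL20P; apply: ae_imp w0 => x h Dx.
have /eqP : x * w x = 0 by exact: h.
by rewrite mulf_eq0 gt_eqF ?D_gt0//= => /eqP.
Qed.

End PositiveSupport.

End SpectralSide.

(** * Spectral representation of a solution of a Lyapunov equation *)

Section Representation.
Context {R : realType} {Y : hspace R} (G A : {linear Y -> Y}) (B c : R) (v : Y).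
Local Notation T := (measurableTypeR R).
Hypothesis G_sym : forall x y, dot (G x) y = dot x (G y).
Hypothesis B_gt0 : 0 < B.
Hypothesis G_le : forall x, nsq (G x) <= B * dot (G x) x.
Hypothesis G_inj : forall x, nsq (G x) = 0 -> nsq x = 0.
Hypothesis c_ge0 : 0 <= c.
Hypothesis A_le : forall x, nsq (A x) <= c * nsq x.
Hypothesis A_inj : forall x, nsq (A x) = 0 -> nsq x = 0.
Hypothesis lyapunov : forall x, A (G x) + G (A x) = dot x (G v) *: v.

Let y n := iter n G v.

Lemma iter_sym i x z : dot (iter i G x) z = dot x (iter i G z).
Proof. by elim: i x z => //= i IH x z; rewrite G_sym IH -iterSr. Qed.

(** On the orthogonal complement of the vectors [G ^+ n v] the operators [A] and
    [G] anticommute, so that [anticommute0] gives [G (A x) = 0]. *)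
Lemma cyclic x : (forall n, dot x (y n) = 0) -> nsq x = 0.
Proof.
move=> xv; apply: A_inj; apply: G_inj.
pose N : {linear Y -> Y} := B^-1 \*: G.
suff : nsq (N (A x)) = 0.
  rewrite /= nsqZ => /eqP; rewrite mulf_eq0 sqrf_eq0 invr_eq0 gt_eqF//=.
  by move/eqP.
apply: (@anticommute0 _ Y Y (fun x => forall n, dot x (y n) = 0) N N A c) => //.
- exact: contr_le.
- by move=> z; apply: le_trans (contr_le B_gt0 G_le z); exact: nsq_ge0.
- by move=> z z0; apply/eqP; rewrite eq_le nsq_ge0 andbT;
    apply: le_trans (contr_le B_gt0 G_le z) _; rewrite dotC nsq0_dot.
- move=> z zv n; rewrite dotBl zv /= dotZl G_sym.
  by rewrite -[G _]/(y n.+1) zv mulr0 subrr.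
- move=> z zv; rewrite linearB/= linearZ/= opprD addrACA subrr add0r -opprD -scalerDr.
  by rewrite lyapunov (zv 1%N) scale0r scaler0 oppr0 nsq0.
Qed.

Section OnSupport.
Variables (s : {finite_measure set T -> \bar R}) (D : set T) (mD : measurable D).
Hypotheses (D_le : forall x, D x -> 0 <= x <= B)
  (s_mom : forall n, (\int[s]_(x in D) (x ^+ n)%:E = (dot (y n) v)%:E)%E).

Let z n := zpow s mD D_le n.

Lemma spectral_gram i j : dot (y i) (y j) = dot (z i) (z j).
Proof.
rewrite dotL2 iter_sym -iterD dotC; apply: EFin_inj; rewrite -s_mom.
rewrite /Rintegral fineK; last first.
  exact: (integrable_fin_num mD (l2_mul mD (z i) (z j))).
by apply: eq_integral => x _; rewrite exprD.
Qed.

Lemma corr_mulX u w : corr y z u w -> corr y z (G u) (mulX B_gt0 D_le w).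
Proof. by move=> uw n; rewrite dot_mulX_zpow uw G_sym. Qed.

End OnSupport.

(** An atom at [0] would correspond to a vector that [G] annihilates. *)
Lemma no_atom0 (s : {finite_measure set T -> \bar R}) :
  (forall n, (\int[s]_(x in `[0%R, B]) (x ^+ n)%:E = (dot (y n) v)%:E)%E) ->
  s [set 0] = 0%E.
Proof.
move=> s_mom; pose D : set T := `[0%R, B]%classic.
have mD : measurable D by exact: measurable_itv.
have D_le (x : R) : D x -> 0 <= x <= B by rewrite /D/= in_itv.
pose z n := zpow s mD D_le n.
have m0 : measurable ([set 0] : set T) by exact: measurable_set1.
have wP : sqint s D (\1_([set 0] : set T)).
  apply: (@bounded_sqint _ _ _ mD _ 1); first exact: measurable_indic.
  by move=> x _; rewrite indicE; case: (_ \in _); rewrite ?normr1 ?normr0.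
pose w : L2space s mD := mkl2 wP.
have [u uw] := corr_surj (spectral_gram mD D_le s_mom)
  (@zpow_total _ s D mD B B_gt0 D_le) w.
have wz n : dot w (z n.+1) = 0.
  rewrite dot_zpow (@eq_Rintegral _ _ _ _ _ (cst 0)); first by rewrite /Rintegral integral0.
  move=> x _ /=.
  rewrite indicE; have [->|x0] := eqVneq x 0; first by rewrite expr0n mulr0.
  by rewrite memNset ?mul0r// => /eqP; exact/negP.
have u0 : nsq u = 0.
  apply: G_inj; apply: cyclic => n; rewrite G_sym -[G _]/(y n.+1) -uw; exact: wz.
have : (dot w (z 0%N))%:E = s [set 0].
  rewrite dotL2 /Rintegral fineK; last exact: (integrable_fin_num mD (l2_mul mD w (z 0%N))).
  transitivity (\int[s]_(x in D) (\1_([set 0] : set T) x)%:E)%E.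
    by apply: eq_integral => x _ /=; rewrite expr0 mulr1.
  rewrite integral_indic//; congr (s _); apply/seteqP; split => x //=.
    by case.
  by move=> ->; split => //; rewrite /D/= in_itv/= lexx ltW.
by rewrite uw nsq0_dot// => <-.
Qed.

Definition Ioc (b : R) : set T := `]0%R, b]%classic.

Lemma mIoc b : measurable (Ioc b). Proof. exact: measurable_itv. Qed.

Lemma IocP b x : Ioc b x <-> 0 < x <= b. Proof. by rewrite /Ioc/= in_itv. Qed.

Lemma Ioc_le b x : Ioc b x -> 0 <= x <= b.
Proof. by move=> /IocP/andP[x0 xb]; rewrite ltW. Qed.

Lemma Ioc_gt0 b x : Ioc b x -> 0 < x. Proof. by move=> /IocP/andP[]. Qed.

(** The moments of [s] are the numbers [dot (iter n G v) v], so that the vectors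
    [iter n G v] and the powers of the variable have the same Gram matrix; both
    families are total.  [A] and the Stieltjes operator solve the same Lyapunov
    equation: their difference, after transport by [Phi], anticommutes with the
    multiplication by the variable, hence vanishes by [anticommute0]. *)
Lemma representation : exists (s : {finite_measure set T -> \bar R})
  (Phi : Y -> L2space s (mIoc B)),
  [/\ s (~` Ioc B) = 0%E,
      forall x x', dot (Phi x) (Phi x') = dot x x',
      forall w, exists x, nsq (Phi x - w) = 0,
      nsq (Phi v - zpow s (mIoc B) (@Ioc_le B) 0) = 0
    & (forall x, nsq (Phi (G x) - mulX B_gt0 (@Ioc_le B) (Phi x)) = 0) /\
      (forall x, nsq (Phi (A x) -
         stjop (@Ioc_le B) (@Ioc_gt0 B) (Phi x)) = 0)].
Proof.
have [s [s_out s_mom0]] := spectral_measure v G_sym B_gt0 G_le.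
have s00 : s [set 0] = 0%E by exact: no_atom0.
have mC : measurable (`[0%R, B]%classic : set T) by exact: measurable_itv.
have m0 : measurable ([set 0] : set T) by exact: measurable_set1.
have IocE : (`[0%R, B]%classic : set T) `\` [set 0] = Ioc B.
  apply/seteqP; split => x.
    move=> [/=]; rewrite in_itv/= => /andP[x0 xB] /eqP xn0; apply/IocP.
    by rewrite lt_def xn0 x0.
  move=> /IocP/andP[x0 xB]; split; first by rewrite /= in_itv/= ltW.
  by move=> /= /eqP; rewrite gt_eqF.
have s_mom n : (\int[s]_(x in Ioc B) (x ^+ n)%:E = (dot (y n) v)%:E)%E.
  rewrite -s_mom0 -IocE -ge0_negligible_integral//.
    by apply/measurable_EFinP; exact: measurable_funX.
  by move=> x; rewrite /= in_itv/= lee_fin => /andP[x0 _]; rewrite exprn_ge0.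
have s_out' : s (~` Ioc B) = 0%E.
  apply/eqP; rewrite -measure_le0.
  apply: (@le_trans _ _ (s (~` `[0%R, B]%classic) + s [set 0%R])%E).
    apply: le_trans (measureU2 _ _ _) => //; last exact: measurableC.
    apply: le_measure; rewrite ?inE; [|apply: measurableU => //; exact: measurableC|].
      by apply: measurableC; exact: mIoc.
    rewrite -IocE setDE setCI setCK => x [|]; [by left|by right].
  by rewrite s_out s00 adde0.
set mD := mIoc B; set Dle := @Ioc_le B; set Dgt0 := @Ioc_gt0 B.
pose z n := zpow s mD Dle n.
have gr := spectral_gram mD Dle s_mom.
have zt := @zpow_total _ s _ mD B B_gt0 Dle.
have /choice[Phi PhiP] : forall x, exists w, corr y z x w.
  by move=> x; exact: (corr_exists gr cyclic).
have Phi_uniq x w : corr y z x w -> nsq (Phi x - w) = 0.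
  by move=> xw; exact: (corr_uniq zt (PhiP x) xw).
have PhiG x : nsq (Phi (G x) - mulX B_gt0 Dle (Phi x)) = 0.
  by apply: Phi_uniq; exact: corr_mulX.
exists s, Phi; split => //.
- by move=> x x'; exact: (corr_dot gr cyclic zt).
- move=> w; have [x xw] := corr_surj gr zt w.
  by exists x; exact: Phi_uniq.
- by apply: Phi_uniq; exact: (corr_y gr 0).
split=> // x.
pose S : {linear L2space s mD -> L2space s mD} := stjop Dle Dgt0.
pose M : {linear L2space s mD -> L2space s mD} := mulX B_gt0 Dle.
apply: (nsq_mulX0 (mD := mD) (B_gt0 := B_gt0) (D_le := Dle) Dgt0).
pose N1 : {linear Y -> Y} := B^-1 \*: G.
pose N2 : {linear L2space s mD -> L2space s mD} := B^-1 \*: M.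
pose Df u := Phi (A u) - S (Phi u).
have N2E w : N2 w = B^-1 *: M w by [].
suff : nsq (N2 (Df x)) = 0.
  rewrite N2E nsqZ => /eqP; rewrite mulf_eq0 sqrf_eq0 invr_eq0 gt_eqF//=.
  by move/eqP.
pose K := nsq (z 0%N) ^+ 2.
have K0 : 0 <= K by exact: sqr_ge0.
have Phi_nsq u : nsq (Phi u) = nsq u by exact: (corr_nsq gr cyclic zt).
apply: (@anticommute0 _ Y (L2space s mD) (fun=> True) N1 N2 Df (2 * c + 2 * K)) => //.
- exact: contr_le.
- by move=> w; rewrite N2E dotZl mulr_ge0 ?invr_ge0 ?(ltW B_gt0)// dot_mulX_ge0.
- by move=> w w0; rewrite N2E nsqZ0//; exact: mulX_null.
- by rewrite addr_ge0// mulr_ge0.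
- move=> u _; have := nsqD_le (Phi (A u)) (- S (Phi u)); rewrite nsqN Phi_nsq => h.
  apply: le_trans h _.
  have -> : (2 * c + 2 * K) * nsq u = 2 * (c * nsq u) + 2 * (K * nsq u) by ring.
  rewrite lerD// ler_pM2l// -(Phi_nsq u); exact: nsq_stjop_le.
(* [Df] takes [1 - N1] to [1 + N2] up to null vectors, the multiples of [v] and
   of its image [z 0] in the two Lyapunov equations cancelling out. *)
move=> u _; pose k := dot u (G v) / B.
have AN : A (u - N1 u) = A u + N1 (A u) - k *: v.
  have AGu : A (G u) = dot u (G v) *: v - G (A u) by rewrite -lyapunov addrK.
  rewrite linearB/= linearZ/= AGu scalerBr scalerA (mulrC B^-1) -/k opprB.
  by rewrite addrA.
have c1 : corr y z (A (u - N1 u)) (Phi (A u) + N2 (Phi (A u)) - k *: z 0%N).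
  move=> n; rewrite AN !dotE PhiP; congr (_ + _ * _ - _ * _).
    by rewrite (corr_mulX (PhiP (A u))).
  exact: esym (gr 0%N n).
have c2 : corr y z (u - N1 u) (Phi u - N2 (Phi u)).
  by move=> n; rewrite !dotE PhiP (corr_mulX (PhiP u)).
have kE : k = B^-1 * dot (Phi u) (z 1%N) by rewrite /k mulrC PhiP.
have h3 := nsqZ0 B^-1 (mulX_stjop B_gt0 Dle Dgt0 (Phi u)).
have h2 : nsq (S (Phi (u - N1 u) - (Phi u - N2 (Phi u)))) = 0.
  apply/eqP; rewrite eq_le nsq_ge0 andbT.
  apply: le_trans (nsq_stjop_le Dle Dgt0 _) _.
  by rewrite (Phi_uniq _ _ c2) mulr0.
have h1 := Phi_uniq _ _ c1.
have -> : Df (u - N1 u) - (Df u + N2 (Df u)) =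
   (Phi (A (u - N1 u)) - (Phi (A u) + N2 (Phi (A u)) - k *: z 0%N)) -
   S (Phi (u - N1 u) - (Phi u - N2 (Phi u))) +
   B^-1 *: (M (S (Phi u)) + S (M (Phi u)) - dot (Phi u) (z 1%N) *: z 0%N).
  have SB a b : S (a - b) = S a - S b by exact: linearB.
  have MB a b : M (a - b) = M a - M b by exact: linearB.
  have SZ a : S (B^-1 *: a) = B^-1 *: S a by exact: linearZ.
  rewrite /Df !N2E !SB SZ MB kE; move: (M (Phi (A u))) (S (Phi (u - N1 u))) (S (M (Phi u))).
  move: (Phi (A (u - N1 u))) (Phi (A u)) (S (Phi u)) => a1 a2 a3 a4 a5 a6.
  move: (M a3) (B^-1) (dot (Phi u) (z 1%N)) (z 0%N) => a7 b d a8.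
  apply/val_inj/funext => e.
  change (a1 e - a5 e - (a2 e - a3 e + b * (a4 e - a7 e)) =
    a1 e - (a2 e + b * a4 e - b * d * a8 e) - (a5 e - (a3 e - b * a6 e)) +
    b * (a7 e + a6 e - d * a8 e)).
  by ring.
by apply: nsqD0 => //; apply: nsqD0 => //; rewrite nsqN.
Qed.

End Representation.

(** * The Laplace transform as an operator *)

Section LaplaceOperator.
Context {R : realType}.
Local Notation T := (measurableTypeR R).
Local Notation leb := (@lebesgue_measure R).
Local Notation Rpos := (@Rpos R).
Local Notation L2p m := (L2space m (@mRpos R)).

Lemma schur_ge0 (m : {measure set T -> \bar R}) c : schur m c -> 0 <= c.
Proof.
move=> mS; have := mS 1 ltr01; rewrite sqrtr1 divr1 -lee_fin; apply: le_trans.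
by apply: integral_ge0 => x _; rewrite lee_fin divr_ge0 ?expR_ge0 ?sqrtr_ge0.
Qed.

Section Operator.
Variables (m1 m2 : {sigma_finite_measure set T -> \bar R}) (c1 c2 : R).
Hypotheses (m1S : schur m1 c1) (m2S : schur m2 c2).
Implicit Types f : L2p m1.

Lemma lapop_sqint f : sqint m2 Rpos (fun y => if 0 < y then lap m1 f y else 0).
Proof.
have fS := lap_sqint m1S m2S (l2P f).
apply: (sqint_le mRpos _ fS) => [|y /RposP ->//].
apply: (eq_measurable_fun (lap m1 f)); last by case: fS.
by move=> y /set_mem/RposP ->.
Qed.

(** The value [0] off the half-line makes the operator exactly linear. *)
Definition lapop f : L2p m2 := mkl2 (lapop_sqint f).

Lemma lapopE f y : 0 < y -> lapop f y = lap m1 f y.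
Proof. by move=> y0; change ((if 0 < y then lap m1 f y else 0) = lap m1 f y); rewrite y0. Qed.

Lemma lapop0E f y : y <= 0 -> lapop f y = 0.
Proof.
by move=> y0; change ((if 0 < y then lap m1 f y else 0) = 0); rewrite ltNge y0.
Qed.

Lemma lapable_l2 f : lapable m1 f.
Proof. exact: lapable_sqint m1S (l2P f). Qed.

Lemma lapop_linear : linear lapop.
Proof.
move=> a f g; apply/val_inj/funext => y.
change ((if 0 < y then lap m1 (a *: f + g) y else 0) =
  a * (if 0 < y then lap m1 f y else 0) + (if 0 < y then lap m1 g y else 0)).
case: ifPn => y0; last by rewrite mulr0 addr0.
rewrite /lap -RintegralZl; [|exact: mRpos|exact: (lapable_l2 f).2].
rewrite -RintegralD; [|exact: mRpos|exact: (integrableZl mRpos a ((lapable_l2 f).2 _ y0))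
  |exact: (lapable_l2 g).2].
by apply: eq_Rintegral => x _; rewrite l2DZ; ring.
Qed.

HB.instance Definition _ := GRing.isLinear.Build R (L2p m1) (L2p m2) _ lapop lapop_linear.

Lemma nsq_lapop_le f : nsq (lapop f) <= c1 * c2 * nsq f.
Proof.
rewrite -lee_fin EFinM !nsqL2.
apply: le_trans (lap_bounded m1S m2S (schur_ge0 m1S) (l2P f)).
rewrite le_eqVlt; apply/orP; left; apply/eqP/eq_integral => y /set_mem/RposP y0.
by rewrite lapopE.
Qed.

End Operator.

Lemma lapop_adj (m1 m2 : {sigma_finite_measure set T -> \bar R}) (c1 c2 : R)
    (m1S : schur m1 c1) (m2S : schur m2 c2) (f : L2p m1) (g : L2p m2) :
  dot (lapop m1S m2S f) g = dot f (lapop m2S m1S g).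
Proof.
rewrite !dotL2; transitivity (\int[m2]_(y in Rpos) (lap m1 f y * g y)).
  by apply: eq_Rintegral => y /set_mem/RposP y0; rewrite lapopE.
rewrite (lap_adjoint m1S m2S (l2P f) (l2P g)).
by apply: eq_Rintegral => y /set_mem/RposP y0; rewrite lapopE.
Qed.

(** * The operator with kernel [1 / (x + y)] *)

Section Carleman.
Variables (mu : {sigma_finite_measure set T -> \bar R}) (c : R).
Hypotheses (muS : schur mu c)
  (mu_cofinite : (\int[mu]_(l in Rpos) (l ^- 2)%:E < +oo)%E).
Local Notation X := (L2p leb).
Local Notation Y := (L2p mu).
Implicit Types (y : Y) (l : R).

Let lebS : schur leb pi := @schur_lebesgue R.

Definition Lop : {linear X -> Y} := lapop lebS muS.
Definition Lst : {linear Y -> X} := lapop muS lebS.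
Definition Gop : {linear Y -> Y} := Lop \o Lst.

Lemma Lop_adj f y : dot (Lop f) y = dot f (Lst y).
Proof. exact: lapop_adj. Qed.

Lemma Lst_adj y f : dot (Lst y) f = dot y (Lop f).
Proof. exact: lapop_adj. Qed.

Lemma Gop_sym y y' : dot (Gop y) y' = dot y (Gop y').
Proof.
change (dot (Lop (Lst y)) y' = dot y (Lop (Lst y'))).
by rewrite Lop_adj Lst_adj.
Qed.

Lemma measurable_invr : measurable_fun (Rpos : set T) (fun x => x^-1 : R).
Proof.
apply: continuous_Rpos_measurable => x x0; apply: continuousV => //.
by rewrite gt_eqF.
Qed.

Lemma vinv_sqint : sqint mu Rpos (fun l => if 0 < l then l^-1 else 0).
Proof.
apply: sqintP.
  apply: (eq_measurable_fun (fun x : R => x^-1 : R)); last exact: measurable_invr.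
  by move=> y /set_mem/RposP ->.
rewrite (_ : (\int[mu]_(x in Rpos) _)%E = (\int[mu]_(l in Rpos) (l ^- 2)%:E)%E)//.
by apply: eq_integral => l /set_mem/RposP ->; rewrite exprVn.
Qed.

Definition vinv : Y := mkl2 vinv_sqint.

Lemma vinvE l : vinv l = if 0 < l then l^-1 else 0. Proof. by []. Qed.

Lemma kinv_sqint l : sqint mu Rpos (fun x => if 0 < l then (x + l)^-1 else 0).
Proof.
have [l0|l0] := boolP (0 < l); last exact: (l2P (0 : Y)).
apply: (sqint_le mRpos _ vinv_sqint) => [|x /RposP x0].
  apply: continuous_Rpos_measurable => x x0; apply: continuousV.
    by rewrite gt_eqF// addr_gt0.
  by apply: continuousD => //; exact: cvg_cst.
have xl : 0 < x + l by rewrite addr_gt0.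
by rewrite x0 !ger0_norm ?invr_ge0 ?(ltW xl) ?(ltW x0)// lef_pV2 ?posrE// lerDl ltW.
Qed.

Definition kinv l : Y := mkl2 (kinv_sqint l).

Lemma nsq_kinv_le l : nsq (kinv l) <= nsq vinv.
Proof.
rewrite /nsq !dotL2; apply: le_Rintegral; first exact: mRpos.
- exact: (l2_mul mRpos (kinv l) (kinv l)).
- exact: (l2_mul mRpos vinv vinv).
move=> x /RposP x0.
change ((if 0 < l then (x + l)^-1 else 0) * (if 0 < l then (x + l)^-1 else 0) <=
  vinv x * vinv x).
rewrite vinvE x0; case: ifPn => l0; last by rewrite mulr0 mulr_ge0 ?invr_ge0 ?ltW.
have xl : 0 < x + l by rewrite addr_gt0.
by rewrite ler_pM ?invr_ge0 ?(ltW xl)// lef_pV2 ?posrE// lerDl ltW.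
Qed.

Lemma int_exp_pos a : 0 < a -> \int[leb]_(t in Rpos) expR (- (a * t)) = a^-1.
Proof.
move=> a0; have h : ((a * \int[leb]_(t in Rpos) expR (- (a * t)))%:E =
    (expR (- (a * 0)))%:E).
  rewrite -(int_exp_tail 0 a0) -/Rpos EFinM -EFin_Rintegral; last first.
    apply/integrableP; split; first by apply/measurable_EFinP; exact: measurable_exp_mul.
    rewrite (_ : (\int[leb]_(t in Rpos) _)%E =
        (\int[leb]_(t in Rpos) ((a^-1)%:E * (a * expR (- (a * t)))%:E))%E); last first.
      apply: eq_integral => t _; rewrite -EFinM mulKf ?gt_eqF//.
      by rewrite /= ger0_norm ?expR_ge0.
    rewrite ge0_integralZl; last 4 first.
    - exact: mRpos.
    - by apply/measurable_EFinP/measurable_funM => //; exact: measurable_exp_mul.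
    - by move=> t _; rewrite lee_fin mulr_ge0 ?expR_ge0// ltW.
    - by rewrite lee_fin invr_ge0 ltW.
    by rewrite /Defs.Rpos int_exp_tail// -EFinM ltry.
  rewrite -ge0_integralZl//; last 3 first.
  - exact: mRpos.
  - by apply/measurable_EFinP; exact: measurable_exp_mul.
  - by rewrite lee_fin ltW.
apply: (mulfI (lt0r_neq0 a0)).
by rewrite (EFin_inj h) mulr0 oppr0 expR0 mulfV// gt_eqF.
Qed.

Lemma GopE y l : 0 < l -> Gop y l = dot y (kinv l).
Proof.
move=> l0; have eP := schur_exp_sqint lebS l0.
pose e : X := mkl2 eP.
have -> : Gop y l = dot e (Lst y).
  by rewrite lapopE// dotL2 /lap; apply: eq_Rintegral.
rewrite -Lop_adj dotC !dotL2; apply: eq_Rintegral => x /set_mem/RposP x0.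
change (y x * lapop lebS muS e x = y x * (if 0 < l then (x + l)^-1 else 0)).
rewrite l0 lapopE// -int_exp_pos ?addr_gt0//; congr (_ * _).
apply: eq_Rintegral => t _; change (expR (- (x * t)) * expR (- (l * t)) = expR (- ((x + l) * t))).
by rewrite -expRD; congr expR; ring.
Qed.

Lemma Gop0E y l : l <= 0 -> Gop y l = 0.
Proof. exact: lapop0E. Qed.

Lemma Gop_sqr_le y l : Gop y l ^+ 2 <= nsq y * nsq vinv.
Proof.
have [l0|l0] := ltP 0 l; last first.
  by rewrite Gop0E// expr0n mulr0n mulr_ge0 ?nsq_ge0.
rewrite GopE//; apply: le_trans (cauchy_schwarz _ _) _.
by rewrite ler_wpM2l ?nsq_ge0// nsq_kinv_le.
Qed.

Lemma Aop_sqint y : sqint mu Rpos (fun l => if 0 < l then Gop y l / l else 0).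
Proof.
have mA : measurable_fun (Rpos : set T) (fun l => if 0 < l then Gop y l / l else 0).
  apply: (eq_measurable_fun (fun l => Gop y l / l)).
    by move=> l /set_mem/RposP ->.
  by apply: measurable_funM; [by case: (l2P (Gop y))|exact: measurable_invr].
pose k : R := Num.sqrt (nsq y * nsq vinv).
apply: (sqint_le mRpos mA (l2P (k *: vinv))) => l /RposP l0.
rewrite l2Z vinvE l0 !normrM normfV (gtr0_norm l0) ler_pM2r ?invr_gt0//.
by rewrite (ger0_norm (sqrtr_ge0 _)) -sqrtr_sqr ler_wsqrtr// Gop_sqr_le.
Qed.

Definition Aval y : Y := mkl2 (Aop_sqint y).

Lemma AvalE y l : Aval y l = if 0 < l then Gop y l / l else 0. Proof. by []. Qed.

Lemma Aval_linear : linear Aval.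
Proof.
move=> a y y'; apply/val_inj/funext => l.
have GE : Gop (a *: y + y') l = a * Gop y l + Gop y' l by rewrite linearP.
change ((if 0 < l then Gop (a *: y + y') l / l else 0) =
  a * (if 0 < l then Gop y l / l else 0) + (if 0 < l then Gop y' l / l else 0)).
rewrite GE; case: ifPn => l0; last by rewrite mulr0 addr0.
by rewrite mulrDl mulrA.
Qed.

HB.instance Definition _ := GRing.isLinear.Build R Y Y _ Aval Aval_linear.

Definition Aop : {linear Y -> Y} := Aval.

Lemma AopE y l : 0 < l -> Aop y l = Gop y l / l.
Proof. by move=> l0; change (Aval y l = Gop y l / l); rewrite AvalE l0. Qed.

Lemma Aop0E y l : l <= 0 -> Aop y l = 0.
Proof. by move=> l0; change (Aval y l = 0); rewrite AvalE ltNge l0. Qed.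

Lemma Aop_le y : nsq (Aop y) <= nsq vinv ^+ 2 * nsq y.
Proof.
rewrite expr2 -mulrA mulrC (mulrC (nsq vinv)) /nsq -/(nsq y) -/(nsq vinv).
rewrite [leLHS]dotL2 [X in _ <= _ * X]dotL2.
rewrite -RintegralZl; [|exact: mRpos|exact: (l2_mul mRpos vinv vinv)].
apply: le_Rintegral; first exact: mRpos.
- exact: (l2_mul mRpos (Aop y) (Aop y)).
- exact: (integrableZl mRpos _ (l2_mul mRpos vinv vinv)).
move=> l /RposP l0; rewrite AopE// mulrACA -expr2 vinvE l0.
by rewrite ler_wpM2r ?Gop_sqr_le// mulr_ge0 ?invr_ge0 ?ltW.
Qed.

(** Partial fractions: [1 / (x (x + l)) = (1 / x - 1 / (x + l)) / l]. *)
Lemma Gop_div (psi phi : Y) : (forall l, 0 < l -> phi l = psi l / l) ->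
  Gop phi = dot psi vinv *: vinv - Aop psi.
Proof.
move=> pp; apply/val_inj/funext => l.
change (Gop phi l = dot psi vinv * vinv l - Aop psi l).
have [l0|l0] := ltP 0 l; last first.
  by rewrite Gop0E// Aop0E// vinvE ltNge l0 mulr0 subr0.
rewrite vinvE l0 AopE// !GopE// -mulrBl -dotBr [in LHS]dotL2 dotL2 mulrC.
rewrite -RintegralZl; [|exact: mRpos|exact: (l2_mul mRpos psi (vinv - kinv l))].
apply: eq_Rintegral => x /set_mem/RposP x0.
change (phi x * (if 0 < l then (x + l)^-1 else 0) =
  l^-1 * (psi x * (vinv x - (if 0 < l then (x + l)^-1 else 0)))).
rewrite l0 vinvE x0 pp//; field.
by rewrite !gt_eqF// addr_gt0.
Qed.

(** [Gop_div] for the pair [Gop y], [Aop y]. *)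
Lemma lyapunov_Gop y : Aop (Gop y) + Gop (Aop y) = dot y (Gop vinv) *: vinv.
Proof.
rewrite (@Gop_div (Gop y) (Aop y)); last by move=> l l0; rewrite AopE.
by rewrite Gop_sym addrCA subrr addr0.
Qed.

(** [dot (Gop y) y] is the square norm of the Laplace transform of [y], and the
    Laplace transform is injective. *)
Lemma Gop_inj y : nsq (Gop y) = 0 -> nsq y = 0.
Proof.
move=> Gy; have : nsq (Lst y) = 0.
  by rewrite /nsq Lst_adj dotC; exact: (nsq0_dot y Gy).
move=> /nsqL20P Ly.
have yL : lapable mu y by exact: lapable_l2 muS y.
apply/nsqL20P; apply: (lap_inj yL) => n.
apply: (@ae0_continuous _ (lap mu y)) => //.
- by move=> t t0; exact: lap_cont.
- apply: ae_imp Ly => t h Rt; rewrite -h//; apply/esym/lapopE.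
  exact/RposP.
Qed.

Lemma Aop_inj y : nsq (Aop y) = 0 -> nsq y = 0.
Proof.
move=> /nsqL20P Ay; apply: Gop_inj; apply/nsqL20P; apply: ae_imp Ay => l h Rl.
have l0 := proj1 (RposP l) Rl; have := h Rl; rewrite AopE// => /eqP.
by rewrite mulf_eq0 invr_eq0 (gt_eqF l0) orbF => /eqP.
Qed.

Definition Bnd : R := pi * c + 1.

Lemma Bnd_gt0 : 0 < Bnd.
Proof. by rewrite ltr_wpDl// mulr_ge0 ?pi_ge0// (schur_ge0 muS). Qed.

Lemma Gop_le y : nsq (Gop y) <= Bnd * dot (Gop y) y.
Proof.
have -> : dot (Gop y) y = nsq (Lst y) by rewrite /nsq Lst_adj dotC.
apply: le_trans (nsq_lapop_le lebS muS (Lst y)) _.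
by rewrite ler_wpM2r ?nsq_ge0// lerDl.
Qed.

End Carleman.

End LaplaceOperator.

(** * The unitary map attached to a factorization of the operator *)

Section SquareRoot.
Context {R : realType} {X Y : hspace R}.
Local Notation T := (measurableTypeR R).
Variables (L : {linear X -> Y}) (Ls : {linear Y -> X}).
Hypothesis L_adj : forall x y, dot (L x) y = dot x (Ls y).
Variables (s : {finite_measure set T -> \bar R}) (B : R) (B_gt0 : 0 < B).
Local Notation Z := (L2space s (mIoc B)).
Local Notation one := (zpow s (mIoc B) (@Ioc_le R B) 0).
Local Notation M := (mulX (s := s) (mD := mIoc B) B_gt0 (@Ioc_le R B)).
Variable Phi : Y -> Z.
Hypothesis Phi_dot : forall y y', dot (Phi y) (Phi y') = dot y y'.
Hypothesis Phi_onto : forall w, exists y, nsq (Phi y - w) = 0.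
Hypothesis Phi_mulX : forall y, nsq (Phi (L (Ls y)) - M (Phi y)) = 0.
Implicit Types (f : X) (y : Y) (w g : Z).

Let mD := mIoc B.

Lemma Phi_nsq y : nsq (Phi y) = nsq y. Proof. exact: Phi_dot. Qed.

Lemma Phi_DZ a y y' : nsq (Phi (a *: y + y') - (a *: Phi y + Phi y')) = 0.
Proof.
rewrite nsqB Phi_nsq dotDr dotZr !Phi_dot !nsqD !nsqZ !Phi_nsq !dotZl Phi_dot.
by rewrite dotDl dotZl !dotDl !dotZl -!/(nsq _) (dotC y' y); ring.
Qed.

(** The weight [E^(-k/2)] is unbounded, hence the cut-off near [0]. *)
Definition cutfun (k n : nat) w (E : R) : R :=
  if n.+1%:R^-1 <= E then (Num.sqrt E) ^- k * w E else 0.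

Lemma measurable_sqrtVX (k : nat) :
  measurable_fun (Ioc B : set T) (fun E => (Num.sqrt E) ^- k).
Proof.
apply: (measurable_funS (@mRpos R)) => [x /Ioc_gt0/RposP //|].
apply: continuous_Rpos_measurable => E E0; apply: continuousV.
  by rewrite expf_neq0// gt_eqF// sqrtr_gt0.
apply: (@continuous_comp _ _ _ (@Num.sqrt R) (fun u => u ^+ k)).
  exact: continuous_Rsqrt.
exact: exprn_continuous.
Qed.

Lemma cut_sqint k n w : sqint s (Ioc B) (cutfun k n w).
Proof.
pose K : R := (Num.sqrt n.+1%:R^-1) ^- k.
have s0 : 0 < Num.sqrt n.+1%:R^-1 :> R by rewrite sqrtr_gt0 invr_gt0.
apply: (sqint_le mD _ (l2P (K *: w))) => [|E /Ioc_gt0 E0].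
  rewrite /cutfun; apply: measurable_fun_if => //.
  - by apply: measurable_fun_ler => //; exact: measurable_cst.
  - apply: measurable_funM.
      by apply: measurable_funS (measurable_sqrtVX k) => // x [].
    by apply: measurable_funS (l2_meas w) => // x [].
rewrite /cutfun l2Z; case: ifPn => nE; last by rewrite normr0.
have sE : 0 < Num.sqrt E by rewrite sqrtr_gt0.
rewrite !normrM ler_wpM2r// !ger0_norm ?invr_ge0 ?exprn_ge0 ?sqrtr_ge0//.
rewrite lef_pV2 ?posrE ?exprn_gt0// lerXn2r ?nnegrE ?sqrtr_ge0//.
by rewrite ler_wsqrtr.
Qed.

Definition cut k n w : Z := mkl2 (cut_sqint k n w).

Lemma cutE k n w E : cut k n w E =
  if n.+1%:R^-1 <= E then (Num.sqrt E) ^- k * w E else 0.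
Proof. by []. Qed.

Let Icut n : set T := Ioc B `&` `[n.+1%:R^-1, +oo[%classic.

Lemma mIcut n : measurable (Icut n).
Proof. by apply: measurableI => //; exact: mIoc. Qed.

Lemma cut_integral_cvg (f : R -> R) : measurable_fun (Ioc B : set T) f ->
  (forall E, Ioc B E -> 0 <= f E) ->
  (\int[s]_(E in Ioc B) (if n.+1%:R^-1 <= E then f E else 0)%:E)%E @[n --> \oo] -->
  (\int[s]_(E in Ioc B) (f E)%:E)%E.
Proof.
move=> mf f0; have IU : \bigcup_n Icut n = Ioc B.
  apply/seteqP; split => [x [n _ []]//|x Dx]; have x0 := Ioc_gt0 Dx.
  exists (Num.truncn x^-1) => //; split=> //.
  rewrite /= in_itv/= andbT invf_ple ?posrE//; apply/ltW; exact: truncnS_gt.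
rewrite -[X in _ --> (\int[_]_(_ in X) _)%E]IU.
have -> : (fun n => \int[s]_(E in Ioc B) (if n.+1%:R^-1 <= E then f E else 0)%:E)%E =
    (fun n => \int[s]_(E in Icut n) (f E)%:E)%E.
  apply/funext => n; rewrite integral_mkcond [RHS]integral_mkcond.
  apply: eq_integral => x _; rewrite !patchE /Icut in_setI.
  rewrite (_ : (x \in `[n.+1%:R^-1, +oo[%classic) = (n.+1%:R^-1 <= x)).
    by case: ifP => //= _; case: ifP.
  by apply/idP/idP => [/set_mem|h]; rewrite ?inE/= in_itv/= andbT.
apply: (@ge0_nondecreasing_set_cvg_integral _ T R Icut (EFin \o f) s).
- move=> n m nm; apply/subsetPset => x [Dx]; rewrite /= in_itv/= andbT => nx.
  split=> //; rewrite /= in_itv/= andbT; apply: le_trans nx.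
  by rewrite lef_pV2 ?posrE// ler_nat ltnS.
- exact: mIcut.
- move=> n; by apply/measurable_EFinP; apply: (measurable_funS mD _ mf) => x [].
- by move=> n x [Dx _]; rewrite lee_fin f0.
Qed.

Lemma dot_Ls y y' : dot (Ls y) (Ls y') = dot (M (Phi y)) (Phi y').
Proof.
by rewrite -L_adj -Phi_dot (nsqB0_dot _ (Phi_mulX y)).
Qed.

Definition tval f (E : R) : R := (Num.sqrt E)^-1 * Phi (L f) E.

Definition cutsq f n : R := \int[s]_(E in Ioc B)
  (if n.+1%:R^-1 <= E then tval f E ^+ 2 else 0).

(** Duality: the cut-off integral is the pairing of [f] with a vector [Ls y]
    whose square norm is the same integral. *)
Lemma cutsq_le f n : cutsq f n <= nsq f.
Proof.
pose w := Phi (L f); have [y yw] := Phi_onto (cut 2 n w).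
have I1 : cutsq f n = dot w (cut 2 n w).
  rewrite dotL2; apply: eq_Rintegral => E _; rewrite cutE; case: ifPn => _.
    by rewrite /tval exprMn exprVn -/w; ring.
  by rewrite mulr0.
have I2 : cutsq f n = dot f (Ls y).
  by rewrite I1 -L_adj -Phi_dot -/w dotC -(nsqB0_dot _ yw) dotC.
have I3 : cutsq f n = nsq (Ls y).
  rewrite /nsq dot_Ls (dotC (M _)) (nsqB0_dot _ yw) (dotC (cut _ _ _)).
  have -> : dot (M (Phi y)) (cut 2 n w) = dot (M (cut 2 n w)) (cut 2 n w).
    apply: nsqB0_dot; rewrite -linearB; exact: mulX_null.
  rewrite I1 !dotL2; apply: eq_Rintegral => E /set_mem/Ioc_gt0 E0.
  change (w E * cut 2 n w E = E * cut 2 n w E * cut 2 n w E).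
  rewrite cutE; case: ifPn => _; last by rewrite !mulr0.
  have := sqr_sqrtr (ltW E0); have : 0 < Num.sqrt E by rewrite sqrtr_gt0.
  move: (Num.sqrt E) (w E) => u a u0 uE; rewrite -uE; field.
  by rewrite gt_eqF.
have := cauchy_schwarz f (Ls y); rewrite -I2 -I3 expr2.
have : 0 <= cutsq f n by rewrite I3 nsq_ge0.
rewrite le_eqVlt => /predU1P[<- _|c0]; first exact: nsq_ge0.
by rewrite ler_pM2r.
Qed.

Lemma tval_measurable f : measurable_fun (Ioc B : set T) (tval f).
Proof.
apply: measurable_funM; last exact: l2_meas.
exact: (measurable_sqrtVX 1).
Qed.

Lemma tval_int_le f : (\int[s]_(E in Ioc B) (tval f E ^+ 2)%:E <= (nsq f)%:E)%E.
Proof.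
have mf := tval_measurable f.
have c := @cut_integral_cvg (fun E => tval f E ^+ 2)
  (measurable_funX 2 mf) (fun E _ => sqr_ge0 _).
apply: cvge_le c; apply: nearW => n.
rewrite -[leLHS]fineK; first by rewrite lee_fin; exact: cutsq_le.
have := l2_mul mD (Phi (L f)) (cut 2 n (Phi (L f))).
move=> /(integrable_fin_num mD); congr (_ \is a fin_num).
apply: eq_integral => E _.
change ((Phi (L f) E * cut 2 n (Phi (L f)) E)%:E =
  (if n.+1%:R^-1 <= E then tval f E ^+ 2 else 0)%:E).
rewrite cutE; case: ifPn => _; last by rewrite mulr0.
by rewrite /tval exprMn exprVn; congr EFin; ring.
Qed.

Lemma tval_sqint f : sqint s (Ioc B) (tval f).
Proof.
apply: sqintP; first exact: tval_measurable.
exact: le_lt_trans (tval_int_le f) (ltry _).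
Qed.

(** The isometric part of the polar decomposition of [L], in the representation
    in which [L Ls] is the multiplication by the variable. *)
Definition Top f : Z := mkl2 (tval_sqint f).

Lemma TopE f E : Top f E = (Num.sqrt E)^-1 * Phi (L f) E. Proof. by []. Qed.

Lemma nsq_Top_le f : nsq (Top f) <= nsq f.
Proof. by rewrite -lee_fin nsqL2; exact: tval_int_le. Qed.

Lemma Top_ae f w : nsq (Phi (L f) - w) = 0 -> forall w' : Z,
  (forall E, Ioc B E -> w' E = (Num.sqrt E)^-1 * w E) -> nsq (Top f - w') = 0.
Proof.
move=> /nsqL20P fw w' w'E; apply/nsqL20P; apply: ae_imp fw => E h DE.
have /eqP : Phi (L f) E - w E = 0 := h DE; rewrite subr_eq0 => /eqP PE.
by change (Top f E - w' E = 0); rewrite TopE w'E// PE subrr.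
Qed.

Lemma Top_DZ a (f g : X) : nsq (Top (a *: f + g) - (a *: Top f + Top g)) = 0.
Proof.
have h : nsq (Phi (L (a *: f + g)) - (a *: Phi (L f) + Phi (L g))) = 0.
  by rewrite linearP; exact: Phi_DZ.
apply: (Top_ae h) => E _.
by change (a * Top f E + Top g E = (Num.sqrt E)^-1 * (a * Phi (L f) E + Phi (L g) E));
  rewrite !TopE; ring.
Qed.

Lemma Top_B (f g : X) : nsq (Top (f - g) - (Top f - Top g)) = 0.
Proof.
have := Top_DZ (-1) g f; rewrite !scaleN1r.
by rewrite ![- _ + _]addrC.
Qed.

Lemma Top_LsL f : nsq (Top (Ls (L f)) - M (Top f)) = 0.
Proof.
apply: (Top_ae (Phi_mulX (L f))) => E _.
by change (E * Top f E = (Num.sqrt E)^-1 * (E * Phi (L f) E)); rewrite TopE; ring.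
Qed.

Lemma Top_null f : nsq (Top f) = 0 <-> nsq (Ls (L f)) = 0.
Proof.
have lem : nsq (Top f) = 0 <-> nsq (L f) = 0.
  rewrite -Phi_nsq; split => /nsqL20P h; apply/nsqL20P; apply: ae_imp h => E h DE.
    have /eqP : (Num.sqrt E)^-1 * Phi (L f) E = 0 := h DE.
    by rewrite mulf_eq0 invr_eq0 gt_eqF ?sqrtr_gt0 ?(Ioc_gt0 DE)//= => /eqP.
  by change ((Num.sqrt E)^-1 * Phi (L f) E = 0); rewrite h// mulr0.
rewrite lem; split => [Lf0|h].
  have : nsq (Ls (L f)) = dot (L (Ls (L f))) (L f) by rewrite L_adj.
  by rewrite dotC nsq0_dot.
by rewrite /nsq L_adj dotC nsq0_dot.
Qed.

Lemma nsq_cut_sub g n : nsq (g - cut 0 n g) = nsq g - nsq (cut 0 n g).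
Proof.
rewrite nsqB; have -> : dot g (cut 0 n g) = nsq (cut 0 n g); last by ring.
rewrite /nsq !dotL2; apply: eq_Rintegral => E _; rewrite !cutE.
by case: ifPn => _; rewrite ?mulr0// expr0 invr1 !mul1r.
Qed.

Lemma nsq_cut_cvg g : nsq (cut 0 n g) @[n --> \oo] --> nsq g.
Proof.
have c := @cut_integral_cvg (fun E => g E ^+ 2)
  (measurable_funX 2 (l2_meas g)) (fun E _ => sqr_ge0 _).
rewrite -nsqL2 in c.
have -> : (fun n => nsq (cut 0 n g)) = (fun n => fine
    (\int[s]_(E in Ioc B) (if n.+1%:R^-1 <= E then g E ^+ 2 else 0)%:E)).
  apply/funext => n; rewrite -[LHS]/(fine (nsq (cut 0 n g))%:E) nsqL2; congr fine.
  apply: eq_integral => E _; rewrite cutE; case: ifPn => _.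
    by rewrite expr0 invr1 mul1r.
  by rewrite expr0n.
exact: fine_cvg c.
Qed.

(** Every [g] is the image of a limit of vectors in the range of [Ls L], of the
    same norm: cut off near [0], [g] is the image of [Ls (L k)] where [k] is
    [Ls] of the vector that corresponds to [E^(-3/2) g]. *)
Lemma Top_onto g : exists p : X, [/\ nsq (Top p - g) = 0, nsq p = nsq g &
  forall e : R, 0 < e -> exists k, nsq (p - Ls (L k)) < e].
Proof.
have /choice[k kP] : forall n : nat, exists k : X, exists y : Y,
    Ls (L k) = Ls y /\ nsq (Top (Ls y) - cut 0 n g) = 0.
  move=> n; have [x xw] := Phi_onto (cut 3 n g).
  exists (Ls x), (L (Ls x)); split => //.
  have h1 := Phi_mulX (L (Ls x)).
  have h2 := mulX_null B_gt0 (@Ioc_le R B) (Phi_mulX x).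
  have h3 := mulX_null B_gt0 (@Ioc_le R B) (mulX_null B_gt0 (@Ioc_le R B) xw).
  have h : nsq (Phi (L (Ls (L (Ls x)))) - M (M (cut 3 n g))) = 0.
    have -> : Phi (L (Ls (L (Ls x)))) - M (M (cut 3 n g)) =
       (Phi (L (Ls (L (Ls x)))) - M (Phi (L (Ls x)))) +
       (M (Phi (L (Ls x)) - M (Phi x)) + M (M (Phi x - cut 3 n g))).
      have MB a b : M (a - b) = M a - M b by exact: linearB.
      by rewrite !MB !subrKA.
    by apply: nsqD0 => //; exact: nsqD0.
  apply: (Top_ae h) => E DE.
  change (cut 0 n g E = (Num.sqrt E)^-1 * (E * (E * cut 3 n g E))).
  rewrite !cutE; case: ifPn => _; last by rewrite !mulr0.
  have E0 := Ioc_gt0 DE.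
  have := sqr_sqrtr (ltW E0); have : 0 < Num.sqrt E by rewrite sqrtr_gt0.
  rewrite expr0 invr1 mul1r.
  move: (Num.sqrt E) (g E) => u a u0 uE; rewrite -uE; field.
  by rewrite gt_eqF.
pose f n := Ls (L (k n)).
have fT n : nsq (Top (f n) - cut 0 n g) = 0.
  by have [y [e h]] := kP n; rewrite /f e.
have isom y : nsq (Top (Ls y)) = nsq (Ls y).
  rewrite [RHS]dot_Ls /nsq !dotL2.
  have /nsqL20P h := Phi_mulX y.
  congr fine; apply: ae_eq_integral.
  - exact: mIoc.
  - by apply/measurable_EFinP/measurable_funM; exact: l2_meas.
  - by apply/measurable_EFinP/measurable_funM; exact: l2_meas.
  apply: ae_imp h => E h DE.
  have /eqP : Phi (L (Ls y)) E - E * Phi y E = 0 := h DE.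
  rewrite subr_eq0 => /eqP PE; rewrite !TopE PE; congr EFin.
  change ((Num.sqrt E)^-1 * (E * Phi y E) * ((Num.sqrt E)^-1 * (E * Phi y E)) =
    E * Phi y E * Phi y E).
  have E0 := Ioc_gt0 DE.
  have := sqr_sqrtr (ltW E0); have : 0 < Num.sqrt E by rewrite sqrtr_gt0.
  move: (Num.sqrt E) (Phi y E) => u a u0 uE; rewrite -uE; field.
  by rewrite gt_eqF.
have dist m n : nsq (f m - f n) = nsq (cut 0 m g - cut 0 n g).
  have [ym [e1 _]] := kP m; have [yn [e2 _]] := kP n.
  have -> : f m - f n = Ls (ym - yn) by rewrite /f e1 e2 linearB.
  rewrite -isom linearB -e1 -e2 -/(f m) -/(f n).
  rewrite (nsqB0 (Top_B _ _)); apply: nsqB0.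
  have -> : Top (f m) - Top (f n) - (cut 0 m g - cut 0 n g) =
      (Top (f m) - cut 0 m g) - (Top (f n) - cut 0 n g).
    by rewrite !opprD !opprK addrACA.
  by apply: nsqD0 => //; rewrite nsqN.
have cutc (e : R) : 0 < e -> exists N, forall n, (N <= n)%N -> nsq (g - cut 0 n g) < e.
  move=> e0; have /cvgrPdist_lt/(_ _ e0)[N _ NP] := @nsq_cut_cvg g.
  exists N => n /NP h; rewrite nsq_cut_sub; apply: le_lt_trans h.
  exact: ler_norm.
have [|p pP] := @dot_complete _ X f.
  move=> e e0; have [N NP] := cutc (e / 4) (divr_gt0 e0 (ltr0Sn _ _)).
  exists N => m n Nm Nn; rewrite -/(nsq _) dist.
  have -> : cut 0 m g - cut 0 n g = (g - cut 0 n g) - (g - cut 0 m g).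
    by rewrite opprB [RHS]addrC subrKA.
  have := nsqD_le (g - cut 0 n g) (- (g - cut 0 m g)); rewrite nsqN.
  have := NP m Nm; have := NP n Nn; lra.
have fp (e : R) : 0 < e -> exists N, forall n, (N <= n)%N -> nsq (p - f n) < e.
  by move=> /pP[N NP]; exists N => n /NP; rewrite -/(nsq _) nsqBC.
have Tpg : nsq (Top p - g) = 0.
  apply/eqP; rewrite eq_le nsq_ge0 andbT; apply: (@eps_le0 R _ 4) => e e0.
  have [N1 N1P] := fp e e0; have [N2 N2P] := cutc e e0.
  pose n := maxn N1 N2.
  have := N1P n (leq_maxl _ _); have := N2P n (leq_maxr _ _).
  have h : nsq (Top p - g - (Top (p - f n) - (g - cut 0 n g))) = 0.
    have -> : Top p - g - (Top (p - f n) - (g - cut 0 n g)) =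
       - (Top (p - f n) - (Top p - Top (f n))) + (Top (f n) - cut 0 n g).
      move: (Top p) (Top (p - f n)) (Top (f n)) (cut 0 n g) => a1 a2 a3 a4.
      apply/val_inj/funext => E.
      change (a1 E - g E - (a2 E - (g E - a4 E)) =
        - (a2 E - (a1 E - a3 E)) + (a3 E - a4 E)); ring.
    by apply: nsqD0 => //; rewrite nsqN; exact: Top_B.
  rewrite (nsqB0 h) => a1 a2.
  have := nsqD_le (Top (p - f n)) (- (g - cut 0 n g)); rewrite nsqN.
  by have := nsq_Top_le (p - f n); lra.
exists p; split => //; last first.
  by move=> e /fp[N NP]; exists (k N); apply: NP.
have isof n : nsq (f n) = nsq (cut 0 n g).
  by have [y [e1 _]] := kP n; rewrite /f e1 -isom -e1 -/(f n) (nsqB0 (fT n)).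
have Tp : nsq (Top p) = nsq g by exact: nsqB0 Tpg.
apply/eqP; rewrite eq_le; apply/andP; split; last by rewrite -Tp nsq_Top_le.
(* A loss of norm would keep [dot p (p - f n)] away from [0]. *)
rewrite leNgt; apply/negP => gp.
have : ((nsq p - nsq g) / 2) ^+ 2 <= 0.
  apply: (@eps_le0 R _ (nsq p)) => e e0; have [n nP] := fp e e0.
  have := nP n (leqnn n) => pf; apply: (@le_trans _ _ (dot p (p - f n) ^+ 2)).
    have := nsq_ge0 (p - f n); rewrite nsqB isof => h1.
    have := nsq_ge0 (g - cut 0 n g); rewrite nsq_cut_sub => h2.
    have h3 : (nsq p - nsq g) / 2 <= dot p (p - f n) by rewrite dotBr -/(nsq p); lra.
    rewrite lerXn2r ?nnegrE//; lra.
  apply: le_trans (cauchy_schwarz _ _) _; rewrite ler_wpM2l ?nsq_ge0//; exact: ltW.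
apply/negP; rewrite -ltNge exprn_gt0//; lra.
Qed.

End SquareRoot.

(** * Integration by parts on the half-line *)

Section TestFunctions.
Context {R : realType}.
Local Notation T := (measurableTypeR R).
Local Notation leb := (@lebesgue_measure R).
Local Notation Rpos := (@Rpos R).
Implicit Types (f u w : R -> R) (a b x l : R).

Lemma compact_Rpos (S : set R) : compact S -> S `<=` Rpos ->
  exists a b, [/\ 0 < a, a <= b & forall x, S x -> a <= x <= b].
Proof.
move=> cS SR; have [S0|/set0P/negP/negPn/eqP->] := pselect (S !=set0); last first.
  by exists 1, 1; split => // x [].
have cid : {within S, continuous (@idfun R)} by apply: continuous_subspaceT => x; exact: cvg_id.
have [a /set_mem Sa aP] := compact_EVT_min S0 cS cid.
have [b /set_mem Sb bP] := compact_EVT_max S0 cS cid.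
exists a, b; split; first exact/RposP/SR.
  by apply: aP; exact/mem_set.
by move=> x /mem_set Sx; apply/andP; split; [exact: aP|exact: bP].
Qed.

Section CompactSupport.
Variables (w : R -> R) (a b : R).
Hypotheses (a_gt0 : 0 < a)
  (w_cont : forall x, 0 < x -> {for x, continuous w})
  (w_supp : forall x, 0 < x -> w x != 0 -> a <= x <= b).

Let mI : measurable (`[a, b]%classic : set T). Proof. exact: measurable_itv. Qed.

Lemma csupp_patch (V : pointedType) (F : R -> V) : (forall x, w x = 0 -> F x = point) ->
  F \_ Rpos = F \_ `[a, b]%classic.
Proof.
move=> F0; apply/funext => x; rewrite !patchE.
have [wx|wx] := eqVneq (w x) 0; first by rewrite F0//; case: ifP => _; case: ifP.
case: ifPn => [/set_mem/RposP x0|xR].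
  by have /andP[ax xb] := w_supp x0 wx; rewrite mem_set//= in_itv/= ax.
case: ifPn => // /set_mem; rewrite /= in_itv/= => /andP[ax _].
by case/negP: xR; apply/mem_set/RposP; exact: lt_le_trans ax.
Qed.

Lemma csupp_within (F : R -> R) : (forall x, 0 < x -> {for x, continuous F}) ->
  {within `[a, b], continuous F}.
Proof.
move=> cF; apply: continuous_in_subspaceT => x /set_mem; rewrite /= in_itv/= => /andP[ax _].
by apply: cF; exact: lt_le_trans ax.
Qed.

Lemma csupp_integrable : leb.-integrable Rpos (EFin \o w).
Proof.
apply/(integrable_mkcond _ mRpos).
rewrite (@csupp_patch _ (EFin \o w)); last by move=> x /= ->.
apply/(integrable_mkcond _ mI).
by apply: continuous_compact_integrable; [exact: segment_compact|exact: csupp_within].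
Qed.

Lemma csupp_Rintegral : \int[leb]_(x in Rpos) w x = \int[leb]_(x in `[a, b]) w x.
Proof. by rewrite Rintegral_mkcond csupp_patch// -Rintegral_mkcond. Qed.

End CompactSupport.

Lemma csupp_sqint w a b : 0 < a -> (forall x, 0 < x -> {for x, continuous w}) ->
  (forall x, 0 < x -> w x != 0 -> a <= x <= b) -> sqint leb Rpos w.
Proof.
move=> a0 cw ws; split; first exact: continuous_Rpos_measurable.
apply: (@csupp_integrable (fun x => w x ^+ 2) a b) => //.
- move=> x x0; rewrite (_ : (fun x => w x ^+ 2) = w \* w).
    by apply: continuousM; exact: cw.
  by apply/funext => z; rewrite expr2.
- by move=> x x0; rewrite sqrf_eq0; exact: ws.
Qed.

Section ByParts.
Variables (u u' w w' : R -> R) (a b : R).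
Hypotheses (a_gt0 : 0 < a) (ab : a <= b)
  (du : forall x, 0 < x -> is_derive x 1 u (u' x))
  (dw : forall x, 0 < x -> is_derive x 1 w (w' x))
  (cu' : forall x, 0 < x -> {for x, continuous u'})
  (cw' : forall x, 0 < x -> {for x, continuous w'})
  (w_supp : forall x, w x != 0 -> a <= x <= b).

Lemma derive_supp x : 0 < x -> w' x != 0 -> a <= x <= b.
Proof.
move=> x0; apply: contraR => xab.
suff : 'D_1 w x = 0 by have [_ ->] := dw x0 => ->.
have -> : 'D_1 w x = 'D_1 (cst 0) x.
  apply: near_eq_derive.
  have : \forall z \near x, ~ (a <= z <= b).
    move: xab; rewrite negb_and -!ltNge => /orP[xa|bx].
      near=> z => /andP[az _]; have : z < a by near: z; exact: lt_nbhsl.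
      by rewrite ltNge az.
    near=> z => /andP[_ zb]; have : b < z by near: z; exact: lt_nbhsr.
    by rewrite ltNge zb.
  apply: filterS => z zab; apply/eqP; apply: contraPT zab => wz /(_ (w_supp wz)).
  exact.
by rewrite derive_cst.
Unshelve. all: by end_near. Qed.

Lemma by_parts : \int[leb]_(x in Rpos) (u' x * w x) = - \int[leb]_(x in Rpos) (u x * w' x).
Proof.
(* A larger interval, at whose endpoints [w] vanishes. *)
pose a' := a / 2; pose b' := b + 1.
have a'0 : 0 < a' by rewrite divr_gt0.
have a'a : a' < a by rewrite /a' ltr_pdivrMr// mulr_natr mulr2n ltrDl.
have bb' : b < b' by rewrite /b' ltrDl.
have ab' : a' < b' by exact: lt_trans (lt_le_trans a'a ab) bb'.
have sup x : a <= x <= b -> a' <= x <= b'.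
  by move=> /andP[ax xb]; rewrite !ltW// ?(lt_le_trans a'a)// (le_lt_trans xb).
have w0 x : ~~ (a <= x <= b) -> w x = 0.
  by move=> xab; apply/eqP; apply: contraNT xab; exact: w_supp.
rewrite (@csupp_Rintegral _ a' b')//; last first.
  by move=> x _; rewrite mulf_eq0 negb_or => /andP[_ /w_supp/sup].
have LR (F F' : R -> R) : (forall x, 0 < x -> is_derive x 1 F (F' x)) ->
    derivable_oo_LRcontinuous F a' b'.
  move=> dF; have b'0 : 0 < b' by exact: lt_trans ab'.
  split.
  - move=> x; rewrite in_itv/= => /andP[x1 _].
    by have [] := dF x (lt_trans a'0 x1).
  - by apply: cvg_at_right_filter; exact: is_derive_cont (dF _ a'0).
  - by apply: cvg_at_left_filter; exact: is_derive_cont (dF _ b'0).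
have d1 (F F' : R -> R) : (forall x, 0 < x -> is_derive x 1 F (F' x)) ->
    {in `]a', b'[, derive1 F =1 F'}.
  move=> dF x; rewrite in_itv/= => /andP[x1 _].
  by rewrite derive1E; have [_ ->] := dF x (lt_trans a'0 x1).
have wb x : (x == a') || (x == b') -> w x = 0.
  by move=> h; apply: w0; case/orP: h => /eqP ->; rewrite negb_and -!ltNge ?a'a ?bb' ?orbT.
have := Rintegration_by_parts ab' (csupp_within a'0 cu') (LR _ _ du) (d1 _ _ du)
  (csupp_within a'0 cw') (LR _ _ dw) (d1 _ _ dw).
rewrite !wb ?eqxx ?orbT// !mulr0 subrr sub0r => h.
apply: (@oppr_inj R); rewrite -h opprK.
rewrite (@csupp_Rintegral _ a' b')//.
by move=> x x0; rewrite mulf_eq0 negb_or => /andP[_ /(derive_supp x0)/sup].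
Qed.

End ByParts.

(** Integration by parts against the exponential. *)
Lemma lap_derive (w w' : R -> R) a b l : 0 < a -> a <= b ->
  (forall x, 0 < x -> is_derive x 1 w (w' x)) ->
  (forall x, 0 < x -> {for x, continuous w'}) ->
  (forall x, w x != 0 -> a <= x <= b) ->
  0 < l -> lap leb w' l = l * lap leb w l.
Proof.
move=> a0 ab dw cw' ws l0.
have du x : is_derive x 1 (fun x => expR (- (l * x))) (- l * expR (- (l * x))).
  have := is_derive1_comp (is_derive_expR _) (is_derive_opp (is_derive_scale l (is_derive_id x 1))).
  by move=> h; apply: is_derive_eq h _; rewrite mulr1 mulrC.
have cu x : {for x, continuous (fun x => - l * expR (- (l * x)))}.
  apply: continuousM; first exact: cvg_cst.
  exact: is_derive_cont (du x).
have := by_parts a0 ab (fun x _ => du x) dw (fun x _ => cu x) cw' ws.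
move=> /eqP; rewrite -subr_eq0 opprK => /eqP h.
rewrite /lap; apply/eqP; rewrite -subr_eq0 -[X in _ == X]h addrC; apply/eqP.
congr (_ + _); rewrite -mulNr -RintegralZl//; first last.
- apply: (@csupp_integrable (fun x => expR (- (l * x)) * w x) a b) => //.
    move=> x x0; apply: continuousM; last exact: is_derive_cont (dw x x0).
    exact: is_derive_cont (du x).
  by move=> x _; rewrite mulf_eq0 negb_or => /andP[_ /ws].
- exact: mRpos.
by apply: eq_Rintegral => x _; rewrite mulrA.
Qed.

End TestFunctions.

(** * Hankel operators as products of Laplace transforms *)

Section HankelFactorization.
Context {R : realType}.
Local Notation T := (measurableTypeR R).
Local Notation leb := (@lebesgue_measure R).
Local Notation Rpos := (@Rpos R).
Local Notation L2p m := (L2space m (@mRpos R)).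
Variables (mu : {sigma_finite_measure set T -> \bar R}) (c : R).
Hypotheses (muS : schur mu c)
  (mu_cofinite : (\int[mu]_(l in Rpos) (l ^- 2)%:E < +oo)%E).
Local Notation X := (L2p leb).
Local Notation Y := (L2p mu).
Local Notation L := (Lop muS).
Local Notation Ls := (Lst muS).
Local Notation v := (vinv mu_cofinite).

Lemma LsE (y : Y) t : 0 < t -> Ls y t = lap mu y t.
Proof. by move=> t0; exact: lapopE. Qed.

Lemma LE (f : X) l : 0 < l -> L f l = lap leb f l.
Proof. by move=> l0; exact: lapopE. Qed.

Lemma Ls_dot (y : Y) t (t0 : 0 < t) :
  Ls y t = dot (mkl2 (schur_exp_sqint muS t0) : Y) y.
Proof. by rewrite LsE// dotL2 /lap; apply: eq_Rintegral. Qed.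

Lemma Ls_null (y : Y) t : nsq y = 0 -> 0 < t -> Ls y t = 0.
Proof. by move=> y0 t0; rewrite Ls_dot dotC nsq0_dot. Qed.

(** The kernel [h (t + s)] is the pairing of two exponentials over [mu], so that
    the Hankel operator is the Laplace transform followed by its adjoint. *)
Lemma hankel_LsL (f : X) t : 0 < t ->
  \int[leb]_(s in Rpos) (hankel_kernel mu (t + s) * f s) = Ls (L f) t.
Proof.
move=> t0; rewrite Ls_dot -Lst_adj dotL2.
apply: eq_Rintegral => s /set_mem/RposP s0; congr (_ * _).
rewrite LsE// /hankel_kernel /lap; apply: eq_Rintegral => l _.
change (expR (- ((t + s) * l)) = expR (- (s * l)) * expR (- (t * l))).
by rewrite -expRD; congr expR; ring.
Qed.

Lemma exp_integrable t : 0 < t -> mu.-integrable Rpos (fun l => (expR (- (t * l)))%:E).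
Proof.
move=> t0; have t20 : 0 < t / 2 by rewrite divr_gt0.
have eP := schur_exp_sqint muS t20.
have := sqint_mul mRpos eP eP; congr (_.-integrable _ _).
by apply/funext => l /=; rewrite -expRD; congr (expR _)%:E; field.
Qed.

(** Integrating the exponential gives the factor [1 / l]. *)
Lemma hint_Ls t : 0 < t -> hankel_kernel_int mu t = Ls v t.
Proof.
move=> t0; pose D1 : set T := `]t, +oo[%classic.
have mD1 : measurable D1 by exact: measurable_itv.
have D1P x : D1 x -> 0 < x by rewrite /D1/= in_itv/= andbT; exact: lt_trans.
pose k (z : T * T) : \bar R := (expR (- (z.1 * z.2)))%:E.
have mk : measurable_fun (D1 `*` Rpos) k.
  by apply/measurable_EFinP; exact: measurable_exp2.
rewrite /hankel_kernel_int LsE// /lap /Rintegral; congr fine.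
transitivity (\int[leb]_(s in D1) \int[mu]_(l in Rpos) k (s, l))%E.
  apply: eq_integral => s /set_mem/D1P s0.
  by rewrite /hankel_kernel -EFin_Rintegral//; exact: exp_integrable.
rewrite (tonelli_on leb mu mD1 mRpos mk); last by move=> *; rewrite lee_fin expR_ge0.
apply: eq_integral => l /set_mem/RposP l0; rewrite vinvE l0 /k/=.
have -> : (\int[leb]_(x in D1) (expR (- (x * l)))%:E)%E =
    (\int[leb]_(x in D1) ((l^-1)%:E * (l * expR (- (l * x)))%:E))%E.
  by apply: eq_integral => x _; rewrite -EFinM mulKf ?gt_eqF// mulrC.
rewrite ge0_integralZl//; first by rewrite int_exp_tail// -EFinM mulrC (mulrC l).
- by apply/measurable_EFinP/measurable_funM => //; exact: measurable_exp_mul.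
- by move=> x _; rewrite lee_fin mulr_ge0 ?expR_ge0// ltW.
- by rewrite lee_fin invr_ge0 ltW.
Qed.

End HankelFactorization.

(** * Complex-valued square integrable functions *)

Section Complex.
Context {R : realType}.
Local Notation T := (measurableTypeR R).
Local Notation Rpos := (@Rpos R).
Implicit Types m : {measure set T -> \bar R}.

Lemma ReE (z : R[i]) : z = complex.Re z +i* complex.Im z. Proof. by case: z. Qed.

Lemma ReM (z w : R[i]) : complex.Re (z * w) =
  complex.Re z * complex.Re w - complex.Im z * complex.Im w.
Proof. by case: z w => ? ? []. Qed.

Lemma ImM (z w : R[i]) : complex.Im (z * w) =
  complex.Re z * complex.Im w + complex.Im z * complex.Re w.
Proof. by case: z w => ? ? []. Qed.

Lemma normcE2 (a b : R) : normc (a +i* b) ^+ 2 = a ^+ 2 + b ^+ 2.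
Proof. by rewrite /normc sqr_sqrtr// addr_ge0 ?sqr_ge0. Qed.

Lemma L2P m (f : R -> R[i]) : L2 m f <->
  sqint m Rpos (fun t => complex.Re (f t)) /\ sqint m Rpos (fun t => complex.Im (f t)).
Proof.
pose u t := complex.Re (f t); pose w t := complex.Im (f t).
have mu2 (g : R -> R) : measurable_fun (Rpos : set T) g ->
    measurable_fun (Rpos : set T) (fun t => (g t ^+ 2)%:E : \bar R).
  by move=> mg; apply/measurable_EFinP; exact: measurable_funX.
have E : measurable_fun (Rpos : set T) u -> measurable_fun (Rpos : set T) w ->
    (\int[m]_(x in Rpos) (normc (f x) ^+ 2)%:E =
     \int[m]_(x in Rpos) (u x ^+ 2)%:E + \int[m]_(x in Rpos) (w x ^+ 2)%:E)%E.
  move=> mU mW; rewrite -ge0_integralD//; first last.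
  - exact: mu2.
  - by move=> x _; rewrite lee_fin sqr_ge0.
  - exact: mu2.
  - by move=> x _; rewrite lee_fin sqr_ge0.
  - exact: mRpos.
  by apply: eq_integral => x _; rewrite -EFinD [f x]ReE normcE2.
have ge0 (g : R -> R) : (0 <= \int[m]_(x in Rpos) (g x ^+ 2)%:E)%E.
  by apply: integral_ge0 => x _; rewrite lee_fin sqr_ge0.
split => [[mU mW]|[uP wP]].
  rewrite E// => h; split; apply: sqintP => //; apply: le_lt_trans h.
    by rewrite leeDl.
  by rewrite leeDr.
have [mU _] := uP; have [mW _] := wP; split => //.
rewrite E//; apply: lte_add_pinfty.
  have h := sqint_lty (@mRpos R) uP.
  exact: h.
have h := sqint_lty (@mRpos R) wP.
exact: h.
Qed.

(** An equation of functions, and not only of classes: [L2_cplx] shows that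
    every square integrable complex function has this form. *)
Definition cplx m (f1 f2 : L2space m (@mRpos R)) : R -> R[i] := fun t => f1 t +i* f2 t.

End Complex.

(** * The resolvent and the generalized eigenfunctions *)

Section ResolventKernel.
Context {R : realType}.
Local Notation T := (measurableTypeR R).
Local Notation leb := (@lebesgue_measure R).
Local Notation Rpos := (@Rpos R).
Local Notation L2p m := (L2space m (@mRpos R)).
Variables (mu : {sigma_finite_measure set T -> \bar R}) (c : R).
Hypotheses (muS : schur mu c)
  (mu_cofinite : (\int[mu]_(l in Rpos) (l ^- 2)%:E < +oo)%E).
Local Notation X := (L2p leb).
Local Notation Y := (L2p mu).
Local Notation L := (Lop muS).
Local Notation Ls := (Lst muS).
Local Notation G := (Gop muS).
Local Notation A := (Aop muS mu_cofinite).
Local Notation v := (vinv mu_cofinite).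
Variables (s : {finite_measure set T -> \bar R}) (B : R) (B_gt0 : 0 < B).
Local Notation Z := (L2space s (mIoc B)).
Local Notation one := (zpow s (mIoc B) (@Ioc_le R B) 0).
Local Notation M := (mulX (s := s) (mD := mIoc B) B_gt0 (@Ioc_le R B)).
Local Notation S := (stjop (s := s) (mD := mIoc B) (@Ioc_le R B) (@Ioc_gt0 R B)).
Variable Phi : Y -> Z.
Hypothesis Phi_dot : forall y y', dot (Phi y) (Phi y') = dot y y'.
Hypothesis Phi_onto : forall w, exists y, nsq (Phi y - w) = 0.
Hypothesis Phi_v : nsq (Phi v - one) = 0.
Hypothesis Phi_G : forall y, nsq (Phi (G y) - M (Phi y)) = 0.
Hypothesis Phi_A : forall y, nsq (Phi (A y) - S (Phi y)) = 0.
Implicit Types (f : X) (y : Y) (w : Z) (t E : R).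

Lemma Phi_total w : (forall y, dot w (Phi y) = 0) -> nsq w = 0.
Proof.
move=> w0; have [y yw] := Phi_onto w.
by rewrite /nsq -(nsqB0_dot w yw) dotC.
Qed.

Lemma rker_sqint E : 0 < E -> sqint s (Ioc B) (fun x => (x + E)^-1).
Proof.
move=> E0; apply: (@bounded_sqint _ _ _ (mIoc B) _ E^-1).
  apply: (measurable_funS (@mRpos R)) => [x /Ioc_gt0/RposP //|].
  apply: continuous_Rpos_measurable => x x0; apply: continuousV.
    by rewrite gt_eqF// addr_gt0.
  by apply: continuousD => //; exact: cvg_cst.
move=> x /Ioc_gt0 x0; have xE : 0 < x + E by rewrite addr_gt0.
by rewrite ger0_norm ?invr_ge0 ?(ltW xE)// lef_pV2 ?posrE// lerDr ltW.
Qed.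

Definition rker E (E0 : 0 < E) : Z := mkl2 (rker_sqint E0).

Lemma mulX_rker E (E0 : 0 < E) : nsq (M (rker E0) + E *: rker E0 - one) = 0.
Proof.
apply/nsqL20P; apply: aeW => x /Ioc_gt0 x0.
change (x * (x + E)^-1 + E * (x + E)^-1 - x ^+ 0 = 0).
by rewrite -mulrDl expr0 mulfV ?subrr// gt_eqF// addr_gt0.
Qed.

(** [Phi] takes [(G + E)^-1 v] to [1 / (x + E)], because it takes [v] to [1] and
    [G] to the multiplication by [x]. *)
Lemma resolvent_vec E (E0 : 0 < E) y : nsq (Phi y - rker E0) = 0 ->
  nsq (G y + E *: y - v) = 0.
Proof.
move=> yE; suff h y' : dot (G y + E *: y - v) y' = 0 by exact: h.
rewrite !dotE -!(Phi_dot _ y') (nsqB0_dot _ (Phi_G y)) (nsqB0_dot _ Phi_v).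
have My : nsq (M (Phi y) - M (rker E0)) = 0.
  by rewrite -linearB; exact: mulX_null.
rewrite (nsqB0_dot _ My) (nsqB0_dot _ yE).
by have := nsq0_dot (Phi y') (mulX_rker E0); rewrite !dotE.
Qed.

Lemma resolvent_null E (d : X) : 0 < E -> nsq (Ls (L d) + E *: d) = 0 -> nsq d = 0.
Proof.
move=> E0 h0; have := nsq0_dot d h0; rewrite !dotE Lst_adj -!/(nsq _) {h0} => h.
have L0 := nsq_ge0 (L d); have d0 := nsq_ge0 d.
have : E * nsq d <= 0 by lra.
by rewrite pmulr_rle0// => d1; apply/eqP; rewrite eq_le d1.
Qed.

(** The integral of [w x / (x + E)], written with the Stieltjes transform that
    represents [A]. *)
Definition qfun w E : R := (dot w one - stj w E) / E.

Lemma qfunE w E (E0 : 0 < E) : qfun w E = dot (rker E0) w.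
Proof.
rewrite /qfun /stj E0 dot_zpow [RHS]dotL2 -RintegralB; last 3 first.
- exact: mIoc.
- exact: (l2_mul (mIoc B) w one).
- exact: (stj_integrable (@Ioc_le R B)).
rewrite mulrC -RintegralZl; last 2 first.
- exact: mIoc.
- exact: (integrableB (mIoc B) (l2_mul (mIoc B) w one) (stj_integrable (@Ioc_le R B) w E0)).
apply: eq_Rintegral => x /set_mem/Ioc_gt0 x0.
change (E^-1 * (w x * x ^+ 0 - x / (x + E) * w x) = (x + E)^-1 * w x).
move: (w x) => wx; rewrite expr0; field.
by rewrite !gt_eqF// addr_gt0.
Qed.

Lemma qfun_measurable w : measurable_fun (Rpos : set T) (qfun w).
Proof.
apply: continuous_Rpos_measurable => E E0; apply: continuousM.
  apply: continuousB; first exact: cvg_cst.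
  exact: (stj_cont (@Ioc_le R B)).
by apply: continuousV => //; rewrite gt_eqF.
Qed.

(** This is where the Lyapunov equation gives back a vector from the Stieltjes
    transform: [G phi = dot psi v *: v - A psi] becomes, on the spectral side,
    [E * phi E = dot psi 1 - stj psi E]. *)
Lemma qfun_div (psi phi : Y) : (forall l, 0 < l -> phi l = psi l / l) ->
  \forall E \ae s, Ioc B E -> qfun (Phi psi) E = Phi phi E.
Proof.
move=> pp; have : nsq (M (Phi phi) - (dot (Phi psi) one *: one - S (Phi psi))) = 0.
  apply: Phi_total => y.
  rewrite !dotE -(nsqB0_dot _ (Phi_G phi)) -(nsqB0_dot _ Phi_v) -(nsqB0_dot _ (Phi_A psi)).
  rewrite (dotC (Phi psi)) -(nsqB0_dot _ Phi_v) !Phi_dot (Gop_div muS mu_cofinite pp).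
  by rewrite !dotE (dotC v psi) subrr.
move=> /nsqL20P h; apply: ae_imp h => E h DE; have E0 := Ioc_gt0 DE.
have /eqP : E * Phi phi E - (dot (Phi psi) one * E ^+ 0 - stj (Phi psi) E) = 0 := h DE.
rewrite subr_eq0 expr0 mulr1 => /eqP e.
by rewrite /qfun -e mulrC mulKf// gt_eqF.
Qed.

Lemma hankelE (f1 f2 : X) t : 0 < t ->
  hankel mu (cplx f1 f2) t = Ls (L f1) t +i* Ls (L f2) t.
Proof.
move=> t0; rewrite -!hankel_LsL// /hankel /cintegral; congr (_ +i* _);
  apply: eq_Rintegral => x _.
- change (hankel_kernel mu (t + x) * f1 x - 0 * f2 x = hankel_kernel mu (t + x) * f1 x).
  by rewrite mul0r subr0.
- change (hankel_kernel mu (t + x) * f2 x + 0 * f1 x = hankel_kernel mu (t + x) * f2 x).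
  by rewrite mul0r addr0.
Qed.

Lemma hankel_ext (f g : R -> R[i]) t : (forall x, 0 < x -> f x = g x) ->
  hankel mu f t = hankel mu g t.
Proof.
move=> fg; rewrite /hankel /cintegral; congr (_ +i* _);
  by apply: eq_Rintegral => x /set_mem/RposP x0; rewrite fg.
Qed.

Lemma cplx_resolvent E (r i : X) :
  resolvent mu E (fun t => (hankel_kernel_int mu t)%:C) (cplx r i) ->
  nsq (Ls (L r) + E *: r - Ls v) = 0 /\ nsq (Ls (L i) + E *: i) = 0.
Proof.
move=> [_ h]; split; apply/nsqL20P; apply: ae_imp h => t h Rt; have t0 := proj1 (RposP t) Rt.
  have := h Rt; rewrite hankelE// (hint_Ls muS)// => -[e _]; move: e.
  rewrite mul0r subr0 => e.
  by change (Ls (L r) t + E * r t - Ls v t = 0); rewrite e subrr.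
have := h Rt; rewrite hankelE// (hint_Ls muS)// => -[_]; rewrite mul0r addr0 => e.
exact: e.
Qed.

Section Smooth.
Variables (E : R) (E0 : 0 < E).
Local Notation g := (smooth_resolvent_hint mu E).

(** Laplace transforms of square integrable functions are smooth, so that the
    solution [Ls (G + E)^-1 v] is an admissible representative. *)
Lemma resolvent_lap y : nsq (Phi y - rker E0) = 0 ->
  (resolvent mu E (fun t => (hankel_kernel_int mu t)%:C) `&` smooth_on_Rpos)
    (fun t => lap mu y t +i* 0).
Proof.
move=> yE; have yl : lapable mu y by exact: lapable_l2 muS y.
split; last first.
  move=> n t t0; split; first exact: lap_smooth.
  rewrite (_ : derive1n n _ = cst 0); first exact: derivable_cst.
  by elim: n => //= n ->; apply/funext => x; rewrite derive1_cst.
split.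
  apply/L2P; split; last exact: (l2P (0 : X)).
  apply: (sqint_le (@mRpos R) _ (l2P (Ls y))) => [|t /RposP t0].
    exact: lap_measurable.
  by rewrite LsE.
apply: aeW => t /RposP t0.
rewrite (@hankel_ext _ (cplx (Ls y) 0)); last by move=> x x0; rewrite /cplx LsE.
rewrite hankelE// (hint_Ls muS)//.
have h : Ls (G y + E *: y - v) t = 0 by exact: Ls_null (resolvent_vec yE) t0.
have {}h : Ls (L (Ls y)) t + E * lap mu y t = Ls v t.
  apply/eqP; rewrite -subr_eq0 -(LsE muS)// -h; apply/eqP.
  by rewrite linearB linearD linearZ.
rewrite -h linear0 linear0; apply/eqP; rewrite eq_complex/=; apply/andP; split; apply/eqP.
  by rewrite mulr0 subr0.
by rewrite mulr0 mul0r !addr0.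
Qed.

Lemma smooth_resolventP :
  (resolvent mu E (fun t => (hankel_kernel_int mu t)%:C) `&` smooth_on_Rpos) g.
Proof.
have [y yE] := Phi_onto (rker E0).
by apply: xgetPex; exists (fun t => lap mu y t +i* 0); exact: resolvent_lap.
Qed.

Lemma Re_sqint : sqint leb Rpos (fun t => complex.Re (g t)).
Proof. by have [[/L2P[]]] := smooth_resolventP. Qed.

Lemma Im_sqint : sqint leb Rpos (fun t => complex.Im (g t)).
Proof. by have [[/L2P[]]] := smooth_resolventP. Qed.

Definition resRe : X := mkl2 Re_sqint.
Definition resIm : X := mkl2 Im_sqint.

Lemma resolvent_ReIm :
  nsq (Ls (L resRe) + E *: resRe - Ls v) = 0 /\
  nsq (Ls (L resIm) + E *: resIm) = 0.
Proof.
apply: cplx_resolvent; have [+ _] := smooth_resolventP.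
have -> // : g = cplx resRe resIm by apply/funext => t; exact: ReE.
Qed.

(** Two solutions of the resolvent equation differ by a vector on which the
    positive operator [Ls L + E] vanishes. *)
Lemma resolvent_Re y : nsq (Phi y - rker E0) = 0 -> nsq (resRe - Ls y) = 0.
Proof.
move=> yE; apply: (resolvent_null E0); have [h _] := resolvent_ReIm.
suff k z : dot (Ls (L (resRe - Ls y)) + E *: (resRe - Ls y)) z = 0.
  exact: k.
have h1 : dot (Ls (L resRe)) z + E * dot resRe z - dot (Ls v) z = 0.
  by rewrite -(nsq0_dot z h) !dotE.
have h2 : dot (Ls (G y)) z + E * dot (Ls y) z - dot (Ls v) z = 0.
  by rewrite !(Lst_adj muS) -(nsq0_dot (L z) (resolvent_vec yE)) !dotE.
rewrite (_ : Ls (L (resRe - Ls y)) = Ls (L resRe) - Ls (G y)); last by rewrite !linearB.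
rewrite !dotE; move: h1 h2; move: (dot (Ls (L resRe)) z) (dot (Ls (G y)) z) => p q.
move: (dot resRe z) (dot (Ls y) z) (dot (Ls v) z) => p' q' r h1 h2.
by rewrite mulrBr -[RHS](subrr 0) -{1}h1 -h2; ring.
Qed.

Lemma resolvent_Im : nsq resIm = 0.
Proof. by apply: (resolvent_null E0); have [] := resolvent_ReIm. Qed.

Lemma Re_smooth t : 0 < t -> is_derive t 1 (fun t => complex.Re (g t))
  (derive1 (fun t => complex.Re (g t)) t).
Proof.
have [_ gs] := smooth_resolventP => t0; have [d _] := gs 0%N t t0.
exact: derivable_is_derive d.
Qed.

Lemma Im_smooth t : 0 < t -> is_derive t 1 (fun t => complex.Im (g t))
  (derive1 (fun t => complex.Im (g t)) t).
Proof.
have [_ gs] := smooth_resolventP => t0; have [_ d] := gs 0%N t t0.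
exact: derivable_is_derive d.
Qed.

Lemma Re_cont t : 0 < t -> {for t, continuous (derive1 (fun t => complex.Re (g t)))}.
Proof.
have [_ gs] := smooth_resolventP => t0; have [d _] := gs 1%N t t0.
exact: derivable_continuous d.
Qed.

Lemma Im_cont t : 0 < t -> {for t, continuous (derive1 (fun t => complex.Im (g t)))}.
Proof.
have [_ gs] := smooth_resolventP => t0; have [_ d] := gs 1%N t t0.
exact: derivable_continuous d.
Qed.

Section Pairing.
Variables (w w' : R -> R) (a b : R).
Hypotheses (a_gt0 : 0 < a) (ab : a <= b)
  (dw : forall x : R, 0 < x -> is_derive x 1 w (w' x))
  (cw' : forall x, 0 < x -> {for x, continuous w'})
  (w_supp : forall x, w x != 0 -> a <= x <= b)
  (w'P : sqint leb Rpos w').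

(** After integration by parts, the pairing with the derivative of [w] is moved
    to the spectral side. *)
Lemma theta_Re : \int[leb]_(t in Rpos) (complex.Re (theta mu E t) * w t) =
  - qfun (Phi (L (mkl2 w'P))) E.
Proof.
have [y yE] := Phi_onto (rker E0).
rewrite (by_parts a_gt0 ab Re_smooth dw Re_cont cw' w_supp); congr (- _).
rewrite (qfunE _ E0) -(nsqB0_dot _ yE) Phi_dot -Lst_adj -(nsqB0_dot _ (resolvent_Re yE)).
by rewrite dotL2.
Qed.

Lemma theta_Im : \int[leb]_(t in Rpos) (complex.Im (theta mu E t) * w t) = 0.
Proof.
rewrite (by_parts a_gt0 ab Im_smooth dw Im_cont cw' w_supp).
by have := nsq0_dot (mkl2 w'P : X) resolvent_Im; rewrite dotL2 => ->; rewrite oppr0.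
Qed.

Lemma theta_integrable :
  leb.-integrable Rpos (EFin \o (fun t => complex.Re (theta mu E t) * w t)) /\
  leb.-integrable Rpos (EFin \o (fun t => complex.Im (theta mu E t) * w t)).
Proof.
by split; apply: (@csupp_integrable _ _ a b) => //;
  [move=> x x0; apply: continuousM; [exact: Re_cont|exact: is_derive_cont (dw x0)]
  |move=> x _; rewrite mulf_eq0 negb_or => /andP[_ /w_supp]
  |move=> x x0; apply: continuousM; [exact: Im_cont|exact: is_derive_cont (dw x0)]
  |move=> x _; rewrite mulf_eq0 negb_or => /andP[_ /w_supp]].
Qed.

End Pairing.

End Smooth.

Section TestFunction.
Variable f : R -> R[i].
Hypothesis f_test : test_function f.

Lemma test_supp : exists a b, [/\ 0 < a, a <= b,
  (forall x, complex.Re (f x) != 0 -> a <= x <= b) &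
  (forall x, complex.Im (f x) != 0 -> a <= x <= b)].
Proof.
have [_ cf fR] := f_test; have [a [b [a0 ab abP]]] := compact_Rpos cf fR.
exists a, b; split => // x fx; apply: abP; apply: subset_closure => /=;
  by apply: contraNneq fx => ->.
Qed.

Lemma test_derive t : 0 < t ->
  (is_derive t 1 (fun t => complex.Re (f t)) (derive1 (fun t => complex.Re (f t)) t) /\
   is_derive t 1 (fun t => complex.Im (f t)) (derive1 (fun t => complex.Im (f t)) t)) /\
  ({for t, continuous (derive1 (fun t => complex.Re (f t)))} /\
   {for t, continuous (derive1 (fun t => complex.Im (f t)))}).
Proof.
have [fs _ _] := f_test => t0; have [d1 d2] := fs 0%N t t0; have [e1 e2] := fs 1%N t t0.
split; split.
- exact: derivable_is_derive d1.
- exact: derivable_is_derive d2.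
- exact: derivable_continuous e1.
- exact: derivable_continuous e2.
Qed.

(** On test functions the transform is the weighted [Phi \o L], given by
    functions that are defined for each [E] and not only almost everywhere. *)
Lemma Theta_test : exists (f1 f2 : X) (q1 q2 : R -> R),
  [/\ f = cplx f1 f2,
      measurable_fun (Rpos : set T) q1 /\ measurable_fun (Rpos : set T) q2,
      forall E, 0 < E -> Theta mu f E = (Num.sqrt E)^-1 * q1 E +i* ((Num.sqrt E)^-1 * q2 E) &
      (\forall E \ae s, Ioc B E -> q1 E = Phi (L f1) E) /\
      (\forall E \ae s, Ioc B E -> q2 E = Phi (L f2) E)].
Proof.
have [a [b [a0 ab s1 s2]]] := test_supp.
pose w1 t := complex.Re (f t); pose w2 t := complex.Im (f t).
have d1 t (t0 : 0 < t) := (test_derive t0).1.1.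
have d2 t (t0 : 0 < t) := (test_derive t0).1.2.
have c1 t (t0 : 0 < t) := (test_derive t0).2.1.
have c2 t (t0 : 0 < t) := (test_derive t0).2.2.
have P1 : sqint leb Rpos w1.
  by apply: (csupp_sqint a0 _ (fun x _ => s1 x)) => x x0; exact: is_derive_cont (d1 x x0).
have P2 : sqint leb Rpos w2.
  by apply: (csupp_sqint a0 _ (fun x _ => s2 x)) => x x0; exact: is_derive_cont (d2 x x0).
have D1 : sqint leb Rpos (derive1 w1).
  by apply: (csupp_sqint a0 c1) => x x0; exact: (derive_supp d1 s1).
have D2 : sqint leb Rpos (derive1 w2).
  by apply: (csupp_sqint a0 c2) => x x0; exact: (derive_supp d2 s2).
have qE (w : R -> R) (wP : sqint leb Rpos w) (D : sqint leb Rpos (derive1 w)) :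
    (forall x : R, 0 < x -> is_derive x 1 w (derive1 w x)) ->
    (forall x : R, 0 < x -> {for x, continuous (derive1 w)}) ->
    (forall x, w x != 0 -> a <= x <= b) ->
    \forall E \ae s, Ioc B E -> qfun (Phi (L (mkl2 D))) E = Phi (L (mkl2 wP)) E.
  move=> dw cw ws; apply: qfun_div => l l0.
  by rewrite !LE// (lap_derive a0 ab dw cw ws l0) mulrAC mulfV ?mul1r// gt_eqF.
exists (mkl2 P1), (mkl2 P2), (qfun (Phi (L (mkl2 D1)))), (qfun (Phi (L (mkl2 D2)))).
split.
- by apply/funext => t; exact: ReE.
- by split; exact: qfun_measurable.
- move=> E E0.
  have t11 := theta_Re E0 a0 ab d1 c1 s1 D1; have t12 := theta_Re E0 a0 ab d2 c2 s2 D2.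
  have t21 := theta_Im E0 a0 ab d1 c1 s1 D1; have t22 := theta_Im E0 a0 ab d2 c2 s2 D2.
  have [i11 i21] := theta_integrable E0 a0 d1 s1.
  have [i12 i22] := theta_integrable E0 a0 d2 s2.
  rewrite /Theta (_ : cintegral leb (fun t => theta mu E t * f t) =
      - qfun (Phi (L (mkl2 D1))) E +i* - qfun (Phi (L (mkl2 D2))) E); last first.
    rewrite -t11 -t12 /cintegral; congr (_ +i* _).
      rewrite -[RHS]subr0 -[X in _ = _ - X]t22 -RintegralB//; last exact: mRpos.
      by apply: eq_Rintegral => x _; rewrite ReM.
    rewrite -[RHS]addr0 -[X in _ = _ + X]t21 -RintegralD//; last exact: mRpos.
    by apply: eq_Rintegral => x _; rewrite ImM.
  move: (qfun (Phi (L (mkl2 D1))) E) (qfun (Phi (L (mkl2 D2))) E) => p q.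
  by apply/eqP; rewrite eq_complex/=; apply/andP; split; apply/eqP; ring.
- by split; apply: qE.
Qed.

End TestFunction.

End ResolventKernel.

(** * Complexification *)

Section ComplexL2.
Context {R : realType}.
Local Notation T := (measurableTypeR R).
Local Notation Rpos := (@Rpos R).
Variable m : {measure set T -> \bar R}.
Local Notation Xm := (L2space m (@mRpos R)).
Implicit Types (f g : R -> R[i]) (x y : Xm) (a : R).

Lemma cplx_L2 x y : L2 m (cplx x y).
Proof. by apply/L2P; split; [exact: (l2P x)|exact: (l2P y)]. Qed.

Lemma L2_cplx f : L2 m f -> exists x y : Xm, f = cplx x y.
Proof.
move=> /L2P[f1 f2]; exists (mkl2 f1), (mkl2 f2).
by apply/funext => t; exact: ReE.
Qed.

Lemma L2norm_ext f g : (forall t, 0 < t -> f t = g t) -> L2norm m f = L2norm m g.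
Proof.
move=> fg; congr Num.sqrt; apply: eq_Rintegral => t /set_mem/RposP t0.
by rewrite fg.
Qed.

Lemma L2_ext f g : (forall t, 0 < t -> f t = g t) -> L2 m f -> L2 m g.
Proof.
move=> fg /L2P[f1 f2]; apply/L2P; split.
  apply: (sqint_le (@mRpos R) _ f1) => [|t /RposP t0]; last by rewrite fg.
  by case: f1 => + _; apply: eq_measurable_fun => t /set_mem/RposP t0; rewrite fg.
apply: (sqint_le (@mRpos R) _ f2) => [|t /RposP t0]; last by rewrite fg.
by case: f2 => + _; apply: eq_measurable_fun => t /set_mem/RposP t0; rewrite fg.
Qed.

Lemma cplx_int x y :
  (\int[m]_(t in Rpos) (normc (cplx x y t) ^+ 2)%:E)%E = (nsq x + nsq y)%:E.
Proof.
rewrite EFinD !nsqL2 -ge0_integralD; last 5 first.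
- exact: mRpos.
- by move=> t _; rewrite lee_fin sqr_ge0.
- by apply/measurable_EFinP; apply: measurable_funX; exact: l2_meas.
- by move=> t _; rewrite lee_fin sqr_ge0.
- by apply/measurable_EFinP; apply: measurable_funX; exact: l2_meas.
by apply: eq_integral => t _; rewrite normcE2.
Qed.

Lemma cplx_norm x y : L2norm m (cplx x y) = Num.sqrt (nsq x + nsq y).
Proof. by rewrite /L2norm /Rintegral cplx_int. Qed.

Lemma cplx_inner x y x' y' : L2inner m (cplx x y) (cplx x' y') =
  (dot x x' + dot y y') +i* (dot y x' - dot x y').
Proof.
rewrite /L2inner /cintegral !dotL2 -RintegralD; last 3 first.
- exact: mRpos.
- exact: (l2_mul (@mRpos R) x x').
- exact: (l2_mul (@mRpos R) y y').
rewrite -RintegralB; last 3 first.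
- exact: mRpos.
- exact: (l2_mul (@mRpos R) y x').
- exact: (l2_mul (@mRpos R) x y').
by congr (_ +i* _); apply: eq_Rintegral => t _; rewrite /cplx ?ReM ?ImM /=; ring.
Qed.

Lemma cplx_ae x y x' y' : cplx x y = cplx x' y' %[ae m in Rpos] <->
  nsq (x - x') = 0 /\ nsq (y - y') = 0.
Proof.
split => [h|[/nsqL20P h1 /nsqL20P h2]].
  by split; apply/nsqL20P; apply: ae_imp h => t h /h [e1 e2];
    [change (x t - x' t = 0); rewrite e1 subrr|change (y t - y' t = 0); rewrite e2 subrr].
apply: ae_imp (ae_and h1 h2) => t [{}h1 {}h2] Rt.
have /eqP : x t - x' t = 0 := h1 Rt; have /eqP : y t - y' t = 0 := h2 Rt.
by rewrite !subr_eq0 /cplx => /eqP -> /eqP ->.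
Qed.

Lemma cplxB x y x' y' :
  (fun t => cplx x y t - cplx x' y' t) = cplx (x - x') (y - y').
Proof. by []. Qed.

Lemma cplxDZ (a : R[i]) x y x' y' :
  (fun t => a * cplx x y t + cplx x' y' t) =
  cplx (complex.Re a *: x + (- complex.Im a *: y + x'))
       (complex.Re a *: y + (complex.Im a *: x + y')).
Proof.
apply/funext => t; case: a => a b; rewrite /cplx.
change ((a * x t - b * y t + x' t) +i* (a * y t + b * x t + y' t) =
  (a * x t + (- b * y t + x' t)) +i* (a * y t + (b * x t + y' t))).
by congr (_ +i* _); ring.
Qed.

End ComplexL2.

Section Complexification.
Context {R : realType}.
Local Notation T := (measurableTypeR R).
Local Notation leb := (@lebesgue_measure R).
Local Notation Rpos := (@Rpos R).
Variable s : {measure set T -> \bar R}.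
Local Notation X := (L2space leb (@mRpos R)).
Local Notation Z := (L2space s (@mRpos R)).
Variables (K : {linear X -> X}) (U : X -> Z) (H : (R -> R[i]) -> R -> R[i]).
Hypotheses (K_sym : forall x x', dot (K x) x' = dot x (K x'))
  (H_cplx : forall (x y : X) (t : R), 0 < t -> H (cplx x y) t = cplx (K x) (K y) t)
  (U_DZ : forall a x x', nsq (U (a *: x + x') - (a *: U x + U x')) = 0)
  (U_le : forall x, nsq (U x) <= nsq x)
  (U_null : forall x, nsq (U x) = 0 <-> nsq (K x) = 0)
  (U_K : forall x, \forall E \ae s, Rpos E -> U (K x) E = E * U x E)
  (U_onto : forall g : Z, exists p : X, [/\ nsq (U p - g) = 0, nsq p = nsq g &
     forall e : R, 0 < e -> exists k, nsq (p - K k) < e]).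
Implicit Types (x y p q : X) (z : Z) (f g : R -> R[i]).

Lemma U_B x x' : nsq (U (x - x') - (U x - U x')) = 0.
Proof. by have := U_DZ (-1) x' x; rewrite !scaleN1r ![- _ + _]addrC. Qed.

Lemma U_ext x x' : nsq (x - x') = 0 -> nsq (U x - U x') = 0.
Proof.
move=> h; have h1 : nsq (U (x - x')) = 0.
  by apply/eqP; rewrite eq_le nsq_ge0 andbT -h U_le.
by rewrite -(nsqB0 (U_B x x')) h1.
Qed.

Let clo x := forall e : R, 0 < e -> exists k, nsq (x - K k) < e.

Lemma null_clo x q : nsq (K x) = 0 -> clo q -> dot x q = 0.
Proof.
move=> Kx cq; apply/eqP; rewrite -sqrf_eq0 eq_le sqr_ge0 andbT.
apply: (@eps_le0 _ _ (nsq x)) => e /cq[k qk].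
have -> : dot x q = dot x (q - K k) by rewrite dotBr -K_sym (nsq0_dot _ Kx) subr0.
by apply: le_trans (cauchy_schwarz _ _) _; rewrite ler_wpM2l ?nsq_ge0// ltW.
Qed.

(** The vector [p] with the same image as [x] and with the norm of that image is
    the projection of [x] on the closure of the range. *)
Lemma U_proj x : exists p, [/\ nsq (U p - U x) = 0, nsq p = nsq (U x), clo p,
  nsq (U (x - p)) = 0 & forall q, clo q -> dot (x - p) q = 0].
Proof.
have [p [p1 p2 p3]] := U_onto (U x); exists p.
have xp : nsq (U (x - p)) = 0 by rewrite (nsqB0 (U_B x p)) -nsqBC.
by split => // q; apply: null_clo; apply/U_null.
Qed.

(** The transform is defined on all functions, so that a default value is taken
    when the argument is not square integrable. *)
Definition toL2 (u : R -> R) : X :=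
  if pselect (sqint leb Rpos u) is left uP then mkl2 uP else 0.

Definition Tc f : R -> R[i] :=
  cplx (U (toL2 (fun t => complex.Re (f t)))) (U (toL2 (fun t => complex.Im (f t)))).

Lemma toL2E x : toL2 x = x.
Proof.
rewrite /toL2; case: pselect => [h|[]]; last exact: (l2P x).
by apply/val_inj.
Qed.

Lemma Tc_cplx x y : Tc (cplx x y) = cplx (U x) (U y).
Proof. by rewrite /Tc /cplx/= !toL2E. Qed.

Lemma H_L2 x y : L2 leb (H (cplx x y)).
Proof.
by apply: L2_ext (cplx_L2 (K x) (K y)) => t t0; rewrite H_cplx.
Qed.

Lemma Tc_ext f g : L2 leb f -> L2 leb g -> f = g %[ae leb in Rpos] ->
  Tc f = Tc g %[ae s in Rpos].
Proof.
move=> /L2_cplx[x [y ->]] /L2_cplx[x' [y' ->]] /cplx_ae[h1 h2].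
by rewrite !Tc_cplx; apply/cplx_ae; split; exact: U_ext.
Qed.

Lemma U_comb a b x y x' :
  nsq (U (a *: x + (b *: y + x')) - (a *: U x + (b *: U y + U x'))) = 0.
Proof.
have h := U_DZ a x (b *: y + x'); have k := U_DZ b y x'.
rewrite -(subrKA (a *: U x + U (b *: y + x'))) nsqD0//.
by rewrite opprD addrACA subrr add0r.
Qed.

Lemma kernel_cplx x y : L2kernel leb s Tc (cplx x y) <-> nsq (U x) = 0 /\ nsq (U y) = 0.
Proof.
split => [[_ h]|h].
  have /cplx_ae : cplx (U x) (U y) = cplx (0 : Z) (0 : Z) %[ae s in Rpos].
    by rewrite -Tc_cplx; exact: h.
  by rewrite !subr0.
have : cplx (U x) (U y) = cplx (0 : Z) (0 : Z) %[ae s in Rpos].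
  by apply/cplx_ae; rewrite !subr0.
by rewrite -Tc_cplx => k; split; [exact: cplx_L2|exact: k].
Qed.

Lemma Tc_partial_isometry : partial_isometry leb s Tc.
Proof.
split; first split.
- by move=> f /L2_cplx[x [y ->]]; rewrite Tc_cplx; exact: cplx_L2.
- exact: Tc_ext.
- move=> a f g /L2_cplx[x [y ->]] /L2_cplx[x' [y' ->]].
  rewrite (cplxDZ a x y x' y') !Tc_cplx.
  have /cplx_ae := conj (U_comb (complex.Re a) (- complex.Im a) x y x')
    (U_comb (complex.Re a) (complex.Im a) y x y').
  by rewrite -cplxDZ.
- exists 1 => f /L2_cplx[x [y ->]]; rewrite Tc_cplx !cplx_norm mul1r.
  by rewrite ler_wsqrtr// lerD.
- move=> f /L2_cplx[x [y ->]]; rewrite Tc_cplx !cplx_norm => fN.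
  have [p [_ p2 cp p4 p5]] := U_proj x; have [q [_ q2 cq q4 q5]] := U_proj y.
  have /fN k : L2kernel leb s Tc (cplx (x - p) (y - q)) by exact/kernel_cplx.
  have h : dot x (x - p) + dot y (y - q) = 0.
    by move: k; rewrite cplx_inner => -[+ _].
  congr Num.sqrt; rewrite (pythagoras (p5 _ cp)) (pythagoras (q5 _ cq)) -p2 -q2.
  rewrite (perp_nsq (p5 _ cp)) (perp_nsq (q5 _ cq)) in h.
  have h1 := nsq_ge0 (x - p); have h2 := nsq_ge0 (y - q).
  move: h h1 h2; move: (nsq (x - p)) (nsq (y - q)) (nsq p) (nsq q) => *; lra.
Qed.

Lemma Tc_onto : L2onto leb s Tc.
Proof.
move=> g /L2_cplx[z1 [z2 ->]].
have [p [p1 _ _]] := U_onto z1; have [q [q1 _ _]] := U_onto z2.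
by exists (cplx p q); [exact: cplx_L2|rewrite Tc_cplx; exact/cplx_ae].
Qed.

Lemma Tc_kernel : L2kernel leb s Tc = L2kernel leb leb H.
Proof.
have z0 : (fun=> 0) = cplx (0 : X) (0 : X) :> (R -> R[i]) by [].
have HK x y : H (cplx x y) = (fun=> 0) %[ae leb in Rpos] <-> nsq (K x) = 0 /\ nsq (K y) = 0.
  rewrite -[X in X /\ _]/(nsq (K x) = 0); split => h.
    have : cplx (K x) (K y) = cplx (0 : X) (0 : X) %[ae leb in Rpos].
      apply: ae_imp h => t h Rt; rewrite -H_cplx; first exact: h.
      exact/RposP.
    by move=> /cplx_ae; rewrite !subr0.
  have : cplx (K x) (K y) = cplx (0 : X) (0 : X) %[ae leb in Rpos].
    by apply/cplx_ae; rewrite !subr0.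
  apply: ae_imp => t k Rt; rewrite H_cplx; first exact: k.
  exact/RposP.
apply/seteqP; split => f; move=> /[dup] -[/L2_cplx[x [y ->]] _].
  move=> /kernel_cplx[/U_null h1 /U_null h2].
  by split; [exact: cplx_L2|exact/HK].
by move=> [_ /HK[/U_null h1 /U_null h2]]; exact/kernel_cplx.
Qed.

Lemma Tc_intertwine f : L2 leb f -> Tc (H f) = (fun E => E%:C * Tc f E) %[ae s in Rpos].
Proof.
move=> /L2_cplx[x [y ->]].
have h : Tc (H (cplx x y)) = cplx (U (K x)) (U (K y)) %[ae s in Rpos].
  rewrite -Tc_cplx; apply: Tc_ext; [exact: H_L2|exact: cplx_L2|].
  by apply: aeW => t /RposP t0; rewrite H_cplx.
apply: ae_imp (ae_and h (ae_and (U_K x) (U_K y))) => E [{}h [h1 h2]] RE.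
rewrite h// Tc_cplx /cplx h1// h2//; apply/eqP; rewrite eq_complex/=.
by apply/andP; split; apply/eqP; ring.
Qed.

Lemma closure_cplx x y : L2closure leb (L2range leb H) (cplx x y) <-> clo x /\ clo y.
Proof.
have dist x' y' : L2norm leb (fun t => cplx x y t - H (cplx x' y') t) =
    Num.sqrt (nsq (x - K x') + nsq (y - K y')).
  rewrite -cplx_norm -cplxB; apply: L2norm_ext => t t0.
  by rewrite H_cplx.
split => [[_ h]|[cx cy]].
  have k e : 0 < e -> exists x' y', nsq (x - K x') + nsq (y - K y') < e.
    move=> e0; have se : 0 < Num.sqrt e by rewrite sqrtr_gt0.
    have [_ [f /L2_cplx[x' [y' ->]] <-]] := h _ se.
    rewrite dist ltr_sqrt// => xy.
    by exists x', y'.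
  split => e /k[x' [y' xy]]; [exists x'|exists y']; apply: le_lt_trans xy.
    by rewrite lerDl nsq_ge0.
  by rewrite lerDr nsq_ge0.
split; first exact: cplx_L2.
move=> e e0; have e2 : 0 < e ^+ 2 / 2 by rewrite divr_gt0 ?exprn_gt0.
have [x' xx] := cx _ e2; have [y' yy] := cy _ e2.
exists (H (cplx x' y')); first by exists (cplx x' y') => //; exact: cplx_L2.
rewrite dist -[X in _ < X](ger0_norm (ltW e0)) -sqrtr_sqr ltr_sqrt ?exprn_gt0//.
by rewrite [X in _ < X]splitr ltrD.
Qed.

(** Any element [p'] of the closure with the defining property of the projection
    has the norm of [p]: orthogonality gives [dot p p' = nsq p'] and
    [dot p' p = nsq p], for the sums over the two components. *)
Lemma proj_norm x y :
  L2norm leb (L2proj_closure leb (L2range leb H) (cplx x y)) =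
  Num.sqrt (nsq (U x) + nsq (U y)).
Proof.
have [p [_ p2 cp _ p5]] := U_proj x; have [q [_ q2 cq _ q5]] := U_proj y.
rewrite /L2proj_closure; set S := [set _ | _].
have Spq : S (cplx p q).
  split; first exact/closure_cplx.
  move=> g /[dup] -[/L2_cplx[p' [q' ->]] _] /closure_cplx[cp' cq'].
  by rewrite cplxB cplx_inner !p5// !q5// addr0 subr0.
have : S (xget (fun=> 0) S) by apply: xgetPex; exists (cplx p q).
move: (xget _ S) => _ [/[dup] -[/L2_cplx[p' [q' ->]] _] /[dup] cpq' /closure_cplx[cp' cq'] h].
rewrite cplx_norm; congr Num.sqrt.
have e1 : dot (x - p') p' + dot (y - q') q' = 0.
  by have := h _ cpq'; rewrite cplxB cplx_inner => -[+ _].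
have e2 : dot (x - p') p + dot (y - q') q = 0.
  by have := h (cplx p q) Spq.1; rewrite cplxB cplx_inner => -[+ _].
have := p5 _ cp; have := p5 _ cp'; have := q5 _ cq; have := q5 _ cq'.
move: e1 e2; rewrite !dotBl -p2 -q2 -!/(nsq _) (dotC p' p) (dotC q' q).
move: (dot x p) (dot x p') (dot p p') (nsq p) (nsq p').
move: (dot y q) (dot y q') (dot q q') (nsq q) (nsq q') => *; lra.
Qed.

End Complexification.

(** * The spectral measure on the half-line *)

Section Extension.
Context {R : realType}.
Local Notation T := (measurableTypeR R).
Local Notation Rpos := (@Rpos R).
Variables (s : {finite_measure set T -> \bar R}) (B : R).
Hypothesis s_Ioc : s (~` Ioc B) = 0%E.
Local Notation Z := (L2space s (mIoc B)).
Local Notation Zp := (L2space s (@mRpos R)).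
Implicit Types (w : Z) (z : Zp) (E : R).

Lemma s_carried : carried_by_Rpos s.
Proof.
apply: (@subset_measure0 _ _ _ s _ (~` Ioc B)) => //.
- by apply: measurableC; exact: mRpos.
- by apply: measurableC; exact: mIoc.
- by apply: subsetC => x /Ioc_gt0/RposP.
Qed.

Lemma ae_Ioc (P : R -> Prop) : {ae s, forall E, Ioc B E -> P E} -> {ae s, forall E, P E}.
Proof.
move=> h; have k : {ae s, forall E, Ioc B E}.
  by exists (~` Ioc B); split => //; apply: measurableC; exact: mIoc.
by apply: ae_imp (ae_and h k) => E [PE DE]; exact: PE.
Qed.

Lemma patch_Rpos (V : pointedType) (F : R -> V) : F \_ (Ioc B) \_ Rpos = F \_ (Ioc B).
Proof.
apply/funext => E; rewrite !patchE; case: ifPn => // ER.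
case: ifPn => // /set_mem/Ioc_gt0 E0.
by case/negP: ER; apply/mem_set/RposP.
Qed.

Definition extfun w E : R := if (0 < E) && (E <= B) then w E else 0.

Lemma extfunE w : extfun w = w \_ (Ioc B).
Proof.
apply/funext => E; rewrite patchE /extfun; case: ifPn => [h|h].
  by rewrite mem_set//; exact/IocP.
by rewrite memNset// => /IocP; exact/negP.
Qed.

Lemma patch_mul (f g : R -> R) (D : set R) :
  (fun x => (f \_ D) x * (g \_ D) x) = (fun x => f x * g x) \_ D.
Proof.
apply/funext => x; rewrite !patchE; case: ifPn => // _.
exact: mulr0.
Qed.

Lemma patch_EFin (f : R -> R) (D : set R) : EFin \o (f \_ D) = (EFin \o f) \_ D.
Proof. by apply/funext => x; rewrite /= !patchE; case: ifPn. Qed.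

Lemma ext_sqint w : sqint s Rpos (extfun w).
Proof.
split.
  rewrite extfunE; apply/measurable_restrict; [exact: mIoc|exact: mRpos|].
  by apply: measurable_funS (l2_meas w); [exact: mIoc|exact: subIsetr].
rewrite (_ : _ \o _ = (EFin \o (fun x => w x * w x)) \_ (Ioc B)).
  apply/(integrable_mkcond _ (@mRpos R)); rewrite patch_Rpos.
  by apply/(integrable_mkcond _ (mIoc B)); exact: (l2_mul (mIoc B) w w).
rewrite -patch_EFin -patch_mul -extfunE; apply/funext => x /=.
by rewrite expr2.
Qed.

Definition ext w : Zp := mkl2 (ext_sqint w).

Lemma extE w E : ext w E = if (0 < E) && (E <= B) then w E else 0. Proof. by []. Qed.

Lemma ext_Ioc w E : Ioc B E -> ext w E = w E.
Proof. by move=> /IocP DE; rewrite extE DE. Qed.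

Lemma dot_ext w w' : dot (ext w) (ext w') = dot w w'.
Proof.
have e : (fun x => w x * w' x) \_ (Ioc B) = (fun x => extfun w x * extfun w' x) \_ Rpos.
  by rewrite !extfunE patch_mul patch_Rpos.
by rewrite [RHS]dotL2 Rintegral_mkcond e -Rintegral_mkcond dotL2.
Qed.

Lemma nsq_ext w : nsq (ext w) = nsq w. Proof. exact: dot_ext. Qed.

Lemma ext_linear : linear ext.
Proof.
move=> a w w'; apply/val_inj/funext => E.
change (extfun (a *: w + w') E = a * extfun w E + extfun w' E).
by rewrite /extfun; case: ifP => // _; rewrite mulr0 addr0.
Qed.

HB.instance Definition _ := GRing.isLinear.Build R Z Zp _ ext ext_linear.

Lemma extB w w' : ext (w - w') = ext w - ext w'. Proof. exact: linearB. Qed.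

Lemma res_sqint z : sqint s (Ioc B) z.
Proof.
have [mz iz] := l2P z; have BR : Ioc B `<=` Rpos by move=> x /Ioc_gt0/RposP.
split; first by apply: measurable_funS mz => //; exact: mRpos.
by apply: integrableS iz => //; [exact: mRpos|exact: mIoc].
Qed.

Definition res z : Z := mkl2 (res_sqint z).

Lemma ext_res z : nsq (ext (res z) - z) = 0.
Proof.
apply/nsqL20P; apply: ae_Ioc; apply: aeW => E DE _.
change (ext (res z) E - z E = 0); rewrite ext_Ioc//.
exact: subrr.
Qed.

Lemma sqint_ae (F : R -> R) z : measurable_fun (Rpos : set T) F ->
  {ae s, forall E, Rpos E -> F E = z E} -> sqint s Rpos F.
Proof.
move=> mF Fz; apply: sqintP => //.
rewrite (@ge0_ae_eq_integral _ _ _ s _ _ (fun E => (z E ^+ 2)%:E)).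
- exact: (sqint_lty (@mRpos R) (l2P z)).
- exact: mRpos.
- by apply/measurable_EFinP; exact: measurable_funX.
- by apply/measurable_EFinP; apply: measurable_funX; exact: l2_meas.
- by move=> E _; rewrite lee_fin sqr_ge0.
- by move=> E _; rewrite lee_fin sqr_ge0.
by apply: ae_imp Fz => E h RE; rewrite h.
Qed.

End Extension.

(** * The spectral transform of the Hankel operator *)

Section Assembly.
Context {R : realType}.
Local Notation T := (measurableTypeR R).
Local Notation leb := (@lebesgue_measure R).
Local Notation Rpos := (@Rpos R).
Local Notation L2p m := (L2space m (@mRpos R)).
Variables (mu : {sigma_finite_measure set T -> \bar R}) (c : R).
Hypothesis muS : schur mu c.
Local Notation X := (L2p leb).
Definition hankel_op : {linear X -> X} := Lst muS \o Lop muS.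
Local Notation K := hankel_op.

Lemma hankel_sym x x' : dot (K x) x' = dot x (K x').
Proof.
change (dot (Lst muS (Lop muS x)) x' = dot x (Lst muS (Lop muS x'))).
by rewrite Lst_adj -Lop_adj.
Qed.

Hypothesis mu_cofinite : (\int[mu]_(l in Rpos) (l ^- 2)%:E < +oo)%E.

Lemma spectral_transform : exists (s : {finite_measure set T -> \bar R})
  (U : X -> L2p s), carried_by_Rpos s /\
  [/\ (forall a x x', nsq (U (a *: x + x') - (a *: U x + U x')) = 0) /\
      (forall x, nsq (U x) <= nsq x),
      forall x, nsq (U x) = 0 <-> nsq (K x) = 0,
      forall x, {ae s, forall E, Rpos E -> U (K x) E = E * U x E},
      forall g, exists p, [/\ nsq (U p - g) = 0, nsq p = nsq g &
        forall e : R, 0 < e -> exists k, nsq (p - K k) < e] &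
      forall f, test_function f -> exists (x y : X) (z1 z2 : L2p s),
        [/\ f = cplx x y, forall E, 0 < E -> Theta mu f E = cplx z1 z2 E,
            nsq (z1 - U x) = 0 & nsq (z2 - U y) = 0]].
Proof.
have [s [Phi [s0 Phi_dot Phi_onto Phi_v [Phi_G Phi_A]]]] :=
  representation (Gop_sym muS) (Bnd_gt0 muS) (Gop_le muS) (@Gop_inj _ _ _ muS)
    (sqr_ge0 (nsq (vinv mu_cofinite))) (Aop_le muS mu_cofinite)
    (@Aop_inj _ _ _ muS mu_cofinite) (lyapunov_Gop muS mu_cofinite).
have Phi_mulX y : nsq (Phi (Lop muS (Lst muS y)) -
    mulX (Bnd_gt0 muS) (@Ioc_le R (Bnd c)) (Phi y)) = 0 by exact: Phi_G.
pose V := Top (Lop_adj muS) Phi_dot Phi_onto Phi_mulX.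
exists s, (fun x => ext (V x)); split; first exact: s_carried s0.
split; first split.
- move=> a x x'; rewrite -linearP -linearB nsq_ext; exact: Top_DZ.
- by move=> x; rewrite nsq_ext; exact: nsq_Top_le.
- by move=> x; rewrite nsq_ext; exact: Top_null.
- move=> x; have /nsqL20P h := Top_LsL (Lop_adj muS) Phi_dot Phi_onto Phi_mulX x.
  apply: (ae_Ioc s0); apply: ae_imp h => E h DE _; rewrite !ext_Ioc//.
  by apply/eqP; rewrite -subr_eq0; apply/eqP; exact: h DE.
- move=> g; have [p [p1 p2 p3]] := Top_onto (Lop_adj muS) Phi_dot Phi_onto Phi_mulX (res (Bnd c) g).
  exists p; split => //.
    have h : nsq (ext (V p) - ext (res (Bnd c) g)) = 0 by rewrite -extB nsq_ext.
    by rewrite -(subrKA (ext (res (Bnd c) g))) nsqD0// (ext_res s0).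
  rewrite p2 -(nsq_ext (res (Bnd c) g)); exact: nsqB0 (ext_res s0 g).
- move=> f ft.
  have [x [y [q1 [q2 [fE [m1 m2] TE [e1 e2]]]]]] :=
    Theta_test Phi_dot Phi_onto Phi_v Phi_G Phi_A ft.
  pose u (q : R -> R) (E : R) := (Num.sqrt E)^-1 * q E.
  have mu' (q : R -> R) : measurable_fun (Rpos : set T) q -> measurable_fun (Rpos : set T) (u q).
    by move=> mq; apply: measurable_funM => //; exact: measurable_sqrtV.
  have uE (q : R -> R) (a : X) : {ae s, forall E, Ioc (Bnd c) E -> q E = Phi (Lop muS a) E} ->
      {ae s, forall E, Rpos E -> u q E = ext (V a) E}.
    move=> h; apply: (ae_Ioc s0); apply: ae_imp h => E h DE _.
    by rewrite ext_Ioc// /u h.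
  have P1 := sqint_ae (mu' _ m1) (uE _ _ e1).
  have P2 := sqint_ae (mu' _ m2) (uE _ _ e2).
  exists x, y, (mkl2 P1), (mkl2 P2); split => //.
    apply/nsqL20P; apply: ae_imp (uE _ _ e1) => E h RE.
    by change (u q1 E - ext (V x) E = 0); rewrite h// subrr.
  apply/nsqL20P; apply: ae_imp (uE _ _ e2) => E h RE.
  by change (u q2 E - ext (V y) E = 0); rewrite h// subrr.
Qed.

End Assembly.

Theorem theorem7p2 (R : realType)
    (mu : {measure set (measurableTypeR R) -> \bar R})
    (mu_Rpos : carried_by_Rpos mu)
    (mu_Carleson : Carleson mu)
    (mu_cofinite : cofinite_measure mu)
    (H_neq0 : ~ (forall f : R -> R[i], L2 (@lebesgue_measure R) f ->
       hankel mu f = (fun=> 0) %[ae @lebesgue_measure R in Rpos])) :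
  exists rho : {finite_measure set (measurableTypeR R) -> \bar R},
    carried_by_Rpos rho /\
    (forall f : R -> R[i], test_function f -> L2 rho (Theta mu f)) /\
    exists T : (R -> R[i]) -> (R -> R[i]),
      (* T extends Theta *)
      (forall f : R -> R[i], test_function f ->
         T f = Theta mu f %[ae rho in Rpos]) /\
      partial_isometry (@lebesgue_measure R) rho T /\
      L2onto (@lebesgue_measure R) rho T /\
      L2kernel (@lebesgue_measure R) rho T =
        L2kernel (@lebesgue_measure R) (@lebesgue_measure R) (hankel mu) /\
      (forall f : R -> R[i], test_function f ->
         (\int[rho]_(E in Rpos) (normc (Theta mu f E) ^+ 2)%:E)%E =
         ((L2norm (@lebesgue_measure R)
             (L2proj_closure (@lebesgue_measure R)
                (L2range (@lebesgue_measure R) (hankel mu)) f)) ^+ 2)%:E) /\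
      (forall f : R -> R[i], L2 (@lebesgue_measure R) f ->
         T (hankel mu f) = (fun E => E%:C * T f E) %[ae rho in Rpos]).
Proof.
have [mu' mu'E] := carleson_sigma_finite mu_Rpos mu_Carleson.
have [C Cb] := mu_Carleson; subst mu; have muS := schur_carleson Cb.
have [s [U [s0 [[U_DZ U_le] U_null U_K U_onto U_Theta]]]] :=
  spectral_transform muS mu_cofinite.
have H_cplx (x y : L2space (@lebesgue_measure R) (@mRpos R)) (t : R) : 0 < t ->
    hankel mu' (cplx x y) t = cplx (hankel_op muS x) (hankel_op muS y) t.
  by move=> t0; exact: hankelE.
have K_sym := hankel_sym muS.
exists s; split=> //; split.
  move=> f /U_Theta[x [y [z1 [z2 [_ TE _ _]]]]].
  by apply: L2_ext (cplx_L2 z1 z2) => E E0; rewrite TE.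
exists (Tc U); split.
  move=> f /U_Theta[x [y [z1 [z2 [-> TE h1 h2]]]]]; rewrite Tc_cplx.
  have /cplx_ae h : nsq (U x - z1) = 0 /\ nsq (U y - z2) = 0 by rewrite !(nsqBC (U _)).
  by apply: ae_imp h => E h RE; rewrite h// TE//; exact/RposP.
split; first exact: (Tc_partial_isometry K_sym U_DZ U_le U_null U_onto).
split; first exact: Tc_onto U_onto.
split; first exact: (Tc_kernel H_cplx U_null).
split; last by move=> f; exact: (Tc_intertwine H_cplx U_DZ U_le U_K).
move=> f /U_Theta[x [y [z1 [z2 [-> TE h1 h2]]]]].
rewrite (proj_norm K_sym H_cplx U_DZ U_null U_onto) sqr_sqrtr ?addr_ge0 ?nsq_ge0//.
rewrite -(nsqB0 h1) -(nsqB0 h2) -cplx_int.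
by apply: eq_integral => E /set_mem/RposP E0; rewrite TE.
Qed.
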